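(* Let $I=(-\frac12,\frac12)$, $K^R=\{(\alpha,\zeta)\in\mathbb R\times\mathbb R:|\alpha|+|\zeta|\le2\}$, and consider the one-dimensional problem of the context (with $\mathbb C\xi=\xi$). Let $V\in C^2(\mathbb R)$ satisfy $-M\le V''\le0$ for some constant $M\ge 0$, $V(\theta)=V(-\theta)$ for every $\theta$, and $V'(\theta)=-1$ if and only if $\theta\ge1$. Let $\boldsymbol w^R(t,y)=ty$, $u_0^R=0$, $e_0^R=0$, $p_0^R=0$ on $[-\frac12,\frac12]$, and let $z_0^R:[-\frac12,\frac12]\to\mathbb R$ be continuous with $z_0^R(0)=1>z_0^R(y)\ge0$ for every $y\ne0$. Let $(\boldsymbol u^R,\boldsymbol e^R,\boldsymbol\mu^R)$ be an approximable quasistatic evolution with boundary datum $\boldsymbol w^R$ and initial condition $(u_0^R,e_0^R,p_0^R,z_0^R)$. Then for every $t\in[0,+\infty)$ $$\boldsymbol u^R(t,y)=\begin{cases}ty&\text{if }t\in[0,1],\ y\in[-\frac12,\frac12],\\ y+\frac{t-1}2&\text{if }t\in(1,+\infty),\ y\in(0,\frac12],\\ y-\frac{t-1}2&\text{if }t\in(1,+\infty),\ y\in[-\frac12,0),\end{cases}$$ $$\boldsymbol e^R(t)=\min\{t,1\},\qquad \boldsymbol\mu^R_t=\delta_{(\boldsymbol p^R(t),\boldsymbol z^R(t))},$$ where $\boldsymbol p^R(t):=(t-1)^+\delta_0$, $\boldsymbol z^R(t):=z_0^R+(t-1)^+\delta_0$, and $\delta_0$ is the unit Dirac mass at $0$.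 Moreover, for every $T>0$, $\mathcal D_{H^R}(\boldsymbol\mu^R;0,T)=2(T-1)^+$, and the energy inequality holds with equality, i.e., with $\boldsymbol\sigma^R=\boldsymbol e^R$, $$\tfrac12\|\boldsymbol e^R(T)\|_2^2+\mathcal D_{H^R}(\boldsymbol\mu^R;0,T)+\langle\{V\}(\theta,\eta),\boldsymbol\mu^R_T(y,\beta,\theta,\eta)\rangle=\int_{-1/2}^{1/2}V(z_0^R)\,dy+\int_0^T\langle\boldsymbol\sigma^R(t),D\dot{\boldsymbol w}^R(t)\rangle\,dt.$$
   Context: $D$ denotes the derivative in $y$; norms and $\langle\cdot,\cdot\rangle$ (for functions) are those of $L^2(I)$. $(\cdot)^+$ is the positive part. Here $H^R(\xi,\theta)=\sup_{(\alpha,\zeta)\in K^R}(\alpha\xi+\zeta\theta)=2\max\{|\xi|,|\theta|\}$ and $N^\varepsilon_{K^R}(\alpha,\zeta)=\frac1\varepsilon((\alpha,\zeta)-P_{K^R}(\alpha,\zeta))$, with $P_{K^R}$ the orthogonal projection onto $K^R$. $V^\infty(\theta)=\lim_{t\to+\infty}V(t\theta)/t$; $\{V\}(\theta,\eta)=\eta V(\theta/\eta)$ if $\eta>0$, $=V^\infty(\theta)$ if $\eta\le0$. $M_b(\overline I;\Xi)$: bounded $\Xi$-valued Borel measures on $\overline I=[-\frac12,\frac12]$; $L^1$ functions are identified with measures. One-dimensional $\varepsilon$-regularized problem (Dirichlet condition at both endpoints $\pm\frac12$). A solution with boundary datum $\boldsymbol w$ and initial condition $(u_0,e_0,p_0,z_0)$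 is a quadruple with $\boldsymbol u_\varepsilon\in H^1_{loc}([0,+\infty);H^1(I))$ and $\boldsymbol e_\varepsilon,\boldsymbol p_\varepsilon,\boldsymbol z_\varepsilon\in H^1_{loc}([0,+\infty);L^2(I))$ such that: the values at $t=0$ are $(u_0,e_0,p_0,z_0)$; for every $t>0$, $D\boldsymbol u_\varepsilon(t)=\boldsymbol e_\varepsilon(t)+\boldsymbol p_\varepsilon(t)$ a.e. in $I$, $\boldsymbol u_\varepsilon(t,\pm\frac12)=\boldsymbol w(t,\pm\frac12)$, and the stress $\boldsymbol\sigma_\varepsilon(t)=\boldsymbol e_\varepsilon(t)$ satisfies $D\boldsymbol\sigma_\varepsilon(t)=0$ in $I$ (i.e. is constant in space); for a.e. $t>0$, $(\dot{\boldsymbol p}_\varepsilon(t),\dot{\boldsymbol z}_\varepsilon(t))=N^\varepsilon_{K^R}(\boldsymbol\sigma_\varepsilon(t),-V'(\boldsymbol z_\varepsilon(t)))$ a.e. in $I$. (It exists and is unique for each $\varepsilon>0$.) Generalized Young measures. For a finite dimensional Hilbert space $\Xi$, $C^{hom}(\overline I\times\Xi\times\mathbb R)$ is the Banach space of continuous $f(y,\xi,\eta)$ positively one-homogeneous in $(\xi,\eta)$, with the sup norm over $y\in\overline I$, $|\xi|^2+\eta^2=1$. $GY(\overline I;\Xi)$ is the set of $\mu$ in its dual such that $\langle f,\mu\rangle\ge0$ if $f\ge0$; $\langle f,\mu\rangle=0$ if $f$ vanishes on $\overline I\times\Xi\times[0,+\infty)$; $\langle\varphi(y)\eta,\mu\rangle=\int_I\varphi\,dy$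 for $\varphi\in C(\overline I)$. For $p\in M_b(\overline I;\Xi)$, $\delta_p\in GY(\overline I;\Xi)$ is $\langle f,\delta_p\rangle=\int_{\overline I}f(y,\frac{dp}{d\lambda},\frac{d\mathcal L^1}{d\lambda})\,d\lambda$ for any bounded positive $\lambda$ with $p,\mathcal L^1\ll\lambda$. $SGY([0,+\infty),\overline I;\Xi)$ is the set of families $\boldsymbol\mu=(\boldsymbol\mu_{t_1\dots t_m})$, $\boldsymbol\mu_{t_1\dots t_m}\in GY(\overline I;\Xi^m)$, indexed by finite increasing sequences in $[0,+\infty)$, such that whenever $\{s_1<\dots<s_n\}\subset\{t_1<\dots<t_m\}$, $\boldsymbol\mu_{s_1\dots s_n}$ is the image of $\boldsymbol\mu_{t_1\dots t_m}$ under $(y,\xi_{t_1},\dots,\xi_{t_m},\eta)\mapsto(y,\xi_{s_1},\dots,\xi_{s_n},\eta)$. For $\boldsymbol p:[0,+\infty)\to M_b(\overline I;\Xi)$, $(\boldsymbol\delta_{\boldsymbol p})_{t_1\dots t_m}:=\delta_{(\boldsymbol p(t_1),\dots,\boldsymbol p(t_m))}$. $\boldsymbol\mu$ is weakly$^*$ left-continuous if $\boldsymbol\mu_{s_1\dots s_m}\rightharpoonup\boldsymbol\mu_{t_1\dots t_m}$ weakly$^*$ as $s_i\to t_i$, $s_i\le t_i$. For $\Xi=\mathbb R\times\mathbb R$, $\mathcal D_{H^R}(\boldsymbol\mu;a,b)=\sup\sum_{i=1}^k\langle H^R(\beta_i-\beta_{i-1},\theta_i-\theta_{i-1}),\boldsymbol\mu_{t_0\dots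 t_k}(y,\beta_0,\theta_0,\dots,\beta_k,\theta_k,\eta)\rangle$ over all $a=t_0<\dots<t_k=b$. Definition. An approximable quasistatic evolution with boundary datum $\boldsymbol w$ and initial condition $(u_0,e_0,p_0,z_0)$ is a triple $(\boldsymbol u,\boldsymbol e,\boldsymbol\mu)$ with $\boldsymbol u\in L^\infty_{loc}([0,+\infty);BV(I))$, $\boldsymbol e\in L^\infty_{loc}([0,+\infty);L^2(I))$, $\boldsymbol\mu\in SGY([0,+\infty),\overline I;\mathbb R\times\mathbb R)$, all weakly$^*$ left-continuous, for which there exist a positive sequence $\varepsilon_k\to0$ and $\Theta\subset[0,+\infty)$ containing $0$, with $\mathcal L^1([0,+\infty)\setminus\Theta)=0$, such that the solutions of the $\varepsilon_k$-regularized problems with the same data satisfy $\boldsymbol u_{\varepsilon_k}(t)\rightharpoonup\boldsymbol u(t)$ weakly$^*$ in $BV(I)$ and $\boldsymbol e_{\varepsilon_k}(t)\rightharpoonup\boldsymbol e(t)$ weakly in $L^2(I)$ for every $t\in\Theta$, and $(\boldsymbol\delta_{(\boldsymbol p_{\varepsilon_k},\boldsymbol z_{\varepsilon_k})})_{t_1\dots t_m}\rightharpoonup\boldsymbol\mu_{t_1\dots t_m}$ weakly$^*$ for every $t_1<\dots<t_m$ in $\Theta$. *)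

(* Defs.v *)
From HB Require Import structures.
From mathcomp Require Import all_boot all_order all_algebra.
From mathcomp Require Import all_classical all_reals all_analysis.

Set Implicit Arguments.
Unset Strict Implicit.
Unset Printing Implicit Defensive.
Import Order.TTheory GRing.Theory Num.Theory.
Import numFieldNormedType.Exports.
Local Open Scope ring_scope.
Local Open Scope classical_set_scope.

(* Functions on I are encoded as functions on R of which only the values on I
   matter; likewise functions of time are only considered on [0, +oo[. *)

Section Spaces.
Context {R : realType}.
Notation mu := (@lebesgue_measure R).
Implicit Types (f g phi : R -> R) (nu : {charge set (measurableTypeR R) -> \bar R}).

Definition I : set R := `]- 2^-1, 2^-1[.
Definition Ibar : set R := `[- 2^-1, 2^-1].

Definition half_line : set R := `[0, +oo[.

Definition ae_eqI f g := {ae mu, forall y, I y -> f y = g y}.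

Definition L1 f := mu.-integrable I (EFin \o f).
Definition L2 f := f \_ I \in Lfun mu 2%:E.
Definition normL2 f : \bar R := 'N[mu]_(2%:E)[EFin \o (f \_ I)].
Definition ip f g : R := \int[mu]_(y in I) (f y * g y).

(* C^1_c(I), the functions being extended by 0 outside I *)
Definition test_fun phi :=
  [/\ forall x, derivable phi x 1, continuous phi^`() &
      exists a b, [/\ - 2^-1 < a, b < 2^-1 &
                      forall x, ~ (a <= x <= b) -> phi x = 0]].

(* C_0(I), the predual of the bounded measures on I *)
Definition C0 phi :=
  [/\ {within Ibar, continuous phi}, phi (- 2^-1) = 0 & phi (2^-1) = 0].

Definition weak_deriv f g :=
  forall phi, test_fun phi -> ip f phi^`() = - ip g phi.

Definition H1 f := L2 f /\ exists g, L2 g /\ weak_deriv f g.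

(* boundary values of an H^1 function, read on its continuous representative *)
Definition has_boundary_values f (a b : R) :=
  exists v, [/\ {within Ibar, continuous v}, ae_eqI f v,
                v (- 2^-1) = a & v (2^-1) = b].

Definition hahn_pos nu : set R := sval (cid (Hahn_decomposition nu)).
Definition hahn_neg nu : set R :=
  sval (cid (svalP (cid (Hahn_decomposition nu)))).
Lemma hahn_posneg nu : hahn_decomposition nu (hahn_pos nu) (hahn_neg nu).
Proof. exact: (svalP (cid (svalP (cid (Hahn_decomposition nu))))). Qed.

(* integral over I with respect to a signed measure, and |nu|(I) *)
Definition charge_int nu phi : R :=
  \int[jordan_pos (hahn_posneg nu)]_(y in I) phi y -
  \int[jordan_neg (hahn_posneg nu)]_(y in I) phi y.
Definition charge_var nu : \bar R := charge_variation (hahn_posneg nu) I.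

Definition measure_deriv f nu :=
  forall phi, test_fun phi -> ip f phi^`() = - charge_int nu phi.

Definition BV_wstar_cvg (S : Type) (F : set_system S) (f_ : S -> R -> R) f :=
  (\int[mu]_(y in I) `|f_ s y - f y|%:E)%E @[s --> F] --> 0%:E /\
  exists (nu_ : S -> {charge set (measurableTypeR R) -> \bar R}) nu,
    [/\ \forall s \near F, L1 (f_ s) /\ measure_deriv (f_ s) (nu_ s),
        L1 f, measure_deriv f nu &
        forall phi, C0 phi ->
          charge_int (nu_ s) phi @[s --> F] --> charge_int nu phi].

Definition L2_weak_cvg (S : Type) (F : set_system S) (f_ : S -> R -> R) f :=
  forall g, L2 g -> ip (f_ s) g @[s --> F] --> ip f g.

(* s -> t with 0 <= s <= t *)
Definition from_left (t : R) : set_system R :=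
  within [set s | 0 <= s <= t] (nbhs t).

Implicit Types (v vdot : R -> R -> R).

Definition L2loc_L2 v :=
  measurable_fun (half_line `*` I) (fun x => v x.1 x.2) /\
  forall T, (\int[mu]_(t in `[0%R, T]) normL2 (v t) ^+ 2 < +oo)%E.

Definition L2loc_H1 v :=
  L2loc_L2 v /\ exists Dv, L2loc_L2 Dv /\
    {ae mu, forall t, 0 <= t -> weak_deriv (v t) (Dv t)}.

(* v(t) = v(0) + \int_0^t vdot(s) ds in L^2(I) for every t >= 0; as vdot is
   jointly measurable, the Bochner integral is computed pointwise in y. *)
Definition primitive_of v vdot :=
  forall t, 0 <= t ->
    ae_eqI (v t) (fun y => v 0 y + \int[mu]_(s in `[0, t]) vdot s y).

(* H^1_loc([0,+oo); X), X = L^2(I) or H^1(I), with time derivative vdot; v is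
   the continuous representative *)
Definition H1loc_L2 v vdot :=
  [/\ forall t, 0 <= t -> L2 (v t), L2loc_L2 vdot & primitive_of v vdot].
Definition H1loc_H1 v vdot :=
  [/\ forall t, 0 <= t -> H1 (v t), L2loc_H1 vdot & primitive_of v vdot].

(* L^oo_loc([0,+oo); L^2(I)), v being defined for every t >= 0 *)
Definition Linfloc_L2 v :=
  [/\ forall t, 0 <= t -> L2 (v t),
      forall g, L2 g -> measurable_fun half_line (fun t => ip (v t) g) &
      forall T, exists C : R,
        {ae mu, forall t, 0 <= t <= T -> (normL2 (v t) <= C%:E)%E}].

(* L^oo_loc([0,+oo); BV(I)), BV(I) being a dual space: weak* measurability *)
Definition Linfloc_BV v :=
  exists nu : R -> {charge set (measurableTypeR R) -> \bar R},
  [/\ forall t, 0 <= t -> L1 (v t) /\ measure_deriv (v t) (nu t),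
      forall phi, C0 phi ->
        measurable_fun half_line (fun t => ip (v t) phi) /\
        measurable_fun half_line (fun t => charge_int (nu t) phi) &
      forall T, exists C : R, {ae mu, forall t, 0 <= t <= T ->
        (\int[mu]_(y in I) `|v t y|%:E + charge_var (nu t) <= C%:E)%E}].

End Spaces.

Section Plasticity.
Context {R : realType}.
Notation mu := (@lebesgue_measure R).

Definition KR : set (R * R) := [set x | `|x.1| + `|x.2| <= 2].

(* support function of K^R *)
Definition HR (xi theta : R) : R :=
  sup [set x.1 * xi + x.2 * theta | x in KR].

(* R * R carries the sup norm in the library, whence the explicit formula *)
Definition eucl_dist (x q : R * R) : R :=
  Num.sqrt ((x.1 - q.1) ^+ 2 + (x.2 - q.2) ^+ 2).

Definition proj (K : set (R * R)) (x : R * R) : R * R :=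
  xget 0 [set q | K q /\ forall r, K r -> eucl_dist x q <= eucl_dist x r].

Definition Neps (eps : R) (K : set (R * R)) (x : R * R) : R * R :=
  eps^-1 *: (x - proj K x).

(* sigma = e, since C xi = xi *)
Definition eps_solution (eps : R) (V : R -> R) (w : R -> R -> R)
    (u0 e0 p0 z0 : R -> R) (u e p z : R -> R -> R) :=
  exists udot edot pdot zdot : R -> R -> R,
  [/\ [/\ H1loc_H1 u udot, H1loc_L2 e edot, H1loc_L2 p pdot & H1loc_L2 z zdot],
      [/\ ae_eqI (u 0) u0, ae_eqI (e 0) e0, ae_eqI (p 0) p0 & ae_eqI (z 0) z0],
      forall t, 0 < t ->
        [/\ weak_deriv (u t) (fun y => e t y + p t y),
            has_boundary_values (u t) (w t (- 2^-1)) (w t (2^-1)) &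
            weak_deriv (e t) (cst 0)] &
      {ae mu, forall t, 0 < t -> {ae mu, forall y, I y ->
        (pdot t y, zdot t y) = Neps eps KR (e t y, - (V^`()%classic) (z t y))}}].

Definition Vinf (V : R -> R) (theta : R) : R :=
  lim (V (t * theta) / t @[t --> +oo]).

Definition persp (V : R -> R) (theta eta : R) : R :=
  if 0 < eta then eta * V (theta / eta) else Vinf V theta.

End Plasticity.

(* Xi = R^d; a point of Xi^m is an m x d matrix whose i-th row is xi_i. *)
Section YoungMeasures.
Context {R : realType}.
Notation mu := (@lebesgue_measure R).
Notation charge := ({charge set (measurableTypeR R) -> \bar R})%R.

Definition integrand (m d : nat) := R -> 'M[R]_(m, d) -> R -> R.

Definition Chom m d (f : integrand m d) :=
  {within [set x : R * 'M[R]_(m, d) * R | Ibar x.1.1],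
     continuous (fun x => f x.1.1 x.1.2 x.2)} /\
  forall y xi eta s, Ibar y -> 0 <= s ->
    f y (s *: xi) (s * eta) = s * f y xi eta.

Definition Chom_norm m d (f : integrand m d) : R :=
  sup [set r | exists (y : R) (xi : 'M[R]_(m, d)) (eta : R),
    [/\ Ibar y, \sum_i \sum_j xi i j ^+ 2 + eta ^+ 2 = 1 &
        r = `|f y xi eta|]].

(* elements of the dual of C^hom; values outside C^hom are irrelevant *)
Definition functional (m d : nat) := integrand m d -> R.

Definition Chom_dual m d (nu : functional m d) :=
  (forall a f g, Chom f -> Chom g ->
     nu (fun y xi eta => a * f y xi eta + g y xi eta) = a * nu f + nu g) /\
  (exists C, forall f, Chom f -> `|nu f| <= C * Chom_norm f).

Definition GY m d (nu : functional m d) :=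
  [/\ Chom_dual nu,
      forall f, Chom f -> (forall y xi eta, Ibar y -> 0 <= f y xi eta) ->
        0 <= nu f,
      forall f, Chom f ->
        (forall y xi eta, Ibar y -> 0 <= eta -> f y xi eta = 0) -> nu f = 0 &
      forall phi : R -> R, {within Ibar, continuous phi} ->
        nu (fun y _ eta => phi y * eta) = \int[mu]_(y in I) phi y].

(* the element of M_b(Ibar) with density f on I (0 if f is not integrable) *)
Definition L1_charge (f : R -> R) : charge :=
  match pselect (mu.-integrable setT (EFin \o (f \_ I))) with
  | left h => induced_charge h
  | right _ => @czero _ (measurableTypeR R) R
  end.

Definition dirac_charge (a : R) : charge :=
  charge_of_finite_measure (@dirac _ (measurableTypeR R) a R).

(* An element of M_b(Ibar; Xi^m) is a matrix of signed measures carried by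
   Ibar. By one-homogeneity of f, delta_pairing lam p f does not depend on lam
   as long as dominating p lam holds. *)
Definition dominating m d (p : 'I_m -> 'I_d -> charge)
    (lam : {finite_measure set (measurableTypeR R) -> \bar R}) :=
  (forall i j, p i j `<< lam) /\ L1_charge (cst 1) `<< lam.

Definition delta_pairing m d
    (lam : {finite_measure set (measurableTypeR R) -> \bar R})
    (p : 'I_m -> 'I_d -> charge) (f : integrand m d) : R :=
  \int[lam]_(y in Ibar)
    f y (\matrix_(i, j) fine (Radon_Nikodym (p i j) lam y))
        (fine (Radon_Nikodym (L1_charge (cst 1)) lam y)).

Definition is_delta m d (p : 'I_m -> 'I_d -> charge) (nu : functional m d) :=
  forall lam, dominating p lam -> forall f, Chom f ->
    nu f = delta_pairing lam p f.

(* delta_{p_k} converges weakly* to nu *)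
Definition delta_wstar_cvg m d (p_ : nat -> 'I_m -> 'I_d -> charge)
    (nu : functional m d) :=
  forall lam_ : nat -> {finite_measure set (measurableTypeR R) -> \bar R},
    (forall k, dominating (p_ k) (lam_ k)) -> forall f, Chom f ->
      delta_pairing (lam_ k) (p_ k) f @[k --> \oo] --> nu f.

Definition times m (t : 'rV[R]_m) :=
  (forall i, 0 <= t 0 i) /\ (forall i j : 'I_m, (i < j)%N -> t 0 i < t 0 j).

Definition time_family (d : nat) := forall m, 'rV[R]_m -> functional m d.

(* s = colsub h t ranges over the subsequences of t *)
Definition SGY d (nu : time_family d) :=
  (forall m (t : 'rV[R]_m), times t -> GY (nu m t)) /\
  (forall m n (h : 'I_n -> 'I_m) (t : 'rV[R]_m), times t ->
     times (colsub h t) -> forall f : integrand n d, Chom f ->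
       nu n (colsub h t) f = nu m t (fun y xi eta => f y (rowsub h xi) eta)).

Definition SGY_left_continuous d (nu : time_family d) :=
  forall m (t : 'rV[R]_m), times t -> forall f, Chom f ->
    nu m s f @[s --> within [set s | times s /\ forall i, s 0 i <= t 0 i]
                            (nbhs t)] --> nu m t f.

Definition pair_charge (p z : charge) (j : 'I_2) : charge :=
  if j == 0 then p else z.

(* row i of x is (beta_i, theta_i) *)
Definition dissipation (nu : time_family 2) (a b : R) : \bar R :=
  ereal_sup [set r | exists k (t : 'rV[R]_k.+1),
    [/\ times t, t 0 ord0 = a, t 0 ord_max = b &
        r = (\sum_(i < k) nu k.+1 t (fun _ x _ =>
               HR (x (lift ord0 i) 0 - x (widen_ord (leqnSn k) i) 0)
                  (x (lift ord0 i) 1 - x (widen_ord (leqnSn k) i) 1)))%:E]].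

Definition approximable_evolution (V : R -> R) (w : R -> R -> R)
    (u0 e0 p0 z0 : R -> R) (u e : R -> R -> R) (nu : time_family 2) :=
  [/\ [/\ Linfloc_BV u, Linfloc_L2 e & SGY nu],
      [/\ forall t, 0 <= t -> BV_wstar_cvg (from_left t) u (u t),
          forall t, 0 <= t -> L2_weak_cvg (from_left t) e (e t) &
          SGY_left_continuous nu] &
      exists (eps_ : nat -> R) (Theta : set R)
             (u_ e_ p_ z_ : nat -> R -> R -> R),
      [/\ (forall k, 0 < eps_ k) /\ eps_ @ \oo --> 0,
          [/\ Theta `<=` half_line, Theta 0 &
              mu.-negligible (half_line `\` Theta)],
          forall k, eps_solution (eps_ k) V w u0 e0 p0 z0
                      (u_ k) (e_ k) (p_ k) (z_ k),
          forall t, Theta t ->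
            BV_wstar_cvg \oo (fun k => u_ k t) (u t) /\
            L2_weak_cvg \oo (fun k => e_ k t) (e t) &
          forall m (t : 'rV[R]_m), times t -> (forall i, Theta (t 0 i)) ->
            delta_wstar_cvg (fun k i =>
                pair_charge (L1_charge (p_ k (t 0 i))) (L1_charge (z_ k (t 0 i))))
              (nu m t)]].

Definition wR (t y : R) : R := t * y.

End YoungMeasures.

(* Main.v *)
(** By the boundary values the stress of the regularized problem is the constant
    t - int p(t).  Pointwise in y, the projection onto K^R moves p and z by the
    same nonnegative amount max (stress - V'(z) - 2) 0 / (2 eps), so that z = z0 + p
    with p nondecreasing in time.  Hence the stress is t up to time 1.  Afterwards
    it stays above 1, and for small eps it cannot exceed 1 by much: near y = 0,
    where - V'(z0) is close to 1, the plastic rate would outrun the loading.  Away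
    from 0 the point (stress, - V'(z0)) then lies inside K^R, p vanishes, and p(t)
    concentrates at 0 with mass t - 1.  Homogeneity turns this into convergence of
    the Young measures, the multi-time dissipation being linear in p because p is
    monotone; left continuity gives the remaining times. *)
Require Import Defs.
From HB Require Import structures.
From mathcomp Require Import all_boot all_order all_algebra.
From mathcomp Require Import all_classical all_reals all_analysis.
From mathcomp Require Import measurable_realfun ring lra.
Set Implicit Arguments.
Unset Strict Implicit.
Unset Printing Implicit Defensive.
Import Order.TTheory GRing.Theory Num.Theory.
Import numFieldNormedType.Exports.
Local Open Scope ring_scope.
Local Open Scope classical_set_scope.

(** The obstacle is a circle: the explicit form of the projection is available only while the stress
    lies in [-1/4, 3/2] and the force - V'(z) is at least -1/4, but these bounds are consequences of
    the explicit flow. The flow is therefore used in conditional form, and continuity in time closes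
    the circle: the estimates valid up to the first exit from the window place the stress in
    [0, 5/4], strictly inside it. A second difficulty is the order of quantifiers. The equation
    holds for almost every t and then almost every y, the pointwise argument needs the converse, and
    the exchange requires a product measurable exceptional set; hence p and z are replaced by time
    primitives of their jointly measurable rates. The threshold on eps is a product r1 d: where |y|
    <= r1 and the stress exceeds 1 + 2 d, the plastic rate is at least d / (2 eps) >= 1 / (2 r1),
    and its mean over that zone balances the unit loading rate. Of the regularized solutions the
    limit passage keeps only [concentrated r], which holds for every r once eps is small enough. *)

(** * Continuity barriers for functions of time *)

Section Barrier.
Context {R : realType}.
Implicit Types (f Z : R -> R) (a b c d T : R).

Lemma compact_level_set f a b c : {within `[a, b], continuous f} ->
  compact (`[a, b]%classic `&` f @^-1` [set c]).
Proof.
move=> cf.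
have : closed (f @^-1` [set c] : set (subspace `[a, b])).
  by move/continuous_closedP : cf; apply; exact: closed_eq.
move=> /closed_subspaceP[W cW WE].
by rewrite setIC -WE setIC; apply: compact_closedI => //; exact: segment_compact.
Qed.

Lemma within_sub_itv f a b s t : {within `[a, b], continuous f} ->
  a <= s -> t <= b -> {within `[s, t], continuous f}.
Proof.
move=> cf sa tb; apply: continuous_subspaceW cf => x /=.
by rewrite !in_itv /= => /andP[? ?]; apply/andP; split; lra.
Qed.

(** The level set is compact and has a least element; a value at or above [c] before it would give,
    by the intermediate value theorem, an earlier point of the level set. *)
Lemma first_hit f a b c : a <= b -> {within `[a, b], continuous f} ->
  f a <= c -> c <= f b ->
  exists t, [/\ a <= t <= b, f t = c & forall s, a <= s < t -> f s < c].
Proof.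
move=> ab cf fa fb.
have A0 : (`[a, b]%classic `&` f @^-1` [set c]) !=set0.
  have [|t tab ft] := IVT ab cf (v := c); last by exists t.
  by rewrite ge_min le_max fa fb ?orbT.
have cid A : {within A, continuous (@idfun R)}.
  by apply: continuous_subspaceT => x; exact: cvg_id.
have [t] := compact_EVT_min A0 (compact_level_set (c:=c) cf) (@cid _).
rewrite inE => -[/=]; rewrite in_itv /= => tab ft tmin; exists t; split => // s /andP[as_ st].
rewrite ltNge; apply/negP => fs.
have sb : s <= b by lra.
have [|r rab fr] := IVT as_ (within_sub_itv cf (lexx _) sb) (v := c).
  by rewrite ge_min le_max fa fs ?orbT.
move: rab; rewrite in_itv /= => /andP[r1 r2].
by have := tmin r; rewrite inE /= in_itv /= r1 (le_trans r2 sb) => /(_ (conj isT fr)); lra.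
Qed.

Lemma last_hit f a b c : a <= b -> {within `[a, b], continuous f} ->
  c <= f a -> f b <= c ->
  exists t, [/\ a <= t <= b, f t = c & forall s, t < s <= b -> f s < c].
Proof.
move=> ab cf fa fb.
have A0 : (`[a, b]%classic `&` f @^-1` [set c]) !=set0.
  have [|t tab ft] := IVT ab cf (v := c); last by exists t.
  by rewrite ge_min le_max fa fb ?orbT.
have cid A : {within A, continuous (@idfun R)}.
  by apply: continuous_subspaceT => x; exact: cvg_id.
have [t] := compact_EVT_max A0 (compact_level_set (c:=c) cf) (@cid _).
rewrite inE => -[/=]; rewrite in_itv /= => tab ft tmax; exists t; split => // s /andP[ts sb].
rewrite ltNge; apply/negP => fs.
have as_ : a <= s by lra.
have [|r rab fr] := IVT sb (within_sub_itv cf as_ (lexx _)) (v := c).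
  by rewrite ge_min le_max fb fs ?orbT.
move: rab; rewrite in_itv /= => /andP[r1 r2].
by have := tmax r; rewrite inE /= in_itv /= (le_trans as_ r1) r2 => /(_ (conj isT fr)); lra.
Qed.

(* Z may be controlled only as long as it stays above c; leaving [c, d]
   downwards would require Z to decrease inside the strip. *)
Lemma barrier Z T c d : c < d -> {within `[0, T], continuous Z} -> d <= Z 0 ->
  (forall t0 t1, 0 <= t0 <= t1 -> t1 <= T ->
     (forall s, 0 <= s <= t1 -> c <= Z s) ->
     (forall s, t0 < s <= t1 -> Z s <= d) -> Z t0 <= Z t1) ->
  forall t, 0 <= t <= T -> d <= Z t.
Proof.
move=> cd cZ Z0 hZ t /andP[t0 tT]; rewrite leNgt; apply/negP => Zt.
(* The level [c'] lies in [c, d[ and is reached no later than [t]. Between the last visit to [d]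
   before that hit and the hit itself, [Z] stays in the strip and decreases, against the
   hypothesis. *)
pose c' := Num.max c (Z t).
have c'd : c' < d by rewrite gt_max cd Zt.
have cc' : c <= c' by rewrite le_max lexx.
have Zc' : Z t <= c' by rewrite le_max lexx orbT.
have cNZ : {within `[0, t], continuous (- Z)%R}.
  by move=> x; apply: continuousN; exact: (within_sub_itv cZ (lexx _) tT).
have [| |t1 [/andP[t10 t1t] Zt1 hb]] := first_hit t0 cNZ (c := - c').
- by rewrite /= fctE lerN2; lra.
- by rewrite /= fctE lerN2.
have {}Zt1 : Z t1 = c' by move: Zt1; rewrite fctE => /oppr_inj.
have {}hb s : 0 <= s <= t1 -> c' <= Z s.
  move=> /andP[s0]; rewrite le_eqVlt => /orP[/eqP ->|st]; first by rewrite Zt1.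
  by have := hb s; rewrite s0 st => /(_ isT); rewrite fctE ltrN2 => /ltW.
have cZ1 : {within `[0, t1], continuous Z}.
  by apply: within_sub_itv cZ _ _ => //; lra.
have [||t2 [/andP[t20 t21] Zt2 hd]] := last_hit t10 cZ1 (c := d).
- exact: Z0.
- by rewrite Zt1 ltW.
suff : Z t2 <= Z t1 by lra.
apply: hZ; rewrite ?t20 ?t21 ?(le_trans t1t tT) // => s h.
  exact: le_trans cc' (hb _ h).
exact/ltW/hd.
Qed.

End Barrier.

(** * The projection onto K^R and its support function *)

Section Projection.
Context {R : realType}.
Implicit Types (q r x : R * R) (s zeta eps h : R).

(** How far (s, zeta) lies beyond the face x1 + x2 = 2, in multiples of the normal (1, 1); the half
    appears because a shift by h (1, 1) changes the sum by 2 h. *)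
Definition overshoot s zeta : R := Num.max (s + zeta - 2) 0 / 2.

(** The vector (1, 1) is normal to the face x1 + x2 = 2, and the complementarity relation puts [q]
    on that face as soon as [h] is nonzero. *)
Lemma proj_KR_diag q h : KR q -> 0 <= h -> h * (2 - (q.1 + q.2)) = 0 ->
  Defs.proj KR (q.1 + h, q.2 + h) = q.
Proof.
move=> Kq h0 hq; pose x := (q.1 + h, q.2 + h).
(* the variational inequality (x - q) . (r - q) <= 0 on KR *)
have var r : KR r ->
    (x.1 - q.1) ^+ 2 + (x.2 - q.2) ^+ 2 + ((r.1 - q.1) ^+ 2 + (r.2 - q.2) ^+ 2)
    <= (x.1 - r.1) ^+ 2 + (x.2 - r.2) ^+ 2.
  rewrite /KR /= => Kr.
  have r2 : r.1 + r.2 <= 2 by apply: le_trans Kr; rewrite lerD // ler_norm.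
  have : h * (r.1 + r.2) <= h * 2 by rewrite ler_wpM2l.
  by nra.
rewrite /Defs.proj; apply: xget_unique => [|r [Kr rmin]].
  split=> // r Kr; rewrite /eucl_dist ler_wsqrtr //.
  by apply: le_trans (var _ Kr); rewrite lerDl addr_ge0 // sqr_ge0.
have := rmin _ Kq; rewrite /eucl_dist.
have n0 (a b : R) : 0 <= a ^+ 2 + b ^+ 2 by rewrite addr_ge0 // sqr_ge0.
(* Minimality of [r], set against the variational inequality, leaves no room for a nonzero distance
   from [q]. *)
rewrite ler_sqrt // => le1; have le2 := var _ Kr.
have le0 : (r.1 - q.1) ^+ 2 + (r.2 - q.2) ^+ 2 <= 0.
  by move: le1 le2; rewrite /x /=; lra.
have e1 : (r.1 - q.1) ^+ 2 = 0.
  by apply/eqP; rewrite eq_le sqr_ge0 andbT (le_trans _ le0) // lerDl sqr_ge0.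
have e2 : (r.2 - q.2) ^+ 2 = 0.
  by apply/eqP; rewrite eq_le sqr_ge0 andbT (le_trans _ le0) // lerDr sqr_ge0.
move/eqP: e1; rewrite sqrf_eq0 subr_eq0 => /eqP e1.
move/eqP: e2; rewrite sqrf_eq0 subr_eq0 => /eqP e2.
by rewrite (surjective_pairing r) (surjective_pairing q) e1 e2.
Qed.

(** In this window only the face with normal (1, 1) matters: a point with s + zeta < 2 already lies
    in [KR], and any other one has a foot with nonnegative coordinates. The margins below 0 and
    above 1 leave room for the continuity arguments in time. *)
Lemma Neps_KR eps s zeta : - 4^-1 <= s <= 3 / 2 -> - 4^-1 <= zeta <= 1 ->
  Neps eps KR (s, zeta) = (overshoot s zeta / eps, overshoot s zeta / eps).
Proof.
move=> /andP[s1 s2] /andP[z1 z2]; pose h := overshoot s zeta.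
suff : Defs.proj KR (s, zeta) = (s - h, zeta - h).
  move=> pE; rewrite /Neps pE; congr (_, _).
    by rewrite -[LHS]/(eps^-1 * (s - (s - h))) subKr mulrC.
  by rewrite -[LHS]/(eps^-1 * (zeta - (zeta - h))) subKr mulrC.
have h0 : 0 <= h by rewrite /h /overshoot divr_ge0 // le_max lexx orbT.
have -> : (s, zeta) = ((s - h, zeta - h).1 + h, (s - h, zeta - h).2 + h).
  by rewrite /= !subrK.
apply: proj_KR_diag => //.
  rewrite /KR /= /h /overshoot maxElt; case: ifPn => k.
    by rewrite mul0r !subr0; have [|] := ger0P s; have [|] := ger0P zeta; lra.
  by have [|] := ger0P (s - _); have [|] := ger0P (zeta - _); lra.
rewrite /h /overshoot maxElt; case: ifPn => k /=; first by rewrite mul0r mul0r.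
by apply/eqP; rewrite mulf_eq0; apply/orP; right; apply/eqP; lra.
Qed.

Lemma overshoot_ge0 s zeta : 0 <= overshoot s zeta.
Proof. by rewrite divr_ge0 // le_max lexx orbT. Qed.

Lemma overshoot_eq0 s zeta : s + zeta <= 2 -> overshoot s zeta = 0.
Proof. by move=> h; rewrite /overshoot max_r ?mul0r //; lra. Qed.

Lemma overshoot_ge s zeta : (s + zeta - 2) / 2 <= overshoot s zeta.
Proof. by rewrite ler_pM2r // le_max lexx. Qed.

Lemma HR_diag (a : R) : 0 <= a -> HR a a = 2 * a.
Proof.
move=> a0; apply/eqP; rewrite eq_le; apply/andP; split.
  apply: ge_sup => [|_ [x Kx <-]].
    by exists 0; exists (0, 0); rewrite /KR /= ?normr0 ?mul0r ?addr0.
  rewrite -mulrDl ler_wpM2r //; apply: le_trans Kx.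
  by rewrite lerD // ler_norm.
apply: ub_le_sup; last first.
  by exists (1, 1) => /=; rewrite /KR /= ?normr1 //; lra.
exists (2 * a) => _ [x Kx <-].
rewrite -mulrDl ler_wpM2r //; apply: le_trans Kx.
by rewrite lerD // ler_norm.
Qed.

(** The supremum over the l1 ball of radius 2 is attained at a vertex on the axis of the larger
    coordinate. *)
Lemma HR_max (a b : R) : HR a b = 2 * Num.max `|a| `|b|.
Proof.
have ub x : KR x -> x.1 * a + x.2 * b <= 2 * Num.max `|a| `|b|.
  rewrite /KR /= => Kx.
  have m0 : 0 <= Num.max `|a| `|b| by rewrite le_max normr_ge0.
  apply: le_trans (ler_wpM2r m0 Kx); rewrite mulrDl.
  apply: le_trans (ler_norm _) _; apply: le_trans (ler_normD _ _) _.
  by rewrite !normrM lerD // ler_wpM2l // le_max lexx ?orbT.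
apply/eqP; rewrite eq_le; apply/andP; split.
  apply: ge_sup => [|_ [x Kx <-]]; last exact: ub.
  by exists 0; exists (0, 0); rewrite /KR /= ?normr0 ?mul0r ?addr0.
apply: ub_le_sup; first by exists (2 * Num.max `|a| `|b|) => _ [x Kx <-]; exact: ub.
have sgK c : `|Num.sg c * 2| <= 2 :> R.
  by rewrite normrM normr_sg (ger0_norm (x := 2)) // ler_piMl // lern1 leq_b1.
have [ab|ab] := leP `|a| `|b|.
  exists (0, Num.sg b * 2) => /=; first by rewrite /KR /= normr0 add0r.
  by rewrite mul0r add0r (mulrC _ 2) -mulrA -normrEsg.
exists (Num.sg a * 2, 0) => /=; first by rewrite /KR /= normr0 addr0.
by rewrite mul0r addr0 (mulrC _ 2) -mulrA -normrEsg.
Qed.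

End Projection.

(** * The driving force - V' and the shape of V *)

Section DrivingForce.
Context {R : realType}.
Variables (V : R -> R) (M : R).
Hypothesis hV1 : forall x, derivable V x 1.
Hypothesis hV2 : forall x, derivable (derive1 V) x 1.
Hypothesis hV2b : forall x, - M <= V^`(2) x <= 0.
Hypothesis hVeven : forall x, V x = V (- x).
Hypothesis hV'1 : forall x, derive1 V x = -1 <-> 1 <= x.

Lemma derivable_continuous (f : R -> R) :
  (forall x, derivable f x 1) -> continuous f.
Proof. by move=> df x; apply/differentiable_continuous/derivable1_diffP. Qed.

Lemma is_derive_derive1 (f : R -> R) x :
  derivable f x 1 -> is_derive x 1 f (derive1 f x).
Proof. by move=> df; rewrite derive1E; exact: derivableP. Qed.

Lemma derive1_driving : derive1 (derive1 V) = V^`(2).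
Proof. by rewrite derive1nS derive1n1. Qed.

Lemma driving_nincr x y : x <= y -> derive1 V y <= derive1 V x.
Proof.
rewrite le_eqVlt => /orP[/eqP -> //|xy].
have [z _||c _] := @MVT _ (derive1 V) (derive1 (derive1 V)) _ _ xy.
- exact: is_derive_derive1.
- exact/continuous_subspaceT/derivable_continuous.
rewrite derive1_driving => e; have /andP[_ c0] := hV2b c.
by rewrite -subr_le0 e mulr_le0_ge0 // subr_ge0 ltW.
Qed.

Lemma driving_odd x : (derive1 V) (- x) = - derive1 V x.
Proof.
have -> : derive1 V x = derive1 (V \o -%R) x.
  by congr derive1; apply/funext => y /=; exact: hVeven.
have dN : derive1 (-%R : R -> R) x = -1.
  by have := @derive1N _ (@id R) x (@derivable_id _ _ _ _); rewrite derive1_id.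
have := @derive1_comp _ -%R V x.
by rewrite dN mulrN1 => ->; rewrite ?opprK //; exact: (@derivableN _ _ _ id).
Qed.

Lemma driving0 : (derive1 V) 0 = 0.
Proof. by have := driving_odd 0; rewrite oppr0; lra. Qed.

(** A nonincreasing function that equals -1 from 1 on cannot be smaller before. *)
Lemma driving_ge x : -1 <= derive1 V x.
Proof.
have [/hV'1 -> //|x1] := leP 1 x.
by rewrite -(hV'1 1).2 //; exact/driving_nincr/ltW.
Qed.

Lemma driving_le0 x : 0 <= x -> derive1 V x <= 0.
Proof. by move=> x0; rewrite -driving0; exact: driving_nincr. Qed.

Lemma driving_gt x : x < 1 -> -1 < derive1 V x.
Proof.
move=> x1; rewrite lt_neqAle driving_ge andbT eq_sym; apply/eqP.
by rewrite hV'1; lra.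
Qed.

Lemma driving_continuous : continuous (derive1 V).
Proof. exact: derivable_continuous. Qed.

(** Beyond 1 the slope is constantly -1, and evenness reflects this to the left. This is what
    determines the recession function of [V]. *)
Lemma V_far x : 1 <= `|x| -> V x = V 1 - (`|x| - 1).
Proof.
wlog x0 : x / 0 <= x => [hw|].
  have [/hw//|/ltW] := leP 0 x; rewrite -oppr_ge0 => /hw.
  by rewrite normrN -hVeven.
rewrite ger0_norm // le_eqVlt => /orP[/eqP <-|x1]; first by rewrite subrr subr0.
have [z _||c cx] := @MVT _ V (derive1 V) _ _ x1.
- exact: is_derive_derive1.
- exact/continuous_subspaceT/derivable_continuous.
have -> : derive1 V c = -1 by apply/hV'1; move: cx; rewrite in_itv /= => /andP[/ltW].
lra.
Qed.

End DrivingForce.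

(** * Real-valued integrals and almost everywhere comparisons *)

Section RintegralToolkit.
Context d (T : measurableType d) (R : realType).
Variable mu : {measure set T -> \bar R}.
Implicit Types (D E : set T) (f g h : T -> R).

Lemma integrable_EFin_Rintegral D f : measurable D ->
  mu.-integrable D (EFin \o f) ->
  (\int[mu]_(x in D) (f x)%:E)%E = (\int[mu]_(x in D) f x)%:E.
Proof. by move=> mD fi; rewrite /Rintegral fineK //; exact: integrable_fin_num. Qed.

Lemma bounded_integrableM D f h (C : R) : measurable D ->
  mu.-integrable D (EFin \o f) -> measurable_fun D h ->
  (forall x, D x -> `|h x| <= C) ->
  mu.-integrable D (EFin \o (fun x => f x * h x)).
Proof.
move=> mD fi mh hC.
have := integrableMl mD fi mh; apply.
exists C; split; [exact: num_real|move=> M' CM' x /= Dx].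
exact: le_trans (hC _ Dx) (ltW CM').
Qed.

Lemma integrable_measurable_EFin D f :
  mu.-integrable D (EFin \o f) -> measurable_fun D f.
Proof. by case/integrableP => /measurable_EFinP. Qed.

Lemma ae_eq_Rintegral D f g : measurable D ->
  measurable_fun D f -> measurable_fun D g ->
  {ae mu, forall x, D x -> f x = g x} ->
  \int[mu]_(x in D) f x = \int[mu]_(x in D) g x.
Proof.
move=> mD mf mg fg; rewrite /Rintegral; congr fine; apply: ae_eq_integral => //.
- exact/measurable_EFinP.
- exact/measurable_EFinP.
- by apply: filterS fg => x /= h /h ->.
Qed.

Lemma ae_eq_integrable D f g : measurable D -> measurable_fun D g ->
  {ae mu, forall x, D x -> f x = g x} ->
  mu.-integrable D (EFin \o f) -> mu.-integrable D (EFin \o g).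
Proof.
move=> mD mg fg /[dup] /integrable_measurable_EFin mf /integrableP[_ fi].
apply/integrableP; split; first exact/measurable_EFinP.
apply: le_lt_trans fi; rewrite le_eqVlt; apply/orP; left; apply/eqP.
apply: ae_eq_integral => //.
- by apply: measurableT_comp => //; exact/measurable_EFinP.
- by apply: measurableT_comp => //; exact/measurable_EFinP.
- by apply: filterS fg => x /= h /h ->.
Qed.

Lemma le_integrableR D f g : measurable D -> measurable_fun D f ->
  (forall x, D x -> `|f x| <= g x) ->
  mu.-integrable D (EFin \o g) -> mu.-integrable D (EFin \o f).
Proof.
move=> mD mf fg; apply: le_integrable => //; first exact/measurable_EFinP.
move=> x Dx; rewrite /= lee_fin; exact: le_trans (fg _ Dx) (ler_norm _).
Qed.

(** The maximum of [f] and [g] is a version of [g] that dominates [f] everywhere, which reduces the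
    claim to the pointwise comparison. *)
Lemma ae_le_Rintegral D f g : measurable D ->
  mu.-integrable D (EFin \o f) -> mu.-integrable D (EFin \o g) ->
  {ae mu, forall x, D x -> f x <= g x} ->
  \int[mu]_(x in D) f x <= \int[mu]_(x in D) g x.
Proof.
move=> mD fi gi fg.
have mx : measurable_fun D (fun x => Num.max (f x) (g x)).
  exact: measurable_maxr (integrable_measurable_EFin fi) (integrable_measurable_EFin gi).
have gm : {ae mu, forall x, D x -> g x = Num.max (f x) (g x)}.
  by apply: filterS fg => x h /h ?; rewrite max_r.
rewrite (ae_eq_Rintegral mD _ mx gm); last exact: integrable_measurable_EFin gi.
apply: le_Rintegral => //; first exact: ae_eq_integrable gi.
by move=> x _; rewrite le_max lexx.
Qed.

Lemma Rintegral_zero_off D E f : measurable D -> measurable E -> E `<=` D ->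
  (forall x, D x -> ~ E x -> f x = 0) ->
  \int[mu]_(x in D) f x = \int[mu]_(x in E) f x.
Proof.
move=> mD mE ED f0; rewrite Rintegral_mkcond [RHS]Rintegral_mkcond.
congr Rintegral; apply/funext => x; rewrite !patchE.
case: ifPn; rewrite ?inE ?notin_setE => Dx; case: ifPn; rewrite ?inE ?notin_setE => Ex //.
- exact: f0.
- by have := ED _ Ex.
Qed.

End RintegralToolkit.

(** * The interval I, of length one *)

Section IntervalI.
Context {R : realType}.
Notation mu := (@lebesgue_measure R).

Lemma measurable_I : measurable (Defs.I : set (measurableTypeR R)). Proof. exact: measurable_itv. Qed.

Lemma measurable_Ibar : measurable (Ibar : set (measurableTypeR R)). Proof. exact: measurable_itv. Qed.

Lemma in_I (y : R) : Defs.I y = (- 2^-1 < y < 2^-1) :> Prop.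
Proof. by rewrite /Defs.I /= in_itv. Qed.

Lemma in_Ibar (y : R) : Ibar y = (- 2^-1 <= y <= 2^-1) :> Prop.
Proof. by rewrite /Ibar /= in_itv. Qed.

Lemma I_sub_Ibar : @Defs.I R `<=` Ibar.
Proof. by move=> y; rewrite in_I in_Ibar => /andP[? ?]; apply/andP; split; exact: ltW. Qed.

Lemma lebesgue_I : mu Defs.I = 1%E.
Proof.
rewrite /Defs.I lebesgue_measure_itv /= lte_fin.
have -> : (- 2^-1 < 2^-1 :> R) by lra.
by rewrite -EFinD; congr EFin; lra.
Qed.

Lemma integrable_cst_I (c : R) : mu.-integrable Defs.I (EFin \o cst c).
Proof.
apply: measurable_bounded_integrable; [exact: measurable_I| |exact: measurable_cst|].
  by have := ltry (1 : R); rewrite -lebesgue_I.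
by exists `|c|; split; [exact: num_real|move=> M' /ltW + x _].
Qed.

Lemma Rintegral_cst_I (c : R) : \int[mu]_(y in Defs.I) c = c.
Proof. by rewrite Rintegral_cst; [have := lebesgue_I; move=> /= ->; rewrite mulr1|exact: measurable_I]. Qed.

Lemma bounded_integrable_I (f : R -> R) (C : R) : measurable_fun Defs.I f ->
  (forall y, Defs.I y -> `|f y| <= C) -> mu.-integrable Defs.I (EFin \o f).
Proof.
move=> mf fC; apply: le_integrableR (integrable_cst_I C) => //.
exact: measurable_I.
Qed.

End IntervalI.
#[global] Hint Extern 0 (measurable Defs.I) => solve [exact: measurable_I] : core.
#[global] Hint Extern 0 (measurable Ibar) => solve [exact: measurable_Ibar] : core.

(** * Explicit C^1 test functions *)

Section SmoothStep.
Context {R : realType}.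
Notation mu := (@lebesgue_measure R).
Implicit Types (u x y h a b : R).

(** A C^1 primitive of 2 |u|, whose translates combine into primitives of piecewise affine
    functions. *)
Definition signed_sqr u := u * `|u|.

Lemma is_derive_signed_sqr u : is_derive u 1 signed_sqr (2 * `|u|).
Proof.
have loc (c : R) : {near u, forall t, signed_sqr t = c * t ^+ 2} -> 2 * `|u| = c * (u *+ 2) ->
    is_derive u 1 signed_sqr (2 * `|u|).
  move=> cu ->.
  have H : is_derive u 1 (fun t => c * t ^+ 2) (c * (u *+ 2)).
    by apply: is_derive_eq; rewrite /GRing.scale /=; ring.
  by apply: near_eq_is_derive H; apply: filterS cu => t ->.
have [u0|u0|->] := ltrgtP u 0.
- apply: (loc (-1)); last by rewrite ltr0_norm // mulN1r mulrC mulNr mulr_natr.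
  near=> t; rewrite /signed_sqr ltr0_norm; first by ring.
  by near: t; exact: lt_nbhsl.
- apply: (loc 1); last by rewrite gtr0_norm // mul1r mulr_natl.
  near=> t; rewrite /signed_sqr gtr0_norm; first by ring.
  by near: t; exact: lt_nbhsr.
rewrite normr0 mulr0.
have c0 : h^-1 *: ((signed_sqr \o shift 0) (h *: 1) - signed_sqr 0) @[h --> 0^'] --> (0 : R).
  have : (fun h : R => `|h|) h @[h --> 0^'] --> (0 : R).
    rewrite -[X in _ --> X](@normr0 _ R).
    exact: (cvg_trans (cvg_app _ (@nbhs_dnbhs _ _)) (@norm_continuous _ R 0)).
  apply: cvg_trans; apply: near_eq_cvg; near=> h.
  have h0 : h != 0 by near: h; exact: nbhs_dnbhs_neq.
  rewrite /signed_sqr /= addr0 mul0r subr0 /GRing.scale /= mulr1 mulrA mulVf // mul1r.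
  by [].
apply: DeriveDef; first by apply/cvg_ex; exists 0.
by rewrite /derive; apply/cvg_lim.
Unshelve. all: by end_near. Qed.

(** The tent function max(1 - |u|, 0), written without case distinction so that it can be integrated
    term by term. *)
Definition hat u : R := (`|u + 1| + `|u - 1|) / 2 - `|u|.

(** The primitive of [hat] vanishing at -1: a C^1 step that rises from 0 to 1 across [-1, 1]. *)
Definition smooth_step u : R :=
  2^-1 + (signed_sqr (u + 1) + signed_sqr (u - 1) - 2 * signed_sqr u) / 4.

Lemma hat_ge0 u : 0 <= hat u.
Proof.
by rewrite /hat; have [|] := ger0P (u + 1); have [|] := ger0P (u - 1); have [|] := ger0P u; lra.
Qed.

Lemma hat_le1 u : hat u <= 1.
Proof.
by rewrite /hat; have [|] := ger0P (u + 1); have [|] := ger0P (u - 1); have [|] := ger0P u; lra.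
Qed.

Lemma hat_eq0 u : 1 <= `|u| -> hat u = 0.
Proof.
by rewrite /hat; have [|] := ger0P (u + 1); have [|] := ger0P (u - 1); have [|] := ger0P u; lra.
Qed.

Lemma hat_continuous : continuous hat.
Proof.
move=> u; apply: cvgB; last exact: norm_continuous.
apply: cvgMl; apply: cvgD.
  by apply: cvg_norm; apply: cvgD; [exact: cvg_id|exact: cvg_cst].
by apply: cvg_norm; apply: cvgB; [exact: cvg_id|exact: cvg_cst].
Qed.

Lemma smooth_step_eq0 u : u <= -1 -> smooth_step u = 0.
Proof.
move=> u1; rewrite /smooth_step /signed_sqr !ler0_norm; [|lra..].
by field.
Qed.

Lemma smooth_step_eq1 u : 1 <= u -> smooth_step u = 1.
Proof.
move=> u1; rewrite /smooth_step /signed_sqr !ger0_norm; [|lra..].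
by field.
Qed.

Lemma smooth_step_itv u : 0 <= smooth_step u <= 1.
Proof.
rewrite /smooth_step /signed_sqr.
have [|] := ger0P (u + 1); have [|] := ger0P (u - 1); have [|] := ger0P u; move=> ? ? ?; apply/andP; split; nra.
Qed.

Lemma is_derive_smooth_step u : is_derive u 1 smooth_step (hat u).
Proof.
have D c : is_derive u 1 (fun t => signed_sqr (t + c)) (2 * `|u + c|).
  have := @is_derive1_comp _ signed_sqr (fun t => t + c) u (2 * `|u + c|) 1.
  rewrite mulr1; apply; first exact: is_derive_signed_sqr.
  by apply: is_derive_eq; rewrite addr0.
have D1 := D 1; have D2 := D (-1); have D0 := is_derive_signed_sqr u.
rewrite /smooth_step; apply: is_derive_eq.
rewrite /hat /GRing.scale /= ; by field.
Qed.

(** A C^1 approximation of the indicator of [a, b], smoothed at scale [h] around the two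
    endpoints. *)
Definition bump a b h y : R := smooth_step ((y - a) / h) - smooth_step ((y - b) / h).

Lemma is_derive_bump a b h y :
  is_derive y 1 (bump a b h) (hat ((y - a) / h) / h - hat ((y - b) / h) / h).
Proof.
have D c : is_derive y 1 (fun t => smooth_step ((t - c) / h)) (hat ((y - c) / h) / h).
  apply: (@is_derive1_comp _ smooth_step (fun t => (t - c) / h) y (hat ((y - c) / h)) h^-1).
    exact: is_derive_smooth_step.
  by apply: is_derive_eq; rewrite /GRing.scale /=; ring.
have D1 := D a; have D2 := D b.
exact: is_deriveB.
Qed.

End SmoothStep.

(** * Weak derivatives tested at Lebesgue points *)

Section WeakDerivative.
Context {R : realType}.
Notation mu := (@lebesgue_measure R).
Notation I := (@Defs.I R).
Implicit Types (f g : R -> R) (a b h x y : R).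

Lemma continuous_rescaled (k : R -> R) a h : continuous k ->
  continuous (fun y => k ((y - a) / h)).
Proof.
move=> ck y; apply: (@continuous_comp _ _ _ (fun y => (y - a) / h) k); last exact: ck.
by apply: cvgMl; apply: cvgB; [exact: cvg_id|exact: cvg_cst].
Qed.

Lemma continuous_measurable_on (D : set (measurableTypeR R)) (k : R -> R) :
  measurable D -> continuous k -> measurable_fun D k.
Proof. by move=> mD ck; apply: measurable_funTS; exact: continuous_measurable_fun. Qed.

Lemma smooth_step_continuous : continuous (@smooth_step R).
Proof.
move=> u; apply/differentiable_continuous/derivable1_diffP.
by case: (is_derive_smooth_step u).
Qed.

(** An approximate identity at [a], of unit mass and supported in the ball of radius [h];
    differences of two such kernels are derivatives of bumps. *)
Definition hat_kernel a h y : R := hat ((y - a) / h) / h.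

Lemma hat_kernel_continuous a h : continuous (hat_kernel a h).
Proof. by move=> y; apply: cvgMl; apply: continuous_rescaled; exact: hat_continuous. Qed.

Lemma ball_itvoo a h : ball a h = `]a - h, a + h[%classic.
Proof. by rewrite ball_itv. Qed.

Lemma hat_kernel_off a h y : 0 < h -> ~ ball a h y -> hat_kernel a h y = 0.
Proof.
move=> h0; rewrite ball_itvoo /= in_itv /= => /negP yh.
rewrite /hat_kernel hat_eq0 ?mul0r // normrM normfV (gtr0_norm h0) ler_pdivlMr // mul1r.
move: yh; rewrite negb_and -!leNgt => /orP[|] ?.
  by rewrite distrC; apply: le_trans (ler_norm _); lra.
by apply: le_trans (ler_norm _); lra.
Qed.

Lemma hat_kernel_ge0 a h y : 0 < h -> 0 <= hat_kernel a h y.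
Proof. by move=> h0; rewrite divr_ge0 ?hat_ge0 // ltW. Qed.

Lemma hat_kernel_le a h y : 0 < h -> hat_kernel a h y <= h^-1.
Proof. by move=> h0; rewrite /hat_kernel ler_piMl ?hat_le1 // invr_ge0 ltW. Qed.

Lemma Rintegral_hat_kernel a h : 0 < h ->
  \int[mu]_(y in ball a h) hat_kernel a h y = 1.
Proof.
move=> h0; rewrite ball_itvoo /Rintegral.
have mk (D : set (measurableTypeR R)) : measurable D -> measurable_fun D (hat_kernel a h).
  by move=> mD; apply: continuous_measurable_on => //; exact: hat_kernel_continuous.
rewrite integral_itv_bndo_bndc; last first.
  by apply/measurable_EFinP; apply: mk.
rewrite integral_itv_obnd_cbnd; last first.
  by apply/measurable_EFinP; apply: mk.
have D y : is_derive y 1 (fun t => smooth_step ((t - a) / h)) (hat_kernel a h y).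
  apply: (@is_derive1_comp _ (@smooth_step R) (fun t => (t - a) / h) y (hat ((y - a) / h)) h^-1).
    exact: is_derive_smooth_step.
  by apply: is_derive_eq; rewrite /GRing.scale /=; ring.
have cS := @continuous_rescaled (@smooth_step R) a h smooth_step_continuous.
rewrite (@continuous_FTC2 _ _ (fun t => smooth_step ((t - a) / h))).
- have -> : (a + h - a) / h = 1 by field; rewrite gt_eqF.
  have -> : (a - h - a) / h = -1 by field; rewrite gt_eqF.
  by rewrite smooth_step_eq1 // smooth_step_eq0 //= subr0.
- by lra.
- by apply: continuous_subspaceT; exact: hat_kernel_continuous.
- split; first by move=> y _; case: (D y).
    by apply: cvg_at_right_filter; exact: cS.
  by apply: cvg_at_left_filter; exact: cS.
- by move=> y _; rewrite derive1E; case: (D y).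
Qed.

(** The kernel has unit mass and is at most 1 / h on a ball of length 2 h, whence the factor 2 in
    front of the average. *)
Lemma hat_average f a h : mu.-integrable I (EFin \o f) -> I a -> 0 < h ->
  ball a h `<=` I ->
  (`| \int[mu]_(y in I) (f y * hat_kernel a h y) - f a |%:E
     <= 2%:E * davg (f \_ I) a h)%E.
Proof.
move=> fi Ia h0 bI.
have mb : measurable (ball a h : set (measurableTypeR R)) by exact: measurable_ball.
have fb : mu.-integrable (ball a h) (EFin \o f) by exact: (integrableS measurable_I mb bI fi).
have mk (D : set (measurableTypeR R)) : measurable D -> measurable_fun D (hat_kernel a h).
  by move=> mD; apply: continuous_measurable_on => //; exact: hat_kernel_continuous.
have kb y : `|hat_kernel a h y| <= h^-1.
  by rewrite ger0_norm ?hat_kernel_ge0 // hat_kernel_le.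
have cb (c : R) : mu.-integrable (ball a h) (EFin \o cst c).
  exact: (integrableS measurable_I mb bI (integrable_cst_I c)).
rewrite (Rintegral_zero_off _ _ mb bI) //; last first.
  by move=> y _ yb; rewrite hat_kernel_off // mulr0.
have ki : mu.-integrable (ball a h) (EFin \o (fun y => f a * hat_kernel a h y)).
  by apply: bounded_integrableM (cb (f a)) _ (fun y _ => kb y) => //; exact: mk.
have fki : mu.-integrable (ball a h) (EFin \o (fun y => f y * hat_kernel a h y)).
  by apply: bounded_integrableM fb _ (fun y _ => kb y) => //; exact: mk.
have fa : f a = \int[mu]_(y in ball a h) (f a * hat_kernel a h y).
  rewrite RintegralZl ?Rintegral_hat_kernel ?mulr1 //.
  apply: eq_integrable (bounded_integrableM mb (cb 1) (mk _ mb) (fun y _ => kb y)) => //.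
  by move=> y _ /=; rewrite mul1r.
have db : mu.-integrable (ball a h) (EFin \o (fun y => f y - f a)).
  by have := integrableB mb fb (cb (f a)); apply: eq_integrable.
have nb : mu.-integrable (ball a h) (EFin \o (fun y => `|f y - f a|)).
  exact: integrable_norm.
rewrite [X in `|_ - X|]fa -RintegralB //.
rewrite /davg /iavg (lebesgue_measure_ball _ (ltW h0)).
have -> : (\int[mu]_(y in ball a h) `|((shift (- (f \_ I) a) \o f \_ I) y)%:E|)%E =
   (\int[mu]_(y in ball a h) `|f y - f a|)%:E.
  rewrite -integrable_EFin_Rintegral //; apply: eq_integral => y.
  rewrite inE => yb; rewrite /= !patchE !mem_set //; exact: bI.
rewrite inver mulrn_eq0 /= gt_eqF // -!EFinM lee_fin.
have -> : 2 * ((h *+ 2)^-1 * \int[mu]_(y in ball a h) `|f y - f a|) =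
          \int[mu]_(y in ball a h) (`|f y - f a| * h^-1).
  by rewrite RintegralZr //; field; rewrite gt_eqF.
have dki : mu.-integrable (ball a h)
    (EFin \o (fun y => f y * hat_kernel a h y - f a * hat_kernel a h y)).
  by have := integrableB mb fki ki; apply: eq_integrable.
apply: le_trans (le_normr_Rintegral mb dki) _; apply: le_Rintegral => //.
- exact: integrable_norm.
- by have := integrableZr mb h^-1 nb; apply: eq_integrable.
- move=> y _; rewrite -mulrBl normrM ler_wpM2l // ; exact: kb.
Qed.

(** Dominated convergence is applied along sequences, so the widths are specialized to 1 / (n +
    1). *)
Lemma harmonic_at_right : (n.+1%:R^-1 : R) @[n --> \oo] --> (0 : R)^'+.
Proof.
move=> A /(@cvg_harmonic R) [N _ hN]; exists N => // n /hN; apply.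
by rewrite -[X in _ < X]/(n.+1%:R^-1) invr_gt0.
Qed.

Lemma near_ball_I a : I a -> \forall h \near (0 : R)^'+, ball a h `<=` I.
Proof.
rewrite in_I => /andP[a1 a2]; near=> h => y; rewrite ball_itvoo in_I /= in_itv /=.
have h1 : h < a + 2^-1 by near: h; apply: nbhs_right_lt; lra.
have h2 : h < 2^-1 - a by near: h; apply: nbhs_right_lt; lra.
by move=> /andP[? ?]; apply/andP; split; lra.
Unshelve. all: by end_near. Qed.

Lemma hat_average_cvg f a : mu.-integrable I (EFin \o f) -> I a ->
  lebesgue_pt (f \_ I) a ->
  \int[mu]_(y in I) (f y * hat_kernel a h y) @[h --> 0^'+] --> f a.
Proof.
move=> fi Ia la; apply/cvgrPdist_le => e e0.
have : (2%:E * davg (f \_ I) a h @[h --> 0^'+] --> 0)%E.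
  by rewrite -[X in _ --> X](mule0 2%:E); apply: cvgeZl.
move=> /fine_cvgP[fin /cvgrPdist_le/(_ _ e0)] dl; near=> h.
have h0 : 0 < h by near: h; exact: nbhs_right_gt.
have bI : ball a h `<=` I by near: h; exact: near_ball_I.
have := hat_average fi Ia h0 bI; rewrite distrC => H.
rewrite -lee_fin; apply: le_trans H _.
have fd : (2%:E * davg (f \_ I) a h)%E \is a fin_num by near: h.
rewrite -(fineK fd) lee_fin; apply: le_trans (ler_norm _) _.
by rewrite -normrN -sub0r; near: h.
Unshelve. all: by end_near. Qed.


Lemma bump_test_fun a b h : a <= b -> 0 < h ->
  - 2^-1 < a - h -> b + h < 2^-1 -> test_fun (bump a b h).
Proof.
move=> ab h0 ah bh.
have D y : is_derive y 1 (bump a b h) (hat_kernel a h y - hat_kernel b h y).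
  exact: is_derive_bump.
split; first by move=> x; case: (D x).
  have -> : derive1 (bump a b h) = hat_kernel a h - hat_kernel b h.
    by apply/funext => y; rewrite derive1E fctE; case: (D y).
  by move=> y; apply: cvgB; exact: hat_kernel_continuous.
exists (a - h), (b + h); split => // x /negP; rewrite negb_and -!ltNge => /orP[] xh.
  rewrite /bump !smooth_step_eq0 ?subrr // ler_pdivrMr //; lra.
rewrite /bump !smooth_step_eq1 ?subrr // ler_pdivlMr //; lra.
Qed.

Lemma derive1_bump a b h y :
  derive1 (bump a b h) y = hat_kernel a h y - hat_kernel b h y.
Proof. by rewrite derive1E; case: (is_derive_bump a b h y). Qed.

Lemma bump_norm_le1 a b h y : `|bump a b h y| <= 1.
Proof.
have /andP[? ?] := smooth_step_itv ((y - a) / h).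
have /andP[? ?] := smooth_step_itv ((y - b) / h).
by rewrite /bump ler_norml; apply/andP; split; lra.
Qed.

(** Once the width is below the distance from [y] to both endpoints, the bump has exactly the value
    of the indicator. *)
Lemma bump_cvg a b y : a < b -> y != a -> y != b ->
  bump a b n.+1%:R^-1 y @[n --> \oo] --> (\1_`[a, b] y : R).
Proof.
move=> ab ya yb; apply: cvg_near_cst.
pose d : R := Num.min `|y - a| `|y - b|.
have d0 : 0 < d by rewrite lt_min !normr_gt0 !subr_eq0 ya yb.
have : \forall h \near (0 : R)^'+, h < d by exact: nbhs_right_lt.
move=> /(harmonic_at_right)[K _ hK]; exists K => // n /= /hK nd.
pose h : R := n.+1%:R^-1; have h0 : 0 < h by rewrite invr_gt0.
have {}nd : h < d := nd.
have ha : h < `|y - a| by apply: lt_le_trans nd _; rewrite ge_min lexx.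
have hb : h < `|y - b| by apply: lt_le_trans nd _; rewrite ge_min lexx orbT.
have S (c : R) : h < `|y - c| -> smooth_step ((y - c) / h) = (c <= y)%R%:R.
  move=> hc; have [cy|yc] := leP c y.
    rewrite smooth_step_eq1 // ler_pdivlMr // mul1r ltW //.
    by apply: lt_le_trans hc _; rewrite ger0_norm // subr_ge0.
  rewrite smooth_step_eq0 // ler_pdivrMr // mulN1r.
  by move: hc; rewrite ltr0_norm ?subr_lt0 //; lra.
rewrite /bump -/h !S // indicE mem_setE in_itv /=.
case: (ltgtP y b) yb => // yb _; case: (leP a y) => //= ay; rewrite ?subr0 ?subrr //.
by have := lt_trans ab yb; rewrite ltNge ltW.
Qed.

Lemma bump_continuous a b h : continuous (bump a b h).
Proof. by move=> y; apply: cvgB; apply: continuous_rescaled; exact: smooth_step_continuous. Qed.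

Lemma Rintegral_bump_cvg g a b : mu.-integrable I (EFin \o g) -> a < b ->
  \int[mu]_(y in I) (g y * bump a b n.+1%:R^-1 y) @[n --> \oo] -->
  \int[mu]_(y in I) (g y * \1_`[a, b] y).
Proof.
move=> gi ab.
have mg := integrable_measurable_EFin gi.
have m1 : measurable_fun (I : set (measurableTypeR R)) (\1_`[a, b] : R -> R) by apply: measurable_indic.
have i1 : mu.-integrable I (EFin \o (fun y => g y * \1_`[a, b] y)).
  by apply: bounded_integrableM (gi) m1 _ => // y _; rewrite indicE; case: (_ \in _); rewrite ?normr1 ?normr0 ?ler01.
have mb n : measurable_fun (I : set (measurableTypeR R)) (bump a b n.+1%:R^-1).
  by apply: continuous_measurable_on => //; exact: bump_continuous.
have [||||| _ _] := @dominated_convergence _ _ _ mu I measurable_I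
  (fun n y => (g y * bump a b n.+1%:R^-1 y)%:E)
  (fun y => (g y * \1_`[a, b] y)%:E) (fun y => `|g y|%:E).
- by move=> n; apply/measurable_EFinP; exact: measurable_funM.
- by apply/measurable_EFinP; exact: measurable_funM.
- have : {ae mu, forall y : measurableTypeR R, y != a /\ y != b}.
    have N c : {ae mu, forall y : measurableTypeR R, y != c}.
      exists [set c]; split; [exact: measurable_set1|exact: lebesgue_measure_set1|].
      by move=> y /= /negP; rewrite negbK => /eqP.
    by apply: filterS2 (N a) (N b) => y ? ?; split.
  apply: filterS => y [ya yb] Iy; apply: cvg_EFin; first by near=> n.
  by apply: cvgMr; exact: bump_cvg.
- exact: integrable_norm.
- apply: aeW => y n _; rewrite lee_fin normrM -[leRHS]mulr1 ler_wpM2l //.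
  exact: bump_norm_le1.
- by rewrite integrable_EFin_Rintegral // => /fine_cvg.
Unshelve. all: by end_near. Qed.

(* Test against a smoothed indicator of [a, b] and let its width go to 0. *)
Lemma weak_deriv_increment f g a b :
  mu.-integrable I (EFin \o f) -> mu.-integrable I (EFin \o g) ->
  weak_deriv f g -> I a -> I b -> a < b ->
  lebesgue_pt (f \_ I) a -> lebesgue_pt (f \_ I) b ->
  f b - f a = \int[mu]_(y in I) (g y * \1_`[a, b] y).
Proof.
move=> fi gi fg Ia Ib ab la lb.
pose L n := \int[mu]_(y in I) (f y * hat_kernel a n.+1%:R^-1 y).
pose N n := \int[mu]_(y in I) (f y * hat_kernel b n.+1%:R^-1 y).
have cL : L n @[n --> \oo] --> f a.
  exact: (@cvg_comp _ _ _ (fun n : nat => n.+1%:R^-1 : R) (fun h => \int[mu]_(y in I) (f y * hat_kernel a h y)) _ _ _ harmonic_at_right (hat_average_cvg fi Ia la)).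
have cN : N n @[n --> \oo] --> f b.
  exact: (@cvg_comp _ _ _ (fun n : nat => n.+1%:R^-1 : R) (fun h => \int[mu]_(y in I) (f y * hat_kernel b h y)) _ _ _ harmonic_at_right (hat_average_cvg fi Ib lb)).
have cg := Rintegral_bump_cvg gi ab.
have : (N n - L n) @[n --> \oo] --> \int[mu]_(y in I) (g y * \1_`[a, b] y).
  apply: cvg_trans cg; apply: near_eq_cvg.
  move: Ia Ib; rewrite !in_I => /andP[Ia _] /andP[_ Ib].
  have : \forall h \near (0 : R)^'+, h < Num.min (a + 2^-1) (2^-1 - b).
    by apply: nbhs_right_lt; rewrite lt_min; apply/andP; split; lra.
  move=> /harmonic_at_right[K _ hK]; exists K => // n /= /hK.
  rewrite /= lt_min => /andP[ha hb].
  have h0 : 0 < n.+1%:R^-1 :> R by rewrite invr_gt0.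
  rewrite /L /N; move: (n.+1%:R^-1 : R) ha hb h0 => h ha hb h0.
  have := fg _ (bump_test_fun (ltW ab) h0 _ _); rewrite /ip => e.
  have {}e := e ltac:(lra) ltac:(lra).
  rewrite -[LHS]opprK -e.
  have ki c : mu.-integrable I (EFin \o (fun y => f y * hat_kernel c h y)).
    apply: (bounded_integrableM (C := h^-1) _ fi) => //.
      by apply: continuous_measurable_on => //; exact: hat_kernel_continuous.
    by move=> y _; rewrite ger0_norm ?hat_kernel_ge0 // hat_kernel_le.
  rewrite -RintegralB // -[RHS]opprK; congr (- _).
  rewrite -mulN1r -RintegralZl //; last first.
    by have := integrableB measurable_I (ki b) (ki a); apply: eq_integrable.
  by apply: eq_Rintegral => y _; rewrite derive1_bump mulN1r opprB -mulrBr.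
by move=> c2; rewrite -(cvg_lim _ (cvgB cN cL)) //; exact/cvg_lim.
Qed.

End WeakDerivative.

(** * Functions recovered from their weak derivative and boundary values *)

Section WeakPrimitive.
Context {R : realType}.
Notation mu := (@lebesgue_measure R).
Notation I := (@Defs.I R).
Implicit Types (f g : R -> R) (a b x y : R).

Lemma ae_imply (P Q : R -> Prop) : (forall y, P y -> Q y) ->
  {ae mu, forall y : measurableTypeR R, P y} -> {ae mu, forall y : measurableTypeR R, Q y}.
Proof.
move=> PQ [N [mN N0 PN]]; exists N; split => // y nQ; apply: PN => /= Py.
exact/nQ/PQ.
Qed.

Lemma ae_and (P Q : measurableTypeR R -> Prop) :
  {ae mu, forall y : measurableTypeR R, P y} ->
  {ae mu, forall y : measurableTypeR R, Q y} ->
  {ae mu, forall y : measurableTypeR R, P y /\ Q y}.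
Proof. exact: (@filterI _ _ (ae_filter_ringOfSetsType mu)). Qed.

(** A nondegenerate interval has positive measure and so cannot lie in a null set. *)
Lemma ae_exists_itv (P : set R) a b : {ae mu, forall y, P y} -> a < b ->
  exists y, a < y < b /\ P y.
Proof.
move=> [N [mN N0 PN]] ab; apply: contrapT => /forallNP nP.
have : (mu `]a, b[ <= mu N)%E.
  apply: le_measure; rewrite ?inE //.
  move=> y; rewrite /= in_itv /= => yab; apply: PN => /= Py.
  by apply: (nP y); split.
rewrite N0 lebesgue_measure_itv /= lte_fin ab -EFinD lee_fin.
lra.
Qed.

Lemma ae_lebesgue_pt f : mu.-integrable I (EFin \o f) ->
  {ae mu, forall y, lebesgue_pt (f \_ I) y}.
Proof.
move=> fi; apply: lebesgue_differentiation.
by apply: integrable_locally fi; exact: measurable_I.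
Qed.

(** There is no increment between two Lebesgue points, and almost every point is one. *)
Lemma weak_deriv_eq0 f : mu.-integrable I (EFin \o f) ->
  weak_deriv f (cst 0) -> exists c, ae_eqI f (cst c).
Proof.
move=> fi f0.
have lf := ae_lebesgue_pt fi.
have [y0 [y0I l0]] := @ae_exists_itv _ (- 2^-1) 2^-1 lf ltac:(lra).
exists (f y0); rewrite /ae_eqI; apply: ae_imply lf => y ly Iy /=.
have Iy0 : I y0 by rewrite in_I.
have inc a b : I a -> I b -> a < b -> lebesgue_pt (f \_ I) a ->
    lebesgue_pt (f \_ I) b -> f b - f a = 0.
  move=> Ia Ib ab la lb.
  rewrite (weak_deriv_increment fi (integrable_cst_I 0) f0 Ia Ib ab la lb).
  under eq_Rintegral do rewrite mul0r.
  by rewrite Rintegral_cst_I.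
have [yy|yy|-> //] := ltgtP y y0.
  by have /eqP := inc _ _ Iy Iy0 yy ly l0; rewrite subr_eq0 => /eqP.
by have /eqP := inc _ _ Iy0 Iy yy l0 ly; rewrite subr_eq0 => /eqP.
Qed.

Definition primitive_I g x : R := \int[mu]_(y in `[- 2^-1, x]) (g \_ I) y.

Lemma integrable_restrict_I g (D : set (measurableTypeR R)) : measurable D ->
  mu.-integrable I (EFin \o g) -> mu.-integrable D (EFin \o (g \_ I)).
Proof.
move=> mD gi; have : mu.-integrable setT ((EFin \o g) \_ I).
  exact/(integrable_mkcond _ measurable_I).
rewrite restrict_EFin => gT; exact: (integrableS measurableT mD (@subsetT _ _) gT).
Qed.

Lemma primitive_I_continuous g : mu.-integrable I (EFin \o g) ->
  {within Ibar, continuous (primitive_I g)}.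
Proof.
move=> gi; apply: parameterized_integral_continuous; first by lra.
by apply: integrable_restrict_I gi; exact: measurable_itv.
Qed.

Lemma primitive_I_left g : primitive_I g (- 2^-1) = 0.
Proof. by rewrite /primitive_I set_itv1 Rintegral_set1. Qed.

Lemma primitive_I_right g : primitive_I g (2^-1) = \int[mu]_(y in I) g y.
Proof.
rewrite /primitive_I [RHS]Rintegral_mkcond [LHS]Rintegral_mkcond.
congr Rintegral; apply/funext => y.
rewrite !patchE; case: ifPn => //; rewrite notin_setE /= => yI.
by case: ifPn => //; rewrite inE => /I_sub_Ibar.
Qed.

Lemma primitive_I_increment g a b : mu.-integrable I (EFin \o g) ->
  - 2^-1 <= a -> a <= b ->
  primitive_I g b - primitive_I g a = \int[mu]_(y in `]a, b]) (g \_ I) y.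
Proof.
move=> gi a1 ab.
rewrite /primitive_I -(@Rintegral_itvB R (g \_ I) (BLeft (- 2^-1)) (BRight b) a) //.
- by apply: integrable_restrict_I gi; exact: measurable_itv.
Qed.

(** The difference between the continuous representative and the primitive of [g] has one and the
    same value at almost every point, hence on all of [Ibar]. Its value at the left endpoint gives
    the constant, the right endpoint then gives the mass of [g]. *)
Lemma weak_deriv_primitive f g a b : mu.-integrable I (EFin \o f) ->
  mu.-integrable I (EFin \o g) -> weak_deriv f g -> has_boundary_values f a b ->
  ae_eqI f (fun y => a + primitive_I g y) /\ \int[mu]_(y in I) g y = b - a.
Proof.
move=> fi gi fg [v [cv fv va vb]].
have lf := ae_lebesgue_pt fi.
pose A y := lebesgue_pt (f \_ I) y /\ (I y -> f y = v y).
have aeA : {ae mu, forall y, A y} by exact: ae_and.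
have cG := primitive_I_continuous gi.
have inc x y : I x -> I y -> x < y -> A x -> A y ->
    v y - primitive_I g y = v x - primitive_I g x.
  move=> Ix Iy xy [lx ex] [ly ey].
  have := weak_deriv_increment fi gi fg Ix Iy xy lx ly.
  rewrite ex // ey //.
  suff -> : \int[mu]_(y0 in I) (g y0 * \1_(`[x, y]%classic) y0) =
    primitive_I g y - primitive_I g x by lra.
  rewrite primitive_I_increment //; last 2 first.
  - by move: Ix; rewrite in_I => /andP[/ltW].
  - exact: ltW.
  rewrite (@Rintegral_itv_obnd_cbnd _ x (BRight y) (g \_ I)); last first.
    by apply: integrable_restrict_I gi; exact: measurable_itv.
  rewrite [LHS]Rintegral_mkcond [RHS]Rintegral_mkcond; congr Rintegral.
  apply/funext => z; rewrite !patchE indicE.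
  by case: ifPn => // zI; case: ifPn => zx; rewrite ?mulr1 ?mulr0.
have [y0 [y0I A0]] := @ae_exists_itv _ (- 2^-1) 2^-1 aeA ltac:(lra).
have Iy0 : I y0 by rewrite in_I.
pose W y := v y - primitive_I g y.
have WA y : I y -> A y -> W y = W y0.
  move=> Iy Ay; have [yy|yy|-> //] := ltgtP y y0.
    by rewrite /W (inc y y0).
  by rewrite /W (inc y0 y).
have cW : {within Ibar, continuous W}.
  by move=> x; apply: cvgB; [exact: cv|exact: cG].
have Wx x : Ibar x -> W x = W y0.
  move=> Ix; apply/eqP; rewrite -subr_eq0 -normr_le0 leNgt; apply/negP => d0.
  have /cvgrPdist_lt/(_ _ d0) := (subspace_continuousP Ibar W).1 cW x Ix.
  move=> [r /= r0 hr].
  move: (Ix); rewrite in_Ibar => /andP[x1 x2].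
  (* The neighbourhood of [x] is cut to [I], so that it contains a point of the full set [A], where
     [W] has the value [W y0]. *)
  pose a' := Num.max (x - r) (- 2^-1); pose b' := Num.min (x + r) 2^-1.
  have ab' : a' < b'.
    by rewrite gt_max !lt_min; apply/andP; split; apply/andP; split; lra.
  have [y [/andP[]]] := ae_exists_itv aeA ab'.
  rewrite gt_max lt_min => /andP[y1 y2] /andP[y3 y4] Ay.
  have Iy : I y by rewrite in_I y2 y4.
  have := hr y; rewrite (WA _ Iy Ay) ltxx => H; apply: notF; apply: H.
    by rewrite /ball_ /= ltr_norml; apply/andP; split; lra.
  exact: I_sub_Ibar.
have W1 : W (- 2^-1) = a by rewrite /W primitive_I_left subr0.
have e0 : W y0 = a by rewrite -(Wx (- 2^-1)) ?W1 // in_Ibar; lra.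
split.
  apply: ae_imply fv => y fvy Iy; rewrite fvy //.
  by have := Wx _ (I_sub_Ibar Iy); rewrite e0 /W => <-; rewrite subrK.
have := Wx 2^-1; rewrite e0 /W vb primitive_I_right => /(_ _) e1.
suff : b - \int[mu]_(y in I) g y = a by lra.
by apply: e1; rewrite in_Ibar; lra.
Qed.

End WeakPrimitive.

(** * Primitives in time *)

Section TimePrimitive.
Context {R : realType}.
Notation mu := (@lebesgue_measure R).
Implicit Types (f g : R -> R) (a b c t T : R).

Definition tprim f t : R := \int[mu]_(s in `[0, t]) f s.

Lemma tprim0 f : tprim f 0 = 0.
Proof. by rewrite /tprim set_itv1 Rintegral_set1. Qed.

Lemma tprim_continuous f T : 0 <= T -> mu.-integrable `[0, T] (EFin \o f) ->
  {within `[0, T], continuous (tprim f)}.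
Proof. by move=> T0 fi; exact: parameterized_integral_continuous. Qed.

Lemma tprim_increment f T a b : mu.-integrable `[0, T] (EFin \o f) ->
  0 <= a -> a <= b -> b <= T ->
  tprim f b - tprim f a = \int[mu]_(s in `]a, b]) f s.
Proof.
move=> fi a0 ab bT.
rewrite /tprim -(@Rintegral_itvB R f (BLeft 0) (BRight b) a) //.
apply: (integrableS _ _ _ fi) => //.
by move=> s /=; rewrite !in_itv /= => /andP[? ?]; apply/andP; split; lra.
Qed.

Lemma sub_integrable_itv f T a b : mu.-integrable `[0, T] (EFin \o f) ->
  0 <= a -> b <= T -> mu.-integrable `]a, b] (EFin \o f).
Proof.
move=> fi a0 bT; apply: (integrableS _ _ _ fi) => //.
by move=> s /=; rewrite !in_itv /= => /andP[? ?]; apply/andP; split; lra.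
Qed.

Lemma integrable_cst_itv a b c : mu.-integrable `]a, b] (EFin \o cst c).
Proof.
apply: measurable_bounded_integrable => //.
  rewrite /= lebesgue_measure_itv /=; case: ifPn => _; last exact: ltry.
  by rewrite -EFinD ltry.
by exists `|c|; split; [exact: num_real|move=> M' /ltW + x _].
Qed.

Lemma Rintegral_cst_itv a b c : a <= b -> \int[mu]_(s in `]a, b]) c = c * (b - a).
Proof.
move=> ab; rewrite Rintegral_cst //= lebesgue_measure_itv /= lte_fin.
by move: ab; rewrite le_eqVlt => /orP[/eqP ->|->]; rewrite ?ltxx ?subrr.
Qed.

Lemma tprim_ge f T a b c : mu.-integrable `[0, T] (EFin \o f) ->
  0 <= a -> a <= b -> b <= T ->
  {ae mu, forall s : measurableTypeR R, a < s <= b -> c <= f s} ->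
  c * (b - a) <= tprim f b - tprim f a.
Proof.
move=> fi a0 ab bT fc; rewrite (tprim_increment fi) // -Rintegral_cst_itv //.
apply: ae_le_Rintegral => //; first exact: integrable_cst_itv.
exact: sub_integrable_itv fi _ _.
Qed.

Lemma tprim_le f T a b c : mu.-integrable `[0, T] (EFin \o f) ->
  0 <= a -> a <= b -> b <= T ->
  {ae mu, forall s : measurableTypeR R, a < s <= b -> f s <= c} ->
  tprim f b - tprim f a <= c * (b - a).
Proof.
move=> fi a0 ab bT fc; rewrite (tprim_increment fi) // -Rintegral_cst_itv //.
apply: ae_le_Rintegral => //; last exact: integrable_cst_itv.
exact: sub_integrable_itv fi _ _.
Qed.

Lemma tprim_eq f g T t : mu.-integrable `[0, T] (EFin \o f) ->
  mu.-integrable `[0, T] (EFin \o g) -> t <= T ->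
  {ae mu, forall s : measurableTypeR R, 0 <= s <= t -> f s = g s} ->
  tprim f t = tprim g t.
Proof.
move=> fi gi tT fg.
have sub h : mu.-integrable `[0, T] (EFin \o h) -> mu.-integrable `[0, t] (EFin \o h).
  move=> hi; apply: (integrableS _ _ _ hi) => // s /=.
  by rewrite !in_itv /= => /andP[-> ?]; apply: le_trans tT.
apply: ae_eq_Rintegral => //.
- exact: integrable_measurable_EFin (sub _ fi).
- exact: integrable_measurable_EFin (sub _ gi).
Qed.

End TimePrimitive.

(** * The flow at a fixed point y *)

Section PointwiseFlow.
Context {R : realType}.
Notation mu := (@lebesgue_measure R).
Variables (V : R -> R) (M : R).
Hypothesis hV1 : forall x, derivable V x 1.
Hypothesis hV2 : forall x, derivable (derive1 V) x 1.
Hypothesis hV2b : forall x, - M <= derive1n 2 V x <= 0.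
Hypothesis hVeven : forall x, V x = V (- x).
Hypothesis hV'1 : forall x, derive1 V x = -1 <-> 1 <= x.
Variables (eps T zi : R) (sigma pd zd : R -> R).
Hypothesis eps0 : 0 < eps.
Hypothesis T0 : 0 <= T.
Hypothesis pdi : mu.-integrable `[0, T] (EFin \o pd).
Hypothesis zdi : mu.-integrable `[0, T] (EFin \o zd).
Hypothesis zi0 : 0 <= zi.
Let Z t := zi + tprim zd t.
Let rate s := overshoot (sigma s) (- derive1 V (Z s)) / eps.

Hypothesis flow : {ae mu, forall s : measurableTypeR R, 0 <= s <= T ->
  - 4^-1 <= sigma s <= 3 / 2 -> - 4^-1 <= - derive1 V (Z s) ->
  pd s = rate s /\ zd s = rate s}.

Lemma flow_continuous : {within `[0, T], continuous Z}.
Proof.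
by move=> x; apply: cvgD; [exact: cvg_cst|exact: (tprim_continuous T0 zdi)].
Qed.

(** The equation is at hand only while the force is at least -1/4, which holds above some negative
    level [c] because V' is continuous and vanishes at 0. Above that level [Z] does not decrease, so
    the barrier argument applies between [c] and [zi]. *)
Lemma flow_lower_bound T1 : T1 <= T ->
  (forall s, 0 <= s <= T1 -> - 4^-1 <= sigma s <= 3 / 2) ->
  forall t, 0 <= t <= T1 -> zi <= Z t.
Proof.
move=> T1T sT.
have [c [c0 hc]] : exists c, c < 0 /\ forall x, c <= x -> - 4^-1 <= - derive1 V x.
  have /cvgrPdist_le/(_ 4^-1) := @driving_continuous R V hV2 0.
  rewrite (driving0 hV1 hVeven) => /(_ ltac:(lra)) [r /= r0 hr].
  exists (- (r / 2)); split=> [|x xr]; first by lra.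
  have [x0|x0] := leP 0 x; first by have := driving_le0 hV1 hV2 hV2b hVeven x0; lra.
  have := hr x; rewrite /= !sub0r normrN => /(_ _) h.
  have := ler_norm (- derive1 V x).
  suff : `|- derive1 V x| <= 4^-1.
    by rewrite normrN ler_norml => /andP[? ?]; lra.
  by apply: h; rewrite ltr0_norm //; lra.
apply: (@barrier _ Z T1 c zi).
- exact: lt_le_trans c0 zi0.
- exact: within_sub_itv flow_continuous _ T1T.
- by rewrite /Z tprim0 addr0.
- move=> t0 t1 /andP[t00 t01] t1T Zc _.
  have t1T' : t1 <= T by lra.
  rewrite /Z lerD2l -subr_ge0 -[leLHS](mul0r (t1 - t0)).
  apply: (tprim_ge zdi) => //; apply: ae_imply flow => s fs /andP[s0 s1].
  have [| | |_ ->] := fs; first by apply/andP; split; lra.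
  + by apply: sT; apply/andP; split; lra.
  + by apply/hc/Zc; apply/andP; split; lra.
  + by rewrite divr_ge0 ?overshoot_ge0 // ltW.
Qed.

(** The lower bound keeps [Z], and with it the force, nonnegative along the trajectory; this
    discharges the condition on the force in [flow]. *)
Lemma flow_rates T1 : T1 <= T ->
  (forall s, 0 <= s <= T1 -> - 4^-1 <= sigma s <= 3 / 2) ->
  {ae mu, forall s : measurableTypeR R, 0 <= s <= T1 -> pd s = rate s /\ zd s = rate s}.
Proof.
move=> T1T sT; apply: ae_imply flow => s fs /[dup] sT1 /andP[s0 s1].
apply: fs; [by apply/andP; split; lra|exact: sT|].
have := flow_lower_bound T1T sT sT1 => Zs.
by have := driving_le0 hV1 hV2 hV2b hVeven (le_trans zi0 Zs); lra.
Qed.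

Lemma flow_increment_ge0 T1 : T1 <= T ->
  (forall s, 0 <= s <= T1 -> - 4^-1 <= sigma s <= 3 / 2) ->
  forall a b, 0 <= a -> a <= b -> b <= T1 -> 0 <= tprim pd b - tprim pd a.
Proof.
move=> T1T sT a b a0 ab bT; rewrite -(mul0r (b - a)).
apply: (tprim_ge pdi) => //; first by lra.
apply: ae_imply (flow_rates T1T sT) => s fs /andP[s0 s1].
have [|-> _] := fs; first by apply/andP; split; lra.
by rewrite divr_ge0 ?overshoot_ge0 // ltW.
Qed.

Lemma flow_tprim_eq T1 : T1 <= T ->
  (forall s, 0 <= s <= T1 -> - 4^-1 <= sigma s <= 3 / 2) ->
  forall t, 0 <= t <= T1 -> tprim zd t = tprim pd t.
Proof.
move=> T1T sT t /andP[t0 tT].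
apply: (tprim_eq zdi pdi); first by lra.
apply: ae_imply (flow_rates T1T sT) => s fs /andP[s0 s1].
by have [|-> ->] := fs; first by apply/andP; split; lra.
Qed.

(* where the initial internal variable is below 1, the driving force never
   reaches the yield surface *)
Lemma flow_rest (d c : R) : zi < c -> - derive1 V c <= 1 - d ->
  (forall s, 0 <= s <= T -> - 4^-1 <= sigma s <= 3 / 2) ->
  (forall s, 0 <= s <= T -> sigma s <= 1 + d) ->
  forall t, 0 <= t <= T -> tprim pd t = 0.
Proof.
move=> zic Vc sT sd t tT.
have lb : 0 <= tprim pd t.
  case/andP: (tT) => t0 tT'.
  by have := flow_increment_ge0 (lexx T) sT (lexx 0) t0 tT'; rewrite tprim0 subr0.
suff : 0 <= - tprim pd t by lra.
(* While the accumulated strain is at most [c - zi], the variable [Z] is at most [c] and the force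
   at most [1 - d]; added to a stress of at most [1 + d] it gives no overshoot, so the strain does
   not grow. *)
apply: (@barrier _ (fun t => - tprim pd t) T (- (c - zi)) 0) tT.
- by lra.
- by move=> x; apply: cvgN; exact: (tprim_continuous T0 pdi).
- by rewrite tprim0 oppr0.
- move=> t0 t1 /andP[t00 t01] t1T Zc _.
  rewrite lerN2 -subr_le0 -[leRHS](mul0r (t1 - t0)).
  apply: (tprim_le pdi) => //.
  apply: ae_imply (flow_rates (lexx T) sT) => s fs /andP[s0 s1].
  have sT' : 0 <= s <= T by apply/andP; split; lra.
  have [//|-> _] := fs; rewrite /rate overshoot_eq0 ?mul0r //.
  have := sd _ sT'; suff : - derive1 V (Z s) <= - derive1 V c by lra.
  rewrite lerN2; apply: (driving_nincr hV2 hV2b).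
  rewrite /Z (flow_tprim_eq (lexx T)) //.
  by have := Zc s; rewrite s1 andbT => /(_ ltac:(lra)); lra.
Qed.

End PointwiseFlow.

(** * Fubini's theorem for real-valued integrals *)

Section RealFubini.
Context d1 d2 (T1 : measurableType d1) (T2 : measurableType d2) (R : realType).
Variables (m1 : {sigma_finite_measure set T1 -> \bar R})
  (m2 : {sigma_finite_measure set T2 -> \bar R}).
Variable F : T1 * T2 -> R.
Hypothesis Fi : (m1 \x m2)%E.-integrable setT (EFin \o F).

(** A real integral is 0 by default when the extended one is infinite, so the two are compared only
    where the section is integrable, which is almost everywhere. *)
Lemma ae_Rintegral_fubini_F : {ae m1, forall x,
  fubini_F m2 (EFin \o F) x = (\int[m2]_y F (x, y))%:E}.
Proof.
apply: filterS (ae_integrable1 Fi) => x Fx.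
by rewrite /fubini_F -integrable_EFin_Rintegral.
Qed.

Lemma ae_Rintegral_fubini_G : {ae m2, forall y,
  fubini_G m1 (EFin \o F) y = (\int[m1]_x F (x, y))%:E}.
Proof.
apply: filterS (ae_integrable2 Fi) => y Fy.
by rewrite /fubini_G -integrable_EFin_Rintegral.
Qed.

Lemma measurable_Rintegral_F : measurable_fun setT (fun x => \int[m2]_y F (x, y)).
Proof.
apply: (@measurableT_comp _ _ _ _ _ _ fine _ (fubini_F m2 (EFin \o F))).
  exact: fine_measurable.
exact: (measurable_fubini_F Fi).
Qed.

Lemma measurable_Rintegral_G : measurable_fun setT (fun y => \int[m1]_x F (x, y)).
Proof.
apply: (@measurableT_comp _ _ _ _ _ _ fine _ (fubini_G m1 (EFin \o F))).
  exact: fine_measurable.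
exact: (measurable_fubini_G Fi).
Qed.

Lemma integrable_Rintegral_F :
  m1.-integrable setT (EFin \o (fun x => \int[m2]_y F (x, y))).
Proof.
have iF := integrable_fubini_F Fi.
apply/integrableP; split.
  by apply/measurable_EFinP; exact: measurable_Rintegral_F.
case/integrableP: (iF) => mF; apply: le_lt_trans; rewrite le_eqVlt; apply/orP; left.
apply/eqP; apply: ae_eq_integral => //.
- by apply: measurableT_comp => //; apply/measurable_EFinP; exact: measurable_Rintegral_F.
- exact: measurableT_comp.
- by apply: filterS ae_Rintegral_fubini_F => x e _; rewrite e.
Qed.

Lemma Rintegral_fubini :
  \int[m1]_x \int[m2]_y F (x, y) = \int[m2]_y \int[m1]_x F (x, y).
Proof.
have eF : (\int[m1]_x (\int[m2]_y F (x, y))%:E)%E = (\int[m1]_x fubini_F m2 (EFin \o F) x)%E.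
  apply: ae_eq_integral => //.
  - by apply/measurable_EFinP; exact: measurable_Rintegral_F.
  - exact: (measurable_fubini_F Fi).
  - by apply: filterS ae_Rintegral_fubini_F => x e _; rewrite e.
have eG : (\int[m2]_y (\int[m1]_x F (x, y))%:E)%E = (\int[m2]_y fubini_G m1 (EFin \o F) y)%E.
  apply: ae_eq_integral => //.
  - by apply/measurable_EFinP; exact: measurable_Rintegral_G.
  - exact: (measurable_fubini_G Fi).
  - by apply: filterS ae_Rintegral_fubini_G => x e _; rewrite e.
rewrite -[LHS]/(fine (\int[m1]_x (\int[m2]_y F (x, y))%:E)%E).
rewrite -[RHS]/(fine (\int[m2]_y (\int[m1]_x F (x, y))%:E)%E) eF eG.
by rewrite integral12_prod_meas1 // integral21_prod_meas1.
Qed.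

End RealFubini.

(** * Exchange of almost everywhere quantifiers *)

Section AeSwap.
Context d1 d2 (T1 : measurableType d1) (T2 : measurableType d2) (R : realType).
Variables (m1 : {sigma_finite_measure set T1 -> \bar R})
  (m2 : {sigma_finite_measure set T2 -> \bar R}).

(** By Tonelli the product measure of [N] can be computed from either family of sections: if almost
    all sections of one family are null, the total is 0 and almost all sections of the other are
    null. *)
Lemma ae_swap (N : set (T1 * T2)) : measurable N ->
  {ae m1, forall x, {ae m2, forall y, ~ N (x, y)}} ->
  {ae m2, forall y, {ae m1, forall x, ~ N (x, y)}}.
Proof.
move=> mN aeN.
have F0 : (\int[m1]_x fubini_F m2 (EFin \o \1_N) x = 0)%E.
  rewrite -(integral0 m1 setT); apply: ae_eq_integral => //.
    exact: indic_measurable_fun_fubini_tonelli_F.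
  apply: filterS aeN => x [A [mA A0 NA]] _.
  rewrite indic_fubini_tonelli_FE //=; apply/eqP; rewrite eq_le measure_ge0 andbT -A0.
  apply: le_measure; rewrite ?inE //; first exact: measurable_xsection.
  by move=> y; rewrite /xsection /= inE => Ny; apply: NA => /=.
move: F0; rewrite indic_fubini_tonelli // => G0.
have mG := indic_measurable_fun_fubini_tonelli_G m1 mN.
have : (\int[m2]_y `|fubini_G m1 (EFin \o \1_N) y| = 0)%E.
  rewrite -G0; apply: eq_integral => y _; rewrite gee0_abs //.
  exact: indic_fubini_tonelli_G_ge0.
move/(ae_eq_integral_abs m2 measurableT mG); apply: filterS => y /(_ Logic.I).
rewrite indic_fubini_tonelli_GE //= => Ny0.
exists (ysection N y); split => //; first exact: measurable_ysection.
by move=> x /= /contrapT; rewrite /ysection /= inE.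
Qed.

End AeSwap.

(** * The square of the L2 norm as an integral *)

Section L2Facts.
Context {R : realType}.
Notation mu := (@lebesgue_measure R).
Notation I := (@Defs.I R).

Lemma normL2_sqr (f : R -> R) :
  (normL2 f ^+ 2 = \int[mu]_(y in I) ((f y) ^+ 2)%:E)%E.
Proof.
have p2 (x : \bar R) : (0 <= x -> x ^+ 2 = x `^ 2)%E.
  case: x => [r||//].
    by rewrite lee_fin => r0; rewrite poweR_EFin powR_mulrn // expe2 -EFinM expr2.
  by move=> _; rewrite poweRE /= (_ : (2 == 0 :> R) = false) ?pnatr_eq0 // expe2 mulyy.
rewrite p2 ?Lnorm_ge0 // powR_Lnorm ?pnatr_eq0 //.
rewrite [RHS]integral_mkcond; apply: eq_integral => y _.
rewrite -[LHS]/(((`|(f \_ I) y|)%:E `^ 2)%E) poweR_EFin powR_mulrn //.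
rewrite real_normK ?num_real // !patchE; case: ifPn => // _.
by rewrite -[LHS]/((0 ^+ 2 : R)%:E) expr0n.
Qed.

End L2Facts.

(** * Jointly measurable rates on a time strip *)

Section Strip.
Context {R : realType}.
Notation mu := (@lebesgue_measure R).
Notation I := (@Defs.I R).
Notation RR := (measurableTypeR R).
Implicit Types (v : R -> R -> R) (t T y : R).

(** The cut-off yields a function on the whole plane, to which the theorems on product measures
    apply directly. *)
Definition strip v T : RR * RR -> R :=
  (fun x => v x.1 x.2) \_ (`[0, T]%classic `*` I).

Lemma stripE v T t y : 0 <= t <= T -> I y -> strip v T (t, y) = v t y.
Proof. by move=> tT Iy; rewrite /strip patchE mem_set //; split; rewrite /= ?in_itv. Qed.

Lemma measurable_strip_dom T :
  measurable (`[0, T]%classic `*` I : set (RR * RR)).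
Proof. by apply: measurableX; [exact: measurable_itv|exact: measurable_I]. Qed.

Lemma measurable_strip v T : L2loc_L2 v -> measurable_fun setT (strip v T).
Proof.
move=> [mv _]; apply/(measurable_restrictT _ (measurable_strip_dom T)).
apply: measurable_funS mv.
  by apply: measurableX; [exact: measurable_itv|exact: measurable_I].
by move=> [t y] /= [tT Iy]; split => //; move: tT; rewrite /half_line /= !in_itv /= => /andP[->].
Qed.

Lemma integrable_indic_strip T :
  (mu \x mu)%E.-integrable setT (EFin \o (\1_(`[0, T]%classic `*` I : set (RR * RR)))).
Proof.
have mS := measurable_strip_dom T.
apply/integrableP; split; first by apply/measurable_EFinP; exact: measurable_indic.
under eq_integral => x _.
  rewrite (_ : `|_|%E = (\1_(`[0, T]%classic `*` I : set (RR * RR)) x)%:E); last first.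
    by rewrite /= ger0_norm.
  over.
rewrite integral_indic // setIT [ltLHS]product_measure1E //.
rewrite [X in (_ * X)%E](lebesgue_I) mule1 /= lebesgue_measure_itv /=.
by case: ifPn => _; [rewrite -EFinD ltry|exact: ltry].
Qed.

(** The strip has finite measure and |v| <= 1 + v^2 on it, so square integrability suffices. *)
Lemma integrable_strip v T : L2loc_L2 v ->
  (mu \x mu)%E.-integrable setT (EFin \o strip v T).
Proof.
move=> hv; have ms := measurable_strip T hv.
have m2 : measurable_fun setT (fun x => strip v T x ^+ 2) by exact: measurable_funX.
have i2 : (mu \x mu)%E.-integrable setT (EFin \o (fun x => strip v T x ^+ 2)).
  apply/integrable12ltyP; first exact/measurable_EFinP.
  case: hv => _ /(_ T); apply: le_lt_trans; rewrite le_eqVlt; apply/orP; left.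
  apply/eqP; rewrite [RHS]integral_mkcond; apply: eq_integral => t _.
  rewrite patchE; case: ifPn; rewrite ?inE ?notin_setE /= in_itv /= => tT.
    rewrite -expe2 normL2_sqr [RHS]integral_mkcond; apply: eq_integral => y _.
    rewrite /= patchE ger0_norm ?sqr_ge0 //; case: ifPn; rewrite ?inE ?notin_setE => Iy.
      by rewrite stripE.
    rewrite /strip patchE memNset /= ?expr0n //; by move=> [_ /=].
  rewrite integral0_eq // => y _; rewrite /= /strip patchE memNset /=.
    by rewrite expr0n normr0.
  by move=> [/=]; rewrite in_itv.
have := integrableD measurableT (integrable_indic_strip T) i2.
apply: le_integrable => //; first exact/measurable_EFinP.
move=> [t y] _ /=; rewrite lee_fin.
apply: le_trans (ler_norm _).
rewrite /strip indicE patchE; case: ifPn => _ /=; last by rewrite normr0 expr0n addr0.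
have [|] := ger0P (v t y); nra.
Qed.

Lemma ae_integrable_time v T : L2loc_L2 v ->
  {ae mu, forall y : RR, I y -> mu.-integrable `[0, T] (EFin \o (v ^~ y))}.
Proof.
move=> hv; apply: filterS (ae_integrable2 (integrable_strip T hv)) => y iy Iy.
have mT : measurable (`[0, T]%classic : set RR) by exact: measurable_itv.
have := integrableS measurableT mT (@subsetT _ _) iy.
apply: eq_integrable => //.
by move=> t; rewrite inE /= in_itv /= => tT; rewrite stripE.
Qed.

(** The integral is also a mean since [I] has length 1. The horizon [T] enters only through the
    cut-off, which provides integrability in time. *)
Definition mean_rate v T t : R := \int[mu]_y strip v T (t, y).

Lemma mean_rateE v T t : 0 <= t <= T -> mean_rate v T t = \int[mu]_(y in I) v t y.
Proof.
move=> tT; rewrite [RHS]Rintegral_mkcond; congr Rintegral; apply/funext => y.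
rewrite patchE; case: ifPn; rewrite ?inE ?notin_setE => Iy; first by rewrite stripE.
by rewrite /strip patchE memNset //; move=> [_ /=].
Qed.

Lemma mean_rate_integrable v T : L2loc_L2 v ->
  mu.-integrable `[0, T] (EFin \o mean_rate v T).
Proof.
move=> hv; have := integrable_Rintegral_F (integrable_strip T hv).
by apply: integrableS => //; exact: measurable_itv.
Qed.

Lemma strip_tprim v t y : I y ->
  \int[mu]_s strip v t (s, y) = tprim (v ^~ y) t.
Proof.
move=> Iy; rewrite /tprim [RHS]Rintegral_mkcond; congr Rintegral.
apply/funext => s; rewrite patchE; case: ifPn; rewrite ?inE ?notin_setE /= in_itv /= => st.
  by rewrite stripE.
by rewrite /strip patchE memNset // => -[/=]; rewrite in_itv.
Qed.

(** Fubini on the strip up to [t]; up to that time the cut-off at the larger horizon [T] makes no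
    difference. *)
Lemma mean_tprim v T t : L2loc_L2 v -> 0 <= t <= T ->
  \int[mu]_(y in I) tprim (v ^~ y) t = tprim (mean_rate v T) t.
Proof.
move=> hv /andP[t0 tT].
have := Rintegral_fubini (integrable_strip t hv) => e.
transitivity (\int[mu]_y \int[mu]_s strip v t (s, y)).
  rewrite [LHS]Rintegral_mkcond; congr Rintegral; apply/funext => y.
  rewrite patchE; case: ifPn; rewrite ?inE ?notin_setE => Iy; first by rewrite strip_tprim.
  rewrite (_ : (fun s => _) = cst 0) ?Rintegral_cst ?mul0r //.
  by apply/funext => s; rewrite /strip patchE memNset //; move=> [_ /=].
rewrite -e /tprim [RHS]Rintegral_mkcond; congr Rintegral; apply/funext => s.
rewrite patchE; case: ifPn; rewrite ?inE ?notin_setE /= in_itv /= => st.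
  rewrite /mean_rate; congr Rintegral; apply/funext => y.
  rewrite /strip !patchE; case: ifPn; case: ifPn => //.
    rewrite inE notin_setE => h [/= sT Iy]; exfalso; apply: h.
    by split => //; move: sT; rewrite /= !in_itv /= => /andP[-> s1]; apply: le_trans tT.
  rewrite inE notin_setE => -[/= sT Iy] h; exfalso; apply: h.
  by split => //=; rewrite in_itv.
rewrite (_ : (fun y => _) = cst 0) ?Rintegral_cst ?mul0r //.
by apply/funext => y; rewrite /strip patchE memNset // => -[/=]; rewrite in_itv.
Qed.

Lemma integrable_tprim_I v t : L2loc_L2 v -> 0 <= t ->
  mu.-integrable I (EFin \o (fun y => tprim (v ^~ y) t)).
Proof.
move=> hv t0.
have swapi : (mu \x mu)%E.-integrable setT (EFin \o (fun x : RR * RR => strip v t (x.2, x.1))).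
  apply/integrable21ltyP.
    apply/measurable_EFinP.
    apply: (measurableT_comp (measurable_strip t hv)).
    by apply: measurable_fun_pair; [exact: measurable_snd|exact: measurable_fst].
  have /measurable_EFinP mE := measurable_strip t hv.
  by have /(integrable12ltyP _ _ mE) := integrable_strip t hv.
have := integrable_Rintegral_F swapi.
move=> /(integrableS measurableT measurable_I (@subsetT _ _)).
apply: eq_integrable; first exact: measurable_I.
by move=> y; rewrite inE => Iy; rewrite /= strip_tprim.
Qed.

(** The moving upper limit of integration becomes the indicator of a measurable set in three
    variables. Individual sections may fail to be integrable, so Tonelli is applied to the positive
    and the negative part separately. *)
Lemma measurable_time_primitive v T : L2loc_L2 v ->
  measurable_fun setT (fun x : RR * RR => \int[mu]_(s in `[0, x.1]) strip v T (s, x.2)).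
Proof.
move=> hv.
pose G : (RR * RR) * RR -> R := fun w => strip v T (w.2, w.1.2) *
  \1_([set w : (RR * RR) * RR | 0 <= w.2 <= w.1.1]) w.
have mA : measurable [set w : (RR * RR) * RR | 0 <= w.2 <= w.1.1].
  have m1 : measurable_fun setT (fun w : (RR * RR) * RR => w.1.1).
    by apply: measurableT_comp; [exact: measurable_fst|exact: measurable_fst].
  have m2 : measurable_fun setT (fun w : (RR * RR) * RR => w.2) by exact: measurable_snd.
  have -> : [set w : (RR * RR) * RR | 0 <= w.2 <= w.1.1] =
    [set w | 0 <= w.2] `&` [set w | w.2 <= w.1.1].
    by apply/seteqP; split => w /= => [/andP|[? ?]]; [move=> []|apply/andP].
  apply: measurableI.
    rewrite -[X in measurable X]setTI; apply: measurable_fun_le => //.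
  by rewrite -[X in measurable X]setTI; exact: measurable_fun_le.
have mG : measurable_fun setT G.
  apply: measurable_funM; last exact: measurable_indic.
  apply: (measurableT_comp (measurable_strip T hv)).
  apply: measurable_fun_pair; first exact: measurable_snd.
  by apply: measurableT_comp; [exact: measurable_snd|exact: measurable_fst].
have mGE : measurable_fun setT (EFin \o G) by exact/measurable_EFinP.
have -> : (fun x : RR * RR => \int[mu]_(s in `[0, x.1]) strip v T (s, x.2)) =
   fun x => fine (fubini_F mu ((EFin \o G)^\+)%E x - fubini_F mu ((EFin \o G)^\-)%E x).
  apply/funext => -[t y]; rewrite [LHS]Rintegral_mkcond /Rintegral /fubini_F.
  congr fine; rewrite integralE; congr (_ - _)%E; apply: eq_integral => s _.
    rewrite !funeposE /= /G /= !patchE indicE; congr maxe; congr EFin.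
    case: ifPn; rewrite ?inE ?notin_setE /= in_itv /= => st.
      by rewrite mem_set // mulr1.
    by rewrite memNset ?mulr0.
  rewrite !funenegE /= /G /= !patchE indicE; congr maxe; congr EFin; congr (- _).
  case: ifPn; rewrite ?inE ?notin_setE /= in_itv /= => st.
    by rewrite mem_set // mulr1.
  by rewrite memNset ?mulr0.
apply: measurableT_comp; first exact: fine_measurable.
apply: emeasurable_funB; apply: measurable_fun_fubini_tonelli_F => //.
- exact: measurable_funepos.
- exact: measurable_funeneg.
Qed.

End Strip.

(** * Square integrable functions on I *)

Section L2Integrable.
Context {R : realType}.
Notation mu := (@lebesgue_measure R).
Notation I := (@Defs.I R).
Implicit Types f g : R -> R.

Lemma L2_measurable f : L2 f -> measurable_fun (I : set (measurableTypeR R)) f.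
Proof.
rewrite /L2 => /sub_Lfun_mfun; rewrite inE /= => mf.
by apply/(measurable_restrictT _ measurable_I).
Qed.

Lemma L2_sqr_integrable f : L2 f -> mu.-integrable I (EFin \o (fun y => f y ^+ 2)).
Proof.
move=> hf; have mf := L2_measurable hf.
apply/integrableP; split; first by apply/measurable_EFinP; exact: measurable_funX.
move: hf; rewrite /L2 => /sub_Lfun_finLfun; rewrite inE /= /finite_norm => fn.
have -> : (\int[mu]_(y in I) `|(EFin \o (fun y => f y ^+ 2)%R) y| = normL2 f ^+ 2)%E.
  rewrite normL2_sqr; apply: eq_integral => y _.
  by rewrite /= ger0_norm // sqr_ge0.
rewrite /normL2 expe2; apply: lte_mul_pinfty; rewrite ?Lnorm_ge0 //.
by rewrite ge0_fin_numE // Lnorm_ge0.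
Qed.

Lemma L2_integrable f : L2 f -> mu.-integrable I (EFin \o f).
Proof.
move=> hf; have mf := L2_measurable hf.
have := integrableD measurable_I (integrable_cst_I 1) (L2_sqr_integrable hf).
apply: le_integrable => //; first exact/measurable_EFinP.
move=> y _ /=; rewrite lee_fin; apply: le_trans (ler_norm _).
have [|] := ger0P (f y); nra.
Qed.

Lemma L2_mul_integrable f g : L2 f -> L2 g ->
  mu.-integrable I (EFin \o (fun y => f y * g y)).
Proof.
move=> hf hg; have mf := L2_measurable hf; have mg := L2_measurable hg.
have := integrableD measurable_I (L2_sqr_integrable hf) (L2_sqr_integrable hg).
apply: le_integrable => //; first by apply/measurable_EFinP; exact: measurable_funM.
move=> y _ /=; rewrite lee_fin; apply: le_trans (ler_norm _).
by rewrite ler_norml; apply/andP; split; nra.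
Qed.

End L2Integrable.

(** * Stress, displacement and flow of a regularized solution *)

Section RegularizedFlow.
Context {R : realType}.
Notation mu := (@lebesgue_measure R).
Notation I := (@Defs.I R).
Notation RR := (measurableTypeR R).
Variables (V : R -> R) (M : R) (z0 : R -> R).
Hypothesis hV1 : forall x, derivable V x 1.
Hypothesis hV2 : forall x, derivable (derive1 V) x 1.
Hypothesis hV2b : forall x, - M <= derive1n 2 V x <= 0.
Hypothesis hV'1 : forall x, derive1 V x = -1 <-> 1 <= x.
Hypothesis z0c : {within Ibar, continuous z0}.

Lemma measurable_z0 : measurable_fun (I : set RR) z0.
Proof.
have : measurable_fun (Ibar : set RR) z0.
  by apply: subspace_continuous_measurable_fun.
by apply: measurable_funS => //; exact: I_sub_Ibar.
Qed.

Section FixedHorizon.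
Variables (eps T : R) (u e p z pdot zdot : R -> R -> R).
Hypothesis T0 : 0 < T.
Hypothesis hL2u : forall t, 0 <= t -> H1 (u t).
Hypothesis hL2e : forall t, 0 <= t -> L2 (e t).
Hypothesis hL2p : forall t, 0 <= t -> L2 (p t).
Hypothesis hpdot : L2loc_L2 pdot.
Hypothesis hzdot : L2loc_L2 zdot.
Hypothesis pp : primitive_of p pdot.
Hypothesis zz : primitive_of z zdot.
Hypothesis p00 : ae_eqI (p 0) (cst 0).
Hypothesis z00 : ae_eqI (z 0) z0.
Hypothesis hu : forall t, 0 < t ->
  [/\ weak_deriv (u t) (fun y => e t y + p t y),
      has_boundary_values (u t) (wR t (- 2^-1)) (wR t (2^-1)) &
      weak_deriv (e t) (cst 0)].
Hypothesis hflow : {ae mu, forall t, 0 < t -> {ae mu, forall y, I y ->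
  (pdot t y, zdot t y) = Neps eps KR (e t y, - derive1 V (z t y))}}.

(** The mean of the plastic strain is written as a primitive in time, which makes the stress
    continuous up to the horizon. *)
Definition stress t := t - tprim (mean_rate pdot T) t.

Lemma stress_continuous : {within `[0, T], continuous stress}.
Proof.
move=> x; apply: cvgB; first exact: (@continuous_subspaceT _ _ _ id (fun y => cvg_id)).
by apply: tprim_continuous; [exact: ltW|exact: mean_rate_integrable].
Qed.

Lemma flow_p t : 0 <= t -> ae_eqI (p t) (fun y => tprim (pdot ^~ y) t).
Proof.
move=> t0; have := ae_and (pp t0) p00; apply: ae_imply => y [h1 h2] Iy.
by rewrite h1 // h2 // add0r.
Qed.

Lemma flow_z t : 0 <= t -> ae_eqI (z t) (fun y => z0 y + tprim (zdot ^~ y) t).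
Proof.
move=> t0; have := ae_and (zz t0) z00; apply: ae_imply => y [h1 h2] Iy.
by rewrite h1 // h2.
Qed.

(** A vanishing weak derivative makes [e t] constant in space. The boundary values force [e t + p t]
    to have integral [t], which identifies the constant. *)
Lemma flow_stress_displacement t : 0 < t <= T ->
  ae_eqI (e t) (cst (stress t)) /\
  ae_eqI (u t) (fun y => - t / 2 + primitive_I (fun y => e t y + p t y) y).
Proof.
move=> /andP[t0 tT]; have t0' := ltW t0.
have [uw ub ew] := hu t0.
have ei := L2_integrable (hL2e t0'); have pi_ := L2_integrable (hL2p t0').
have [c ec] := weak_deriv_eq0 ei ew.
have ui : mu.-integrable I (EFin \o u t) by apply: L2_integrable; case: (hL2u t0').
have epi : mu.-integrable I (EFin \o (fun y => e t y + p t y)).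
  by have := integrableD measurable_I ei pi_; apply: eq_integrable.
have [uE intE] := weak_deriv_primitive ui epi uw ub.
split; last first.
  by apply: ae_imply uE => y h Iy; rewrite h // /wR mulrN mulNr.
have eint : \int[mu]_(y in I) e t y = c.
  rewrite -[RHS](Rintegral_cst_I c); apply: ae_eq_Rintegral => //.
  exact: integrable_measurable_EFin ei.
have pint : \int[mu]_(y in I) p t y = tprim (mean_rate pdot T) t.
  rewrite -mean_tprim //; last by rewrite t0'.
  apply: ae_eq_Rintegral => //; first exact: integrable_measurable_EFin pi_.
    by apply: integrable_measurable_EFin; exact: integrable_tprim_I.
  exact: flow_p.
move: intE; rewrite RintegralD // eint pint /wR => eq1.
have -> : stress t = c by rewrite /stress; lra.
exact: ec.
Qed.

Let Zf t y := z0 y + tprim (zdot ^~ y) t.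
Let rate t y := overshoot (stress t) (- derive1 V (Zf t y)) / eps.

(** At each such time [e t] and [z t] are exchanged for the almost everywhere equal [stress t] and
    [Zf t]. The upper bound 1 on the force in [Neps_KR] comes from V' >= -1. *)
Lemma flow_ae_time : {ae mu, forall t : RR, 0 < t <= T -> {ae mu, forall y : RR, I y ->
  - 4^-1 <= stress t <= 3 / 2 -> - 4^-1 <= - derive1 V (Zf t y) ->
  pdot t y = rate t y /\ zdot t y = rate t y}}.
Proof.
apply: ae_imply hflow => t ft /[dup] tT /andP[t0 _].
have [et _] := flow_stress_displacement tT.
have := ae_and (ae_and et (flow_z (ltW t0))) (ft t0).
apply: ae_imply => y [[e1 e2] e3] Iy s1 s2.
have := e3 Iy; rewrite e1 // e2 // Neps_KR //.
  by move=> [-> ->].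
by rewrite s2 /=; have := driving_ge hV2 hV2b hV'1 (Zf t y); lra.
Qed.

(** The exchange of quantifiers needs a measurable exceptional set. It is one because the stress is
    continuous in time and [Zf] is a time integral of a jointly measurable rate. *)
Lemma flow_ae_space : {ae mu, forall y : RR, I y -> {ae mu, forall t : RR, 0 <= t <= T ->
  - 4^-1 <= stress t <= 3 / 2 -> - 4^-1 <= - derive1 V (Zf t y) ->
  pdot t y = rate t y /\ zdot t y = rate t y}}.
Proof.
have mT : measurable (`[0, T]%classic : set RR) by exact: measurable_itv.
pose sg : RR * RR -> R := (stress \_ `[0, T]%classic) \o fst.
have msg : measurable_fun setT sg.
  apply: measurableT_comp; last exact: measurable_fst.
  apply/(measurable_restrictT _ mT).
  by apply: subspace_continuous_measurable_fun => //; exact: stress_continuous.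
pose zt : RR * RR -> R := fun x => (z0 \_ I) x.2 + \int[mu]_(s in `[0, x.1]) strip zdot T (s, x.2).
have mzt : measurable_fun setT zt.
  apply: measurable_funD; last exact: measurable_time_primitive.
  apply: (@measurableT_comp _ _ _ _ _ _ (z0 \_ I)); last exact: measurable_snd.
  by apply/(measurable_restrictT _ measurable_I); exact: measurable_z0.
pose zeta : RR * RR -> R := fun x => - derive1 V (zt x).
have mzeta : measurable_fun setT zeta.
  apply: (@measurableT_comp _ _ _ _ _ _ (fun r => - derive1 V r)) => //.
  apply: continuous_measurable_fun => r; apply: cvgN; exact: driving_continuous.
pose rt : RR * RR -> R := fun x => overshoot (sg x) (zeta x) / eps.
have mrt : measurable_fun setT rt.
  apply: measurable_funM => //; apply: measurable_funM => //.
  apply: measurable_maxr => //.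
  by apply: measurable_funD => //; exact: measurable_funD.
pose a x := strip pdot T x - rt x; pose b x := strip zdot T x - rt x.
have ma : measurable_fun setT a by apply: measurable_funB => //; exact: measurable_strip.
have mb : measurable_fun setT b by apply: measurable_funB => //; exact: measurable_strip.
have pre (f : RR * RR -> R) (A : set R) : measurable_fun setT f -> measurable A ->
    measurable (f @^-1` A) by move=> mf mA; rewrite -[X in measurable X]setTI; exact: mf.
(* The exceptional set is expressed through globally measurable functions that agree on the strip
   with the stress, the force and the two defects of the flow. *)
pose N := ((`[0, T]%classic `*` I) `&` sg @^-1` `[- 4^-1, 3 / 2]%classic `&`
  zeta @^-1` `[- 4^-1, +oo[%classic) `&` ~` (a @^-1` [set 0] `&` b @^-1` [set 0]).
have mN : measurable N.
  apply: measurableI; last by apply: measurableC; apply: measurableI; exact: pre.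
  apply: measurableI; last exact: pre.
  apply: measurableI; last exact: pre.
  exact: measurable_strip_dom.
have dom t y : 0 <= t <= T -> I y ->
    [/\ sg (t, y) = stress t, zeta (t, y) = - derive1 V (Zf t y) &
        a (t, y) = pdot t y - rate t y /\ b (t, y) = zdot t y - rate t y].
  move=> /[dup] tT /andP[t0 tT'] Iy.
  have sE : sg (t, y) = stress t by rewrite /sg /= patchE mem_set //= in_itv.
  have zE : zt (t, y) = Zf t y.
    rewrite /zt /Zf /= patchE mem_set //; congr (_ + _).
    apply: eq_Rintegral => s; rewrite inE /= in_itv /= => /andP[s0 st].
    by rewrite stripE // s0 (le_trans st tT').
  have zetaE : zeta (t, y) = - derive1 V (Zf t y) by rewrite /zeta zE.
  split; [exact: sE|exact: zetaE|].
  have rE : rt (t, y) = rate t y by rewrite -[LHS]/(overshoot (sg (t, y)) (zeta (t, y)) / eps) sE zetaE.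
  split.
    by rewrite -[LHS]/(strip pdot T (t, y) - rt (t, y)) rE (stripE pdot tT Iy).
  by rewrite -[LHS]/(strip zdot T (t, y) - rt (t, y)) rE (stripE zdot tT Iy).
have aeN : {ae mu, forall t : RR, {ae mu, forall y : RR, ~ N (t, y)}}.
  have n0 : {ae mu, forall t : RR, t != 0}.
    exists [set 0]; split; [exact: measurable_set1|exact: lebesgue_measure_set1|].
    by move=> y /= /negP; rewrite negbK => /eqP.
  have := ae_and flow_ae_time n0; apply: ae_imply => t [ft tn0].
  have [tT|tT] := boolP (0 <= t <= T); last first.
    by apply: aeW => y [[[[/= + _] _] _] _]; rewrite in_itv /=; exact/negP.
  have tT' : 0 < t <= T by case/andP: (tT) => t0 ->; rewrite lt_neqAle eq_sym tn0 t0.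
  apply: ae_imply (ft tT') => y fy [[[[/= _ Iy]]]].
  have [-> -> [-> ->]] := dom t y tT Iy.
  rewrite /= !in_itv /= andbT => s1 s2; have [// -> ->] := fy Iy s1 s2.
  by rewrite !subrr; apply; split.
have := @ae_swap _ _ _ _ R mu mu N mN aeN; apply: ae_imply => y; move=> fy Iy.
apply: ae_imply fy => t nN tT s1 s2.
have [d1 d2 [d3 d4]] := dom t y tT Iy.
apply: contrapT => h; apply: nN; split.
  by split; [split; [split => //=; rewrite in_itv|rewrite /= d1 in_itv]|rewrite /= d2 in_itv /= s2].
move=> /= [h1 h2]; apply: h; move: h1 h2; rewrite d3 d4.
by move=> /subr0_eq h1 /subr0_eq h2; split; [exact: h1|exact: h2].
Qed.

End FixedHorizon.
End RegularizedFlow.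

(** * A priori bounds on the stress for small eps *)

Section Concentration.
Context {R : realType}.
Notation mu := (@lebesgue_measure R).
Notation I := (@Defs.I R).
Notation RR := (measurableTypeR R).
Variables (V : R -> R) (M : R) (z0 : R -> R).
Hypothesis hV1 : forall x, derivable V x 1.
Hypothesis hV2 : forall x, derivable (derive1 V) x 1.
Hypothesis hV2b : forall x, - M <= derive1n 2 V x <= 0.
Hypothesis hVeven : forall x, V x = V (- x).
Hypothesis hV'1 : forall x, derive1 V x = -1 <-> 1 <= x.
Hypothesis z0c : {within Ibar, continuous z0}.
Hypothesis z0_ge0 : forall y, I y -> 0 <= z0 y.

Section FixedHorizon.
Variables (eps T r d : R) (pdot zdot : R -> R -> R).
Hypothesis T0 : 0 < T.
Hypothesis eps0 : 0 < eps.
Hypothesis r0 : 0 < r.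
Hypothesis r2 : r < 2^-1.
Hypothesis d0 : 0 < d.
Hypothesis d8 : d <= 8^-1.
Hypothesis epsr : eps <= r * d.
Hypothesis z0r : forall y, `|y| <= r -> 1 - d <= - derive1 V (z0 y).
Hypothesis hpdot : L2loc_L2 pdot.
Hypothesis hzdot : L2loc_L2 zdot.
Let sigma := stress T pdot.
Let Zf t y := z0 y + tprim (zdot ^~ y) t.
Let rate t y := overshoot (sigma t) (- derive1 V (Zf t y)) / eps.
Hypothesis flow_t : {ae mu, forall t : RR, 0 < t <= T -> {ae mu, forall y : RR, I y ->
  - 4^-1 <= sigma t <= 3 / 2 -> - 4^-1 <= - derive1 V (Zf t y) ->
  pdot t y = rate t y /\ zdot t y = rate t y}}.
Hypothesis flow_y : {ae mu, forall y : RR, I y -> {ae mu, forall t : RR, 0 <= t <= T ->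
  - 4^-1 <= sigma t <= 3 / 2 -> - 4^-1 <= - derive1 V (Zf t y) ->
  pdot t y = rate t y /\ zdot t y = rate t y}}.

(** The stress window of the explicit flow, assumed up to [T1] in the estimates below until
    [stress_safe] establishes it up to [T]. *)
Let safe T1 := forall s, 0 <= s <= T1 -> - 4^-1 <= sigma s <= 3 / 2.

Lemma ae_flow_lower_bound T1 : T1 <= T -> safe T1 ->
  {ae mu, forall y : RR, I y -> forall s, 0 <= s <= T1 -> z0 y <= Zf s y}.
Proof.
move=> T1T sT; have := ae_and (ae_integrable_time T hzdot) flow_y.
apply: ae_imply => y [zi fy] Iy.
exact: (flow_lower_bound hV1 hV2 hV2b hVeven eps0 (ltW T0) (zi Iy) (z0_ge0 Iy)
  (fy Iy) T1T sT).
Qed.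

Lemma ae_pdot_rate T1 : T1 <= T -> safe T1 ->
  {ae mu, forall t : RR, 0 < t <= T1 -> mu.-integrable I (EFin \o pdot t) /\
    {ae mu, forall y : RR, I y -> pdot t y = rate t y /\ z0 y <= Zf t y}}.
Proof.
move=> T1T sT.
have := ae_and flow_t (ae_integrable1 (integrable_strip T hpdot)).
apply: ae_imply => t [ft it] /[dup] tT1 /andP[t0 tT].
have tT' : 0 < t <= T by rewrite t0 (le_trans tT).
have tTc : 0 <= t <= T by rewrite ltW //= (le_trans tT).
have tc : 0 <= t <= T1 by rewrite ltW.
split.
  move/(integrableS measurableT measurable_I (@subsetT _ _)) : it.
  apply: eq_integrable; first exact: measurable_I.
  by move=> y; rewrite inE => Iy; rewrite /= stripE.
have := ae_and (ft tT') (ae_flow_lower_bound T1T sT).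
apply: ae_imply => y [fy ly] Iy; have Zt := ly Iy _ tc; split=> //.
have [] // := fy Iy (sT _ tc).
have := driving_le0 hV1 hV2 hV2b hVeven (le_trans (z0_ge0 Iy) Zt). rewrite -/(Zf t y); lra.
Qed.

(** The force never exceeds 1, so a stress of at most 1 produces no overshoot. *)
Lemma mean_rate_eq0 T1 : T1 <= T -> safe T1 ->
  {ae mu, forall t : RR, 0 < t <= T1 -> sigma t <= 1 -> mean_rate pdot T t = 0}.
Proof.
move=> T1T sT; apply: ae_imply (ae_pdot_rate T1T sT) => t ft /[dup] tT1 /andP[t0 tT] s1.
have [it fty] := ft tT1.
rewrite mean_rateE; last by rewrite ltW //= (le_trans tT).
rewrite -(Rintegral_cst_I 0); apply: ae_eq_Rintegral => //.
  exact: integrable_measurable_EFin it.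
apply: ae_imply fty => y fy Iy; have [-> _] := fy Iy.
rewrite /rate overshoot_eq0 ?mul0r //.
by have := driving_ge hV2 hV2b hV'1 (Zf t y); lra.
Qed.

(** For |y| <= r the force is at least its initial value, hence at least 1 - d, and the overshoot is
    at least ((1 + 2 d) + (1 - d) - 2) / 2 = d / 2. Divided by eps <= r d this is at least 1 / (2
    r), which has integral 1 over ]-r, r]. *)
Lemma mean_rate_ge1 T1 : T1 <= T -> safe T1 ->
  {ae mu, forall t : RR, 0 < t <= T1 -> 1 + 2 * d <= sigma t -> 1 <= mean_rate pdot T t}.
Proof.
move=> T1T sT; apply: ae_imply (ae_pdot_rate T1T sT) => t ft /[dup] tT1 /andP[t0 tT] s1.
have [it fty] := ft tT1.
rewrite mean_rateE; last by rewrite ltW //= (le_trans tT).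
pose k y : R := (2 * r)^-1 * \1_(`]- r, r]%classic) y.
have mk : measurable_fun (I : set RR) k.
  by apply: measurable_funM => //; exact: measurable_indic.
have rr : 0 <= (2 * r)^-1 by rewrite invr_ge0 mulr_ge0 // ltW.
have ki : mu.-integrable I (EFin \o k).
  apply: (@bounded_integrable_I _ _ ((2 * r)^-1)) => // y _.
  rewrite /k normrM ger0_norm // ler_piMr // indicE.
  by case: (_ \in _); rewrite ?normr1 ?normr0.
have k1 : \int[mu]_(y in I) k y = 1.
  have sub : `]- r, r]%classic `<=` I.
    by move=> y; rewrite in_I /= in_itv /= => /andP[? ?]; apply/andP; split; move: r2; lra.
  have mr : measurable (`]- r, r]%classic : set RR) by exact: measurable_itv.
  rewrite (Rintegral_zero_off mu measurable_I mr sub); last first.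
    by move=> y _ ry; rewrite /k indicE memNset // mulr0.
  transitivity (\int[mu]_(y in `]- r, r]) (2 * r)^-1).
    by apply: eq_Rintegral => y yr; rewrite /k indicE yr mulr1.
  rewrite Rintegral_cst_itv; last by rewrite ge0_cp // ltW.
  by rewrite opprK -mulr2n -[r *+ 2]mulr_natl mulVf // mulf_neq0 // gt_eqF.
rewrite -k1; apply: ae_le_Rintegral => //.
apply: ae_imply fty => y fy Iy; have [-> Zy] := fy Iy.
rewrite /k indicE; case: (boolP (y \in _)) => yr; last first.
  by rewrite mulr0 divr_ge0 ?overshoot_ge0 // ltW.
rewrite mulr1 ler_pdivlMr //.
have yr' : `|y| <= r.
  by move: yr; rewrite inE /= in_itv /= => /andP[y1 y2]; rewrite ler_norml y2 (ltW y1).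
apply: le_trans (overshoot_ge _ _).
have g1 : - derive1 V (z0 y) <= - derive1 V (Zf t y).
  by rewrite lerN2; exact: (driving_nincr hV2 hV2b).
have g2 := z0r yr'.
have : (2 * r)^-1 * eps <= (2 * r)^-1 * (r * d) by rewrite ler_wpM2l.
have -> : (2 * r)^-1 * (r * d) = d / 2 by field; rewrite gt_eqF.
lra.
Qed.

(** While the stress is at most min(t, 1), hence at most 1, the mean plastic rate vanishes: the
    stress then grows at the unit loading rate, at least as fast as min(t, 1). *)
Lemma stress_ge T1 : 0 <= T1 -> T1 <= T -> safe T1 ->
  forall t, 0 <= t <= T1 -> Num.min t 1 <= sigma t.
Proof.
move=> T10 T1T sT t tT1.
have cs := within_sub_itv (stress_continuous T0 hpdot) (lexx 0) T1T.
suff : 0 <= sigma t - Num.min t 1 by rewrite subr_ge0.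
apply: (@barrier _ (fun t => sigma t - Num.min t 1) T1 (-1) 0) tT1.
- by lra.
- move=> x; apply: cvgB; first exact: cs.
  apply: (@continuous_subspaceT _ _ _ (fun t : R => Num.min t 1)) => y.
  by apply: (@continuous_min _ _ id (cst 1)); [exact: cvg_id|exact: cvg_cst].
- by rewrite /sigma /stress tprim0 subr0 min_l // subrr.
- move=> t0 t1 /andP[t00 t01] t1T _ sle.
  have inc : tprim (mean_rate pdot T) t1 - tprim (mean_rate pdot T) t0 <= 0 * (t1 - t0).
    apply: (tprim_le (mean_rate_integrable T hpdot)) => //; first by lra.
    apply: ae_imply (mean_rate_eq0 T1T sT) => s ms /[dup] s01 /andP[s0 s1].
    rewrite ms //; first by apply/andP; split; lra.
    have := sle _ s01; have : Num.min s 1 <= 1 by rewrite ge_min lexx orbT.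
    by lra.
  have : Num.min t1 1 - Num.min t0 1 <= t1 - t0.
    by rewrite !minElt; case: ifPn; case: ifPn; rewrite -?leNgt; lra.
  by move: inc; rewrite /sigma /stress; lra.
Qed.

(** Above 1 + 2 d the mean plastic rate absorbs the unit loading rate, so the stress cannot increase
    there. *)
Lemma stress_le T1 : 0 <= T1 -> T1 <= T -> safe T1 ->
  forall t, 0 <= t <= T1 -> sigma t <= 1 + 2 * d.
Proof.
move=> T10 T1T sT t tT1.
have cs := within_sub_itv (stress_continuous T0 hpdot) (lexx 0) T1T.
suff : - (1 + 2 * d) <= - sigma t by rewrite lerN2.
apply: (@barrier _ (fun t => - sigma t) T1 (- (1 + 2 * d) - 1) (- (1 + 2 * d))) tT1.
- by lra.
- by move=> x; apply: cvgN; exact: cs.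
- by rewrite /sigma /stress tprim0 subr0; move: d0; lra.
- move=> t0 t1 /andP[t00 t01] t1T _ sle.
  have inc : 1 * (t1 - t0) <= tprim (mean_rate pdot T) t1 - tprim (mean_rate pdot T) t0.
    apply: (tprim_ge (mean_rate_integrable T hpdot)) => //; first by lra.
    apply: ae_imply (mean_rate_ge1 T1T sT) => s ms /[dup] s01 /andP[s0 s1].
    apply: ms; first by apply/andP; split; lra.
    by have := sle _ s01; rewrite lerN2.
  by move: inc; rewrite /sigma /stress; lra.
Qed.

(** At the first time the stress touches the boundary of the window, the two bounds are already
    valid and put it in [0, 1 + 2 d], which is contained in [0, 5/4] and away from the boundary. *)
Lemma stress_safe : safe T.
Proof.
move=> s sT; apply: contrapT => /negP ns.
case/andP: (sT) => s0 sT'.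
have cs := within_sub_itv (stress_continuous T0 hpdot) (lexx 0) sT'.
(* The window [-1/4, 3/2] has centre 5/8 and half-width 7/8. *)
pose f t := `|sigma t - 5 / 8|.
have sig0 : sigma 0 = 0 by rewrite /sigma /stress tprim0 subr0.
have [|||t1 [/andP[t10 t1s] ft1 hb]] := @first_hit _ f 0 s (7 / 8) s0.
- by move=> x; apply: cvg_norm; apply: cvgB; [exact: cs|exact: cvg_cst].
- by rewrite /f sig0 sub0r normrN ger0_norm; lra.
- rewrite leNgt; apply/negP; rewrite /f ltr_norml => /andP[? ?].
  by move/negP: ns; apply; apply/andP; split; lra.
have st1 : safe t1.
  move=> t /andP[tt0 tt1].
  have : f t <= 7 / 8.
    move: tt1; rewrite le_eqVlt => /orP[/eqP ->|tt1]; first by rewrite ft1.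
    by apply/ltW/hb; rewrite tt0.
  by rewrite /f ler_norml => /andP[? ?]; apply/andP; split; lra.
have t1T : t1 <= T by lra.
have t1t1 : 0 <= t1 <= t1 by rewrite t10 lexx.
have lo := stress_ge t10 t1T st1 t1t1.
have hi := stress_le t10 t1T st1 t1t1.
have m0 : 0 <= Num.min t1 1 by rewrite le_min t10 ler01.
have : f t1 < 7 / 8.
  by rewrite /f ltr_norml; apply/andP; split; move: d8 lo hi m0; lra.
by rewrite ft1 ltxx.
Qed.

Lemma ae_flow_conclusion : {ae mu, forall y : RR, I y -> forall t, 0 <= t <= T ->
  [/\ 0 <= tprim (pdot ^~ y) t,
      (forall c, z0 y < c -> - derive1 V c <= 1 - 2 * d -> tprim (pdot ^~ y) t = 0),
      tprim (zdot ^~ y) t = tprim (pdot ^~ y) t &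
      forall s, 0 <= s <= t -> tprim (pdot ^~ y) s <= tprim (pdot ^~ y) t]}.
Proof.
have := ae_and (ae_and (ae_integrable_time T hpdot) (ae_integrable_time T hzdot)) flow_y.
have sT := stress_safe.
apply: ae_imply => y [[pi_ zi] fy] Iy t /[dup] tT /andP[t0 tT'].
have inc := flow_increment_ge0 hV1 hV2 hV2b hVeven eps0 (ltW T0) (pi_ Iy) (zi Iy)
  (z0_ge0 Iy) (fy Iy) (lexx T) sT.
split.
- by have := inc 0 t (lexx 0) t0 tT'; rewrite tprim0 subr0.
- move=> c zc Vc.
  apply: (flow_rest hV1 hV2 hV2b hVeven eps0 (ltW T0) (pi_ Iy) (zi Iy)
    (z0_ge0 Iy) (fy Iy) zc Vc sT _ tT).
  by move=> s; apply: stress_le => //; exact: ltW.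
- exact: (flow_tprim_eq hV1 hV2 hV2b hVeven eps0 (ltW T0) (pi_ Iy) (zi Iy)
    (z0_ge0 Iy) (fy Iy) (lexx T) sT tT).
- by move=> s /andP[s0 st]; rewrite -subr_ge0; exact: inc.
Qed.

End FixedHorizon.
End Concentration.

(** * Concentration of the regularized solutions at the origin *)

Section RegularizedConcentration.
Context {R : realType}.
Notation mu := (@lebesgue_measure R).
Notation I := (@Defs.I R).
Notation RR := (measurableTypeR R).

(** All that the limit passage retains of a regularized solution. The parameter eps has disappeared,
    and [r] measures both the excess of the stress and the half-width of the plastic zone. *)
Record concentrated (r : R) (z0 : R -> R) (u e p z : R -> R -> R) : Prop := Concentrated {
  concentrated_p_integrable : forall t, 0 <= t -> mu.-integrable I (EFin \o p t);
  concentrated_u_integrable : forall t, 0 <= t -> mu.-integrable I (EFin \o u t);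
  concentrated_e_integrable : forall t, 0 <= t -> mu.-integrable I (EFin \o e t);
  concentrated_z_integrable : forall t, 0 <= t -> mu.-integrable I (EFin \o z t);
  concentrated_stress : forall t, 0 <= t ->
    Num.min t 1 <= t - \int[mu]_(y in I) p t y <= Num.min t 1 + r;
  concentrated_e : forall t, 0 <= t ->
    ae_eqI (e t) (cst (t - \int[mu]_(y in I) p t y));
  concentrated_u : forall t, 0 <= t ->
    ae_eqI (u t) (fun y => - t / 2 + primitive_I (fun y => e t y + p t y) y);
  concentrated_p : forall t, 0 <= t -> {ae mu, forall y : RR, I y ->
    [/\ 0 <= p t y, r <= `|y| -> p t y = 0 & z t y = z0 y + p t y]};
  concentrated_mono : forall s t, 0 <= s <= t ->
    {ae mu, forall y : RR, I y -> p s y <= p t y} }.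

Variables (V : R -> R) (M : R) (z0 : R -> R).
Hypothesis hV1 : forall x, derivable V x 1.
Hypothesis hV2 : forall x, derivable (derive1 V) x 1.
Hypothesis hV2b : forall x, - M <= derive1n 2 V x <= 0.
Hypothesis hVeven : forall x, V x = V (- x).
Hypothesis hV'1 : forall x, derive1 V x = -1 <-> 1 <= x.
Hypothesis z0c : {within Ibar, continuous z0}.
Hypothesis z01 : z0 0 = 1.
Hypothesis z0b : forall y, Ibar y -> y != 0 -> 0 <= z0 y < 1.

Lemma z0_ge0 y : I y -> 0 <= z0 y.
Proof.
move=> /I_sub_Ibar Iy; have [->|y0] := eqVneq y 0; first by rewrite z01.
by case/andP: (z0b Iy y0).
Qed.

(** By compactness [z0] attains a maximum below 1 away from the origin; the midpoint between it and
    1 makes the inequality strict. *)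
Lemma z0_away r : 0 < r -> exists c, c < 1 /\ forall y, I y -> r <= `|y| -> z0 y < c.
Proof.
move=> r0; pose K : set R := Ibar `&` [set y | r <= `|y|].
have cK : compact K.
  apply: compact_closedI; first exact: segment_compact.
  apply: (@closed_comp _ _ (fun y : R => `|y|) [set x | r <= x]).
    by move=> y _; exact: norm_continuous.
  exact: closed_ge.
have [K0|/set0P K0] := eqVneq K set0.
  exists 0; split=> // y /I_sub_Ibar Iy ry.
  by exfalso; suff : K y by rewrite K0.
have cz : {within K, continuous z0}.
  by apply: continuous_subspaceW z0c => y [].
have [y0] := compact_EVT_max K0 cK cz.
rewrite inE => -[Iy0 ry0] hmax.
have y00 : y0 != 0 by apply: contraTneq ry0 => ->; rewrite normr0 leNgt r0.
have /andP[_ z1] := z0b Iy0 y00.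
exists ((1 + z0 y0) / 2); split; first by lra.
move=> y Iy ry; have := hmax y; rewrite inE => /(_ (conj (I_sub_Ibar Iy) ry)).
lra.
Qed.

(** The force is continuous and equals 1 at the origin. Capping the radius by 1/4 keeps the
    neighbourhood inside [Ibar]. *)
Lemma z0_near d : 0 < d -> exists r, 0 < r < 2^-1 /\
  forall y, `|y| <= r -> 1 - d <= - derive1 V (z0 y).
Proof.
move=> d0; have I0 : Ibar (0 : R) by rewrite in_Ibar; apply/andP; split; lra.
have cz : z0 y @[y --> within Ibar (nbhs (0 : R))] --> z0 0.
  exact: ((subspace_continuousP Ibar z0).1 z0c 0 I0).
have cV : derive1 V (z0 y) @[y --> within Ibar (nbhs (0 : R))] --> derive1 V (z0 0).
  apply: (cvg_comp z0 (derive1 V) cz); exact: (@driving_continuous _ V hV2).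
move/cvgrPdist_le : cV => /(_ d d0) [q /= q0 hq].
exists (Num.min (q / 2) 4^-1); split.
  by rewrite lt_min gt_min; apply/andP; split; [apply/andP; split|apply/orP; right]; lra.
move=> y; rewrite le_min => /andP[yq y4].
have := hq y; rewrite /= sub0r normrN => /(_ _ _) h.
have : `|derive1 V (z0 0) - derive1 V (z0 y)| <= d.
  apply: h; first by lra.
  by rewrite in_Ibar -ler_norml; lra.
rewrite z01 (hV'1 1).2 // ler_norml => /andP[? ?]; lra.
Qed.

(** Two radii play different roles: [r] is the prescribed half-width of the plastic zone, while on
    |y| <= r1 the initial force is within [d] of 1, and this smaller set of sources is what holds
    the stress down. *)
Lemma eps_solution_concentrated r : 0 < r -> exists eps0, 0 < eps0 /\
  forall eps u e p z, 0 < eps <= eps0 ->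
    eps_solution eps V wR (cst 0) (cst 0) (cst 0) z0 u e p z ->
    concentrated r z0 u e p z.
Proof.
move=> r0; have [c [c1 hc]] := z0_away r0.
have gc : - derive1 V c < 1 by have := driving_gt hV2 hV2b hV'1 c1; lra.
(* The bound 1/8 keeps the stress inside its window, the second one makes the force at [c] at most 1
   - 2 d so that points with |y| >= r stay at rest, and r / 2 makes the stress exceed 1 by at most
   [r]. *)
pose d := Num.min 8^-1 (Num.min ((1 + derive1 V c) / 2) (r / 2)).
have d0 : 0 < d by rewrite !lt_min; apply/andP; split; [|apply/andP; split]; lra.
have d8 : d <= 8^-1 by rewrite ge_min lexx.
have dc : - derive1 V c <= 1 - 2 * d.
  have : d <= (1 + derive1 V c) / 2 by rewrite !ge_min lexx orbT.
  by lra.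
have dr : 2 * d <= r.
  have : d <= r / 2 by rewrite !ge_min lexx !orbT.
  by lra.
have [r1 [/andP[r10 r12] hr1]] := z0_near d0.
exists (r1 * d); split; first exact: mulr_gt0.
move=> eps u e p z /andP[eps0 epsr] [udot [edot [pdot [zdot]]]].
move=> [[Hu He Hp Hz] [u0E e0E p0E z0E] hu hflow].
have [L2u _ pu] := Hu; have [L2e _ _] := He.
have [L2p hpdot pp] := Hp; have [L2z hzdot zz] := Hz.
have fp := flow_p pp p0E; have fz := flow_z zz z0E.
have mid T t : 0 <= t <= T -> \int[mu]_(y in I) p t y = tprim (mean_rate pdot T) t.
  move=> /[dup] tT /andP[t0 _]; rewrite -mean_tprim //; apply: ae_eq_Rintegral => //.
  - exact: integrable_measurable_EFin (L2_integrable (L2p _ t0)).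
  - by apply: integrable_measurable_EFin; exact: integrable_tprim_I.
  - exact: fp.
(* The horizon is left free: below, the estimates at time [t] are taken with horizon [t]. *)
have ft T (T0 : 0 < T) := flow_ae_time hV2 hV2b hV'1 T L2u L2e L2p hpdot pp zz p0E z0E hu hflow.
have fy T (T0 : 0 < T) := flow_ae_space hV2 hV2b hV'1 z0c T0 L2u L2e L2p hpdot hzdot pp zz p0E z0E hu hflow.
have sd T := @flow_stress_displacement _ T _ _ _ _ L2u L2e L2p hpdot pp p0E hu.
have safeT T (T0 : 0 < T) := stress_safe hV1 hV2 hV2b hVeven hV'1 z0_ge0 T0 eps0 r10 r12 d0 d8
  epsr hr1 hpdot hzdot (ft T T0) (fy T T0).
have concl T (T0 : 0 < T) := ae_flow_conclusion hV1 hV2 hV2b hVeven hV'1 z0_ge0 T0 eps0 r10 r12 d0 d8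
  epsr hr1 hpdot hzdot (ft T T0) (fy T T0).
have p0int : \int[mu]_(y in I) p 0 y = 0.
  by rewrite (mid 1) ?tprim0 //; lra.
split.
- by move=> t t0; apply: L2_integrable; exact: L2p.
- by move=> t t0; apply: L2_integrable; case: (L2u t t0).
- by move=> t t0; apply: L2_integrable; exact: L2e.
- by move=> t t0; apply: L2_integrable; exact: L2z.
(* Time 0 is treated apart, here and below: the equations hold at positive times only, and the
   initial data are used instead. *)
- move=> t; rewrite le_eqVlt => /orP[/eqP <-|t0].
    by rewrite p0int subr0 min_l // lexx add0r ltW.
  have tt : 0 <= t <= t by rewrite ltW /=.
  rewrite (mid t) //; apply/andP; split.
    exact: (stress_ge hV1 hV2 hV2b hVeven hV'1 z0_ge0 t0 eps0 hpdot hzdot (ft t t0) (fy t t0)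
      (ltW t0) (lexx t) (safeT t t0) tt).
  have h1 := stress_le hV1 hV2 hV2b hVeven z0_ge0 t0 eps0 r10 r12 d0
    epsr hr1 hpdot hzdot (ft t t0) (fy t t0) (ltW t0) (lexx t) (safeT t t0) tt.
  have h2 : 0 <= \int[mu]_(y in I) p t y.
    rewrite -(Rintegral_cst_I 0); apply: ae_le_Rintegral => //.
    + exact: integrable_cst_I.
    + by apply: L2_integrable; apply: L2p; exact: ltW.
    + have := ae_and (concl t t0) (fp t (ltW t0)); apply: ae_imply => y [cy py] Iy.
      by rewrite py //; case: (cy Iy t tt).
  rewrite (mid t) // in h2; move: h1; rewrite /stress minElt; case: ifPn => _; lra.
- move=> t; rewrite le_eqVlt => /orP[/eqP <-|t0].
    by rewrite p0int subr0.
  have [h _] := sd t t ltac:(by rewrite t0 /=).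
  by rewrite (mid t) //; rewrite ltW /=.
- move=> t; rewrite le_eqVlt => /orP[/eqP <-|t0]; last first.
    by have [_ h] := sd t t ltac:(by rewrite t0 /=).
  have := u0E; apply: ae_imply => y h Iy; rewrite h // oppr0 mul0r add0r.
  symmetry; rewrite -(mul0r (y + 2^-1)) /primitive_I.
  have epi : mu.-integrable I (EFin \o (fun y => e 0 y + p 0 y)).
    have := integrableD measurable_I (L2_integrable (L2e 0 (lexx 0))) (L2_integrable (L2p 0 (lexx 0))).
    by apply: eq_integrable.
  rewrite mul0r; transitivity (\int[mu]_(y0 in `[- 2^-1, y]) (0 : R)); last first.
    by rewrite Rintegral_cst // mul0r.
  apply: ae_eq_Rintegral => //.
    apply: integrable_measurable_EFin.
    by apply: integrable_restrict_I epi; exact: measurable_itv.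
  have := ae_and e0E p0E; apply: ae_imply => x [ex px] _.
  rewrite patchE; case: ifPn => //; rewrite inE => Ix.
  by rewrite ex // px // addr0.
- move=> t; rewrite le_eqVlt => /orP[/eqP <-|t0].
    have := ae_and p0E z0E; apply: ae_imply => y [h1 h2] Iy.
    by rewrite h1 // h2 // addr0.
  have tt : 0 <= t <= t by rewrite ltW /=.
  have := ae_and (concl t t0) (ae_and (fp t (ltW t0)) (fz t (ltW t0))).
  apply: ae_imply => y [cy [py zy]] Iy.
  rewrite py // zy //; have [h1 h2 h3 _] := cy Iy t tt.
  by split => //; [move=> ry; exact: (h2 c (hc _ Iy ry) dc)|rewrite h3].
- move=> s t /andP[]; rewrite le_eqVlt => /orP[/eqP <-|s0] st.
    move: st; rewrite le_eqVlt => /orP[/eqP <-|t0]; first exact: aeW.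
    have tt : 0 <= t <= t by rewrite ltW /=.
    have := ae_and (concl t t0) (ae_and (fp t (ltW t0)) p0E).
    apply: ae_imply => y [cy [py p0y]] Iy; rewrite py // p0y //.
    by case: (cy Iy t tt).
  have t0 : 0 < t by exact: lt_le_trans st.
  have tt : 0 <= t <= t by rewrite ltW /=.
  have := ae_and (concl t t0) (ae_and (fp t (ltW t0)) (fp s (ltW s0))).
  apply: ae_imply => y [cy [py ps]] Iy; rewrite py // ps //.
  by have [_ _ _ h] := cy Iy t tt; apply: h; rewrite ltW.
Qed.

End RegularizedConcentration.

(** * Continuous one-homogeneous integrands *)

Section ChomFacts.
Context {R : realType}.
Notation RR := (measurableTypeR R).
Variables (m d : nat) (f : @integrand R m d).
Hypothesis hf : Chom f.
Implicit Types (xi : 'M[R]_(m, d)) (y eta : R).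

Lemma Chom_eps_delta y0 xi0 eta0 (e : R) : Ibar y0 -> 0 < e ->
  exists2 r : R, 0 < r & forall y xi eta, Ibar y -> `|y - y0| < r ->
    (forall i j, `|xi i j - xi0 i j| < r) -> `|eta - eta0| < r ->
    `|f y xi eta - f y0 xi0 eta0| < e.
Proof.
move=> Iy0 e0; have [cf _] := hf.
pose A := [set x : R * 'M[R]_(m, d) * R | Ibar x.1.1].
have /cvgrPdist_lt/(_ _ e0) := (subspace_continuousP A _).1 cf (y0, xi0, eta0) Iy0.
rewrite /within /= => /nbhs_ballP[r /= r0 hr]; exists r => // y xi eta Iy yr xr er.
rewrite distrC; apply: (hr (y, xi, eta)) => //; split; last first.
  by rewrite /ball /= distrC.
split; first by rewrite /ball /= distrC.
by split=> // i j; rewrite /ball /= distrC.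
Qed.

Lemma Chom_scale y xi eta s : Ibar y -> 0 <= s ->
  f y (s *: xi) (s * eta) = s * f y xi eta.
Proof. by move=> Iy s0; have [_ h] := hf; exact: h. Qed.

Lemma Chom00 y : Ibar y -> f y 0 0 = 0.
Proof. by move=> Iy; have := @Chom_scale y 0 0 0 Iy (lexx 0); rewrite scaler0 !mul0r. Qed.

(** Near (0, 0) the integrand is smaller than 1 uniformly in [y], by compactness of [Ibar];
    homogeneity turns this into linear growth. *)
Lemma Chom_bound : exists2 C, 0 <= C & forall y xi eta B, Ibar y -> 0 <= B ->
  (forall i j, `|xi i j| <= B) -> `|eta| <= B -> `|f y xi eta| <= C * B.
Proof.
have cI : compact (@Ibar R) by exact: segment_compact.
pose P r y := Ibar y -> forall xi eta, (forall i j, `|xi i j| < r) -> `|eta| < r ->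
  `|f y xi eta| < 1.
have : \forall r \near (0 : R)^'+, Ibar `<=` P r.
  apply: ((compact_near_coveringP Ibar).1 cI) => y Iy.
  have [q q0 hq] := @Chom_eps_delta y 0 0 1 Iy ltr01.
  exists ([set y' | `|y' - y| < q], [set r | r < q]).
    split => /=; last exact: nbhs_right_lt.
    by exists q => // y' /=; rewrite distrC.
  move=> [y' r] [/= yq rq] Iy' xi eta hx he.
  have := hq y' xi eta Iy' yq; rewrite Chom00 // !subr0; apply.
    by move=> i j; rewrite mxE subr0; apply: lt_trans rq.
  by apply: lt_trans rq.
move=> [q /= q0 hq].
pose r := q / 2; have r0 : 0 < r by rewrite divr_gt0.
have hr : Ibar `<=` P r.
  by apply: hq => //=; rewrite sub0r normrN gtr0_norm // /r; move: q0 => /=; lra.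
exists (2 / r); first by rewrite divr_ge0 // ltW.
move=> y xi eta B Iy; rewrite le_eqVlt => /orP[/eqP <- hx he|B0 hx he].
  have -> : xi = 0.
    by apply/matrixP => i j; rewrite mxE; apply/eqP; rewrite -normr_le0.
  have -> : eta = 0 by apply/eqP; rewrite -normr_le0.
  by rewrite Chom00 // normr0 mulr0.
(* The factor 2 makes the rescaled entries strictly smaller than [r]. *)
pose s := r / (2 * B); have s0 : 0 < s by rewrite divr_gt0 // mulr_gt0.
have sB : s * B < r.
  by rewrite /s invfM mulrA mulrVK ?unitfE ?gt_eqF // ltr_pdivrMr // ltr_pMr // ltr1n.
have : s * `|f y xi eta| < 1.
  rewrite -{1}(gtr0_norm s0) -normrM -(Chom_scale xi eta Iy (ltW s0)).
  apply: (hr y Iy Iy) => [i j|]; rewrite ?mxE normrM gtr0_norm //; apply: le_lt_trans sB.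
    by rewrite ler_pM2l.
  by rewrite ler_pM2l.
rewrite -ltr_pdivlMl // => /ltW h1; apply: le_trans h1 _.
by rewrite mulr1 /s invf_div mulrAC.
Qed.

End ChomFacts.

(** * Measurability of composed integrands *)

Section ChomMeasurable.
Context {R : realType}.
Notation RR := (measurableTypeR R).

Lemma countable_fibers_measurable (C : countType) (D : set RR)
    (h : RR -> C) (k : C -> R) : measurable D ->
  (forall c, measurable (D `&` h @^-1` [set c])) ->
  measurable_fun D (k \o h).
Proof.
move=> mD mh _ B mB.
have -> : D `&` (k \o h) @^-1` B =
    \bigcup_c ((D `&` h @^-1` [set c]) `&` [set _ | B (k c)]).
  apply/seteqP; split => y /=.
    by move=> [Dy By]; exists (h y).
  by move=> [c _ /= [[Dy hc] Bc]]; split => //; rewrite hc.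
apply: countable_bigcupT_measurable => [|c]; first exact: countableP.
have [Bc|Bc] := pselect (B (k c)).
  rewrite (_ : [set _ | _] = setT) ?setIT; first exact: mh.
  by apply/seteqP; split.
rewrite (_ : [set _ | _] = set0) ?setI0 //.
by apply/seteqP; split.
Qed.

Definition quantize (n : nat) (x : R) : R := (Num.floor (x * n.+1%:R))%:~R / n.+1%:R.

Lemma quantize_cvg x : quantize n x @[n --> \oo] --> x.
Proof.
apply/cvgrPdist_le => e e0.
have : (n.+1%:R^-1 : R) @[n --> \oo] --> 0 by exact: cvg_harmonic.
move/cvgrPdist_le => /(_ e e0); apply: filterS => n.
rewrite sub0r normrN ger0_norm ?invr_ge0 // => ne; apply: le_trans ne.
have n0 : 0 < n.+1%:R :> R by rewrite ltr0n.
rewrite /quantize -{1}(mulfK (lt0r_neq0 n0) x) -mulrBl normrM.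
rewrite (ger0_norm (x := n.+1%:R^-1)) ?invr_ge0 // ler_piMl ?invr_ge0 //.
have /andP[h1 h2] := floor_itv (x * n.+1%:R).
rewrite ger0_norm ?subr_ge0 //; move: h2; rewrite intrD; lra.
Qed.

Lemma measurable_floor_fiber (D : set RR) (g : RR -> R) (n : nat) (c : int) :
  measurable D -> measurable_fun D g ->
  measurable (D `&` [set y | Num.floor (g y * n.+1%:R) = c]).
Proof.
move=> mD mg.
have mg' : measurable_fun D (fun y => g y * n.+1%:R) by exact: measurable_funM.
have -> : D `&` [set y | Num.floor (g y * n.+1%:R) = c] =
    D `&` (fun y => g y * n.+1%:R) @^-1` `[c%:~R, (c + 1)%:~R[%classic.
  apply/seteqP; split => y /= [Dy].
    by move=> <-; split => //; rewrite in_itv /= floor_itv.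
  by rewrite in_itv /= => /floor_def ->.
by apply: mg'.
Qed.

Variables (m d : nat) (f : @integrand R m d).
Hypothesis hf : Chom f.

(** Quantizing all arguments gives functions with countably many values and measurable fibres, and
    continuity of [f] yields pointwise convergence. As [f] is continuous only over [Ibar], the
    quantized [y] is clamped back into it. *)
Lemma Chom_measurable (D : set RR) (X : RR -> 'M[R]_(m, d)) (eta : RR -> R) :
  measurable D -> D `<=` Ibar -> (forall i j, measurable_fun D (fun y => X y i j)) ->
  measurable_fun D eta -> measurable_fun D (fun y => f y (X y) (eta y)).
Proof.
move=> mD DI mX meta.
pose clamp (y : R) := Num.max (- 2^-1) (Num.min y 2^-1).
have clampI y : Ibar (clamp y).
  by rewrite in_Ibar le_max lexx ge_max ge_min lexx orbT andbT /=; lra.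
have clamp_dist y q : Ibar y -> `|clamp q - y| <= `|y - q|.
  rewrite in_Ibar => /andP[? ?]; have := ler_norm (y - q); have := ler_norm (q - y).
  rewrite distrC ler_norml /clamp maxElt minElt; move: (`|y - q|) => N ? ?.
  by do 2 case: ifPn; rewrite -?leNgt => *; apply/andP; split; lra.
pose ev n (c : int * {ffun 'I_m * 'I_d -> int} * int) : R :=
  f (clamp (c.1.1%:~R / n.+1%:R)) (\matrix_(i, j) ((c.1.2 (i, j))%:~R / n.+1%:R))
    (c.2%:~R / n.+1%:R).
pose code n (y : RR) : int * {ffun 'I_m * 'I_d -> int} * int :=
  (Num.floor (y * n.+1%:R), [ffun ij => Num.floor (X y ij.1 ij.2 * n.+1%:R)],
   Num.floor (eta y * n.+1%:R)).
pose g n (y : RR) := f (clamp (quantize n y)) (\matrix_(i, j) quantize n (X y i j))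
   (quantize n (eta y)).
have gE n : g n = ev n \o code n.
  apply/funext => y; rewrite /g /ev /code /=; congr (f _ _ _).
  by apply/matrixP => i j; rewrite !mxE ffunE.
have mgn n : measurable_fun D (g n).
  rewrite gE; apply: (@countable_fibers_measurable (int * {ffun 'I_m * 'I_d -> int} * int)%type) => // -[[a b] c].
  have -> : D `&` code n @^-1` [set (a, b, c)] =
     (D `&` [set y | Num.floor (y * n.+1%:R) = a]) `&`
     (D `&` [set y | Num.floor (eta y * n.+1%:R) = c]) `&`
     \bigcap_(ij : 'I_m * 'I_d) (D `&` [set y | Num.floor (X y ij.1 ij.2 * n.+1%:R) = b ij]) `|` D `&` set0.
    rewrite setI0 setU0; apply/seteqP; split => y /=.
      move=> [Dy [<- <- <-]]; split; first by split.
      by move=> ij _ /=; rewrite ffunE.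
    move=> [[[Dy <-] [_ <-]] h]; split => //; congr (_, _, _).
    by apply/ffunP => ij; rewrite ffunE; case: (h ij Logic.I).
  rewrite setI0 setU0; apply: measurableI.
    apply: measurableI; last exact: measurable_floor_fiber.
    by apply: (@measurable_floor_fiber D id).
  apply: fin_bigcap_measurable => // ij _.
  exact: measurable_floor_fiber.
apply: (measurable_fun_cvg mgn) => y Dy.
have Iy := DI _ Dy.
apply/cvgrPdist_lt => e e0.
have [r r0 hr] := Chom_eps_delta hf (X y) (eta y) Iy e0.
near=> n; rewrite distrC; apply: hr => //.
- apply: le_lt_trans (clamp_dist _ _ Iy) _.
  by near: n; have /cvgrPdist_lt := @quantize_cvg y; apply.
- move=> i j; rewrite mxE distrC; move: i j; near: n.
  apply: filter_forall => i; apply: filter_forall => j.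
  by have /cvgrPdist_lt := @quantize_cvg (X y i j); apply.
- by rewrite distrC; near: n; have /cvgrPdist_lt := @quantize_cvg (eta y); apply.
Unshelve. all: by end_near. Qed.

End ChomMeasurable.

(** * Lebesgue measure on I as a finite measure *)

Section LebesgueOnI.
Context {R : realType}.
Notation mu := (@lebesgue_measure R).
Notation I := (@Defs.I R).
Notation RR := (measurableTypeR R).
Implicit Types (G : RR -> R) (A : set RR).

Lemma lebesgue_I_lty : (mu (I : set RR) < +oo)%E.
Proof. by rewrite [X in (X < _)%E]lebesgue_I ltry. Qed.

(** Bundled as a finite measure on the line, so that it can itself serve as dominating measure in
    [delta_pairing]. *)
Definition lebI : {finite_measure set RR -> \bar R} :=
  mfrestr (@measurable_I R) lebesgue_I_lty.

Lemma lebIE A : lebI A = mu (A `&` I). Proof. by []. Qed.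

Lemma lebI_setD A : measurable A -> lebI (A `\` I) = 0%E.
Proof.
move=> mA; rewrite lebIE setDE -setIA setICl setI0.
exact: measure0.
Qed.

Lemma lebI_integral_sub A (f : RR -> \bar R) : A `<=` I ->
  (\int[lebI]_(x in A) f x = \int[mu]_(x in A) f x)%E.
Proof.
move=> AI; apply: eq_measure_integral => B mB BA.
by rewrite [LHS]lebIE setIidl //; exact: subset_trans AI.
Qed.

Lemma setDI_I A : A `\` (A `\` I) = A `&` I.
Proof. by rewrite setDD. Qed.

Lemma integrable_lebI G : measurable_fun setT G -> mu.-integrable I (EFin \o G) ->
  lebI.-integrable setT (EFin \o G).
Proof.
move=> mG /integrableP[_ Gi]; apply/integrableP; split; first exact/measurable_EFinP.
rewrite (@ge0_negligible_integral _ _ _ lebI setT (setT `\` I)) //.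
- by rewrite setDI_I setTI lebI_integral_sub.
- exact: measurableD.
- by apply: measurableT_comp => //; exact/measurable_EFinP.
- exact: lebI_setD.
Qed.

Lemma lebI_integral G A : measurable A -> lebI.-integrable setT (EFin \o G) ->
  (\int[lebI]_(x in A) (G x)%:E = \int[mu]_(x in A `&` I) (G x)%:E)%E.
Proof.
move=> mA Gi; have GA := integrableS measurableT mA (@subsetT _ _) Gi.
rewrite (@negligible_integral _ _ _ lebI A (A `\` I)) //.
- by rewrite setDI_I lebI_integral_sub //; exact: subIsetr.
- exact: measurableD.
- exact: lebI_setD.
Qed.

Lemma L1_chargeE (g : R -> R) A : mu.-integrable I (EFin \o g) ->
  L1_charge g A = (\int[mu]_(y in A) ((g \_ I) y)%:E)%E.
Proof.
move=> gi; have gi' := integrable_restrict_I measurableT gi.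
by rewrite /L1_charge; case: pselect.
Qed.

Lemma L1_charge1E A : measurable A -> L1_charge (cst 1) A = lebI A.
Proof.
move=> mA; rewrite L1_chargeE; last exact: integrable_cst_I.
rewrite [RHS]lebIE -[RHS]mul1e -integral_cst; last exact: measurableI.
by rewrite [RHS]integral_mkcondr; apply: eq_integral => y _; rewrite restrict_EFin.
Qed.

Lemma lebI_dominated (lam : {finite_measure set RR -> \bar R}) :
  L1_charge (cst 1) `<< lam -> lebI `<< lam.
Proof.
move=> /null_content_dominatesP h; apply/null_content_dominatesP => A mA A0.
by rewrite -L1_charge1E // h.
Qed.

End LebesgueOnI.

(** * Densities with respect to a dominating measure *)

Section Density.
Context {R : realType}.
Notation mu := (@lebesgue_measure R).
Notation I := (@Defs.I R).
Notation RR := (measurableTypeR R).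
Variable lam : {finite_measure set RR -> \bar R}.

Lemma Radon_Nikodym_unique (q : {charge set RR -> \bar R}) (g : RR -> R) :
  q `<< lam -> lam.-integrable setT (EFin \o g) ->
  (forall A, measurable A -> q A = (\int[lam]_(x in A) (g x)%:E)%E) ->
  {ae lam, forall y, fine (Radon_Nikodym q lam y) = g y}.
Proof.
move=> qlam gi qE.
have : ae_eq lam setT (Radon_Nikodym q lam) (EFin \o g).
  apply: integral_ae_eq => //; first exact: Radon_Nikodym_integrable.
    by case/integrableP: gi.
  by move=> A _ mA; rewrite -Radon_Nikodym_integral // qE.
by apply: filterS => y /(_ Logic.I) ->.
Qed.

Hypothesis lebI_lam : lebI `<< lam.

(** This version of the derivative is finite and nonnegative at every point, so that it can be
    pulled out of a one-homogeneous integrand pointwise. *)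
Definition leb_density (y : RR) : R :=
  fine (Radon_Nikodym_SigmaFinite.f (@lebI R) lam y).

Lemma leb_densityE y : (leb_density y)%:E = Radon_Nikodym_SigmaFinite.f (@lebI R) lam y.
Proof. by rewrite /leb_density fineK //; exact: Radon_Nikodym_SigmaFinite.f_fin_num. Qed.

Lemma leb_density_ge0 y : 0 <= leb_density y.
Proof. by rewrite fine_ge0 //; exact: Radon_Nikodym_SigmaFinite.f_ge0. Qed.

Lemma leb_density_integrable : lam.-integrable setT (EFin \o leb_density).
Proof.
apply: eq_integrable (Radon_Nikodym_SigmaFinite.f_integrable lebI_lam) => //.
by move=> y _; rewrite /= leb_densityE.
Qed.

Lemma leb_density_integral A : measurable A ->
  lebI A = (\int[lam]_(x in A) (leb_density x)%:E)%E.
Proof.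
move=> mA; rewrite (Radon_Nikodym_SigmaFinite.f_integral lebI_lam) //.
by apply: eq_integral => y _; rewrite leb_densityE.
Qed.

(** The link with [Radon_Nikodym], in which the change of variables formula is phrased. *)
Lemma ae_leb_density :
  {ae lam, forall y, Radon_Nikodym (charge_of_finite_measure (@lebI R)) lam y = (leb_density y)%:E}.
Proof.
have dom : charge_of_finite_measure (@lebI R) `<< lam by exact: lebI_lam.
have := Radon_Nikodym_unique dom leb_density_integrable leb_density_integral.
by apply: filterS => y <-; rewrite fineK // Radon_Nikodym_fin_num.
Qed.

Lemma integrable_densityM (G : RR -> R) : measurable_fun setT G ->
  lebI.-integrable setT (EFin \o G) ->
  lam.-integrable setT (EFin \o (fun y => G y * leb_density y)).
Proof.
move=> mG Gi; have md := integrable_measurable_EFin leb_density_integrable.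
have Gn : lebI.-integrable setT (EFin \o (fun y => `|G y|)) by exact: integrable_norm.
have := Radon_Nikodym_SigmaFinite.integrableM lebI_lam (fun y => _) measurableT Gn.
move=> /(_ (fun y => normr_ge0 _)).
apply: le_integrable => //; first by apply/measurable_EFinP; exact: measurable_funM.
move=> y _ /=; rewrite -leb_densityE -EFinM lee_fin.
by rewrite !normrM normr_id.
Qed.

Lemma integral_densityM (G : RR -> R) A : measurable A -> measurable_fun setT G ->
  lebI.-integrable setT (EFin \o G) ->
  (\int[lam]_(y in A) (G y * leb_density y)%:E = \int[lebI]_(y in A) (G y)%:E)%E.
Proof.
move=> mA mG Gi.
have GA := integrableS measurableT mA (@subsetT _ _) Gi.
rewrite -(Radon_Nikodym_change_of_variables lebI_lam mA GA).
have md := integrable_measurable_EFin leb_density_integrable.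
have dom : charge_of_finite_measure (@lebI R) `<< lam by exact: lebI_lam.
apply: ae_eq_integral => //.
- apply/measurable_EFinP; apply: measurable_funTS; exact: measurable_funM.
- apply: emeasurable_funM; first by apply/measurable_EFinP; exact: measurable_funTS.
  by apply: measurable_funTS; case/integrableP: (Radon_Nikodym_integrable dom).
- by apply: filterS ae_leb_density => y -> _.
Qed.

(* x / 0 = 0 makes this vanish when lam has no atom at 0 *)
Definition dirac_density (y : RR) : R := \1_([set 0] : set RR) y / fine (lam [set 0]).

Lemma dirac_density_integrable : lam.-integrable setT (EFin \o dirac_density).
Proof.
apply: measurable_bounded_integrable => //.
- by rewrite -ge0_fin_numE // fin_num_measure.
- apply: measurable_funM => //; apply: measurable_indic; exact: measurable_set1.
exists `|(fine (lam [set 0]))^-1|; split; first exact: num_real.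
move=> B /ltW hB y _; apply: le_trans hB.
rewrite normrM ler_piMl // indicE.
by case: (_ \in _); rewrite ?normr1 ?normr0.
Qed.

Lemma dirac_density_integral A : measurable A ->
  (\int[lam]_(y in A) (dirac_density y)%:E =
   (if lam [set 0%R] == 0 then 0 else \d_(0%R : RR) A))%E.
Proof.
move=> mA.
have m0 : measurable ([set 0] : set RR) by exact: measurable_set1.
have fl : (fine (lam [set 0]))%:E = lam [set 0] by rewrite fineK // fin_num_measure.
rewrite /dirac_density; under eq_integral do rewrite mulrC EFinM.
rewrite integralZl //; last exact: (integrableS measurableT mA (@subsetT _ _) (integrable_indic lam m0)).
rewrite integral_indic //.
have [A0|A0] := boolP ((0 : RR) \in A).
  have -> : [set 0] `&` A = [set 0] by apply/setIidPl => _ ->; exact: set_mem.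
  rewrite diracE A0 /= -fl -EFinM; case: ifPn => [/eqP e|e].
    by rewrite e invr0 mul0r.
  by rewrite mulVf // -eqe fl -fl.
have -> : [set 0] `&` A = set0.
  by apply/seteqP; split => // y [/= ->] /mem_set; rewrite (negbTE A0).
by rewrite measure0 mule0 diracE (negbTE A0); case: ifPn.
Qed.

End Density.

(** * Pairing with a density plus an atom at the origin *)

Section DeltaPairing.
Context {R : realType}.
Notation mu := (@lebesgue_measure R).
Notation I := (@Defs.I R).
Notation RR := (measurableTypeR R).
Notation charge := ({charge set RR -> \bar R}).

Lemma integrable_sumR (T : finType) (F : T -> R -> R) :
  (forall i, mu.-integrable I (EFin \o F i)) ->
  mu.-integrable I (EFin \o (fun y => \sum_i F i y)).
Proof.
move=> Fi; have := @integrable_sum _ _ _ mu I measurable_I _ (enum T) xpredT (fun i => EFin \o F i) (fun i _ => Fi i).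
apply: eq_integrable; first exact: measurable_I.
by move=> y _ /=; rewrite sumEFin big_enum.
Qed.

Lemma Chom_integrable m d (f : @integrand R m d) (g : 'I_m -> 'I_d -> R -> R) :
  Chom f -> (forall i j, mu.-integrable I (EFin \o g i j)) ->
  mu.-integrable I (EFin \o (fun y => f y (\matrix_(i, j) g i j y) 1)).
Proof.
move=> hf gi; have [C C0 hC] := Chom_bound hf.
pose B (y : R) := 1 + \sum_i \sum_j `|g i j y|.
have Bi : mu.-integrable I (EFin \o (fun y => C * B y)).
  have s : mu.-integrable I (EFin \o (fun y => \sum_i \sum_j `|g i j y|)).
    by apply: integrable_sumR => i; apply: integrable_sumR => j; exact: integrable_norm.
  have b : mu.-integrable I (EFin \o B).
    by have := integrableD measurable_I (integrable_cst_I 1) s; apply: eq_integrable.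
  by have := integrableZl measurable_I C b; apply: eq_integrable.
apply: le_integrableR Bi => //.
  apply: (Chom_measurable hf) => //; first exact: I_sub_Ibar.
  move=> i j; under eq_fun do rewrite mxE.
  exact: integrable_measurable_EFin (gi i j).
move=> y Iy; apply: hC; first exact: I_sub_Ibar.
- by rewrite addr_ge0 // sumr_ge0 // => i _; rewrite sumr_ge0.
- move=> i j; rewrite mxE; apply: (@le_trans _ _ (\sum_i \sum_j `|g i j y|)).
    rewrite (bigD1 i) //= (bigD1 j) //= -addrA lerDl addr_ge0 ?sumr_ge0 // => k _.
    by rewrite sumr_ge0.
  by rewrite lerDr.
- by rewrite normr1 /B lerDl sumr_ge0 // => k _; rewrite sumr_ge0.
Qed.

(** The density at 0 times the mass of the atom is the Lebesgue measure of a point. *)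
Lemma leb_density_atom (lam : {finite_measure set RR -> \bar R}) :
  lebI `<< lam -> lam [set 0] != 0%E -> leb_density lam 0 = 0.
Proof.
move=> dom l0; have m0 : measurable ([set 0] : set RR) by exact: measurable_set1.
have : lebI ([set 0] : set RR) = 0%E.
  apply/eqP; rewrite eq_le measure_ge0 andbT lebIE.
  rewrite -(lebesgue_measure_set1 (0 : R)); apply: le_measure; rewrite ?inE //.
  by apply: measurableI => //; exact: measurable_I.
rewrite (leb_density_integral dom m0).
have -> : (\int[lam]_(x in [set 0%R]) (leb_density lam x)%:E =
    (leb_density lam 0)%:E * lam [set 0%R])%E.
  by rewrite -integral_cst //; apply: eq_integral => y; rewrite inE => ->.
by move/eqP; rewrite mule_eq0 (negbTE l0) orbF eqe => /eqP.
Qed.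

(* An atom of lam at 0 is not charged by Lebesgue measure, so by homogeneity
   the pairing splits into the absolutely continuous part and the atom. *)
Lemma delta_pairing_density m d (lam : {finite_measure set RR -> \bar R})
    (q : 'I_m -> 'I_d -> charge) (g : 'I_m -> 'I_d -> R -> R) (c : 'M[R]_(m, d))
    (f : @integrand R m d) :
  Chom f -> dominating q lam ->
  (forall i j, mu.-integrable I (EFin \o g i j)) ->
  (forall i j A, measurable A ->
    q i j A = (L1_charge (g i j) A + (c i j)%:E * \d_(0%R : RR) A)%E) ->
  delta_pairing lam q f =
    \int[mu]_(y in I) f y (\matrix_(i, j) g i j y) 1 + f 0 c 0.
Proof.
move=> hf [qlam Llam] gi qE.
have dom := lebI_dominated Llam.
have m0 : measurable ([set 0] : set RR) by exact: measurable_set1.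
pose h := leb_density lam; pose D := dirac_density lam.
pose G i j : RR -> R := g i j \_ I.
have mG i j : measurable_fun setT (G i j).
  by apply/(measurable_restrictT _ measurable_I); exact: integrable_measurable_EFin (gi i j).
have GI i j : mu.-integrable I (EFin \o G i j).
  apply: eq_integrable (gi i j); first exact: measurable_I.
  by move=> y Iy; rewrite /= /G patchE Iy.
have Gi i j := integrable_lebI (mG i j) (GI i j).
have Ghi i j := integrable_densityM dom (mG i j) (Gi i j).
have hi := leb_density_integrable dom.
have Di := dirac_density_integrable lam.
(* If [lam] has no atom at 0, domination rules out a Dirac part. *)
have c0 : lam [set 0] = 0%E -> c = 0.
  move=> l0; apply/matrixP => i j; rewrite mxE.
  have /null_content_dominatesP/(_ _ m0 l0) := qlam i j.
  rewrite qE // L1_chargeE // integral_set1 add0e diracE mem_set // mule1.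
  by move=> [].
have mh := integrable_measurable_EFin hi.
have mD := integrable_measurable_EFin Di.
have RNq i j : {ae lam, forall y, fine (Radon_Nikodym (q i j) lam y) = G i j y * h y + c i j * D y}.
  have Dci : lam.-integrable setT (EFin \o (fun y => c i j * D y)).
    by have := integrableZl measurableT (c i j) Di; apply: eq_integrable.
  apply: Radon_Nikodym_unique => //.
    by have := integrableD measurableT (Ghi i j) Dci; apply: eq_integrable.
  move=> A mA; rewrite qE // L1_chargeE //.
  under [RHS]eq_integral do rewrite EFinD.
  rewrite integralD //; last 2 first.
  - exact: (integrableS measurableT mA (@subsetT _ _) (Ghi i j)).
  - exact: (integrableS measurableT mA (@subsetT _ _) Dci).
  congr (_ + _)%E.
    rewrite (integral_densityM dom mA (mG i j) (Gi i j)) lebI_integral //.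
    rewrite [RHS]integral_mkcondr; apply: eq_integral => y _.
    by rewrite /G !patchE; case: ifPn => yI; rewrite ?(negbTE yI) ?yI.
  under eq_integral do rewrite EFinM.
  rewrite integralZl //; last exact: (integrableS measurableT mA (@subsetT _ _) Di).
  rewrite dirac_density_integral //; case: ifPn => // /eqP l0.
  by rewrite (c0 l0) mxE !mul0e.
have RN1 : {ae lam, forall y, fine (Radon_Nikodym (L1_charge (cst 1)) lam y) = h y}.
  apply: (Radon_Nikodym_unique Llam hi) => A mA.
  by rewrite L1_charge1E // (leb_density_integral dom mA).
have mRN (r : charge) : r `<< lam -> measurable_fun (Ibar : set RR)
    (fun y => fine (Radon_Nikodym r lam y)).
  move=> rl; apply: measurableT_comp; first exact: fine_measurable.
  by apply: measurable_funTS; case/integrableP: (Radon_Nikodym_integrable rl).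
rewrite /delta_pairing.
pose F (y : RR) := f y (\matrix_(i, j) G i j y) 1.
have mF : measurable_fun (Ibar : set RR) F.
  apply: (Chom_measurable hf) => // i j; under eq_fun do rewrite mxE.
  exact: measurable_funTS.
pose F' : RR -> R := F \_ Ibar.
have mF' : measurable_fun setT F' by apply/(measurable_restrictT _ measurable_Ibar).
have FI : mu.-integrable I (EFin \o F').
  apply: eq_integrable (Chom_integrable hf gi); first exact: measurable_I.
  move=> y Iy; rewrite /= /F' patchE mem_set; last by apply: I_sub_Ibar; exact: set_mem.
  by congr EFin; congr (f _ _ _); apply/matrixP => i j; rewrite !mxE /G patchE Iy.
have Fi := integrable_lebI mF' FI.
have Fhi := integrable_densityM dom mF' Fi.
have I0 : Ibar (0 : R) by rewrite in_Ibar; apply/andP; split; lra.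
have Dint : \int[lam]_(y in Ibar) (f 0 c 0 * D y) = f 0 c 0.
  have DI := integrableS measurableT measurable_Ibar (@subsetT _ _) Di.
  rewrite RintegralZl // /Rintegral dirac_density_integral; last exact: measurable_Ibar.
  case: ifPn => [/eqP l0|_]; last by rewrite diracE mem_set //= mulr1.
  by rewrite (c0 l0) Chom00 // mul0r.
transitivity (\int[lam]_(y in Ibar) (F' y * h y + f 0 c 0 * D y)); last first.
  rewrite RintegralD //; last 2 first.
  - exact: (integrableS measurableT measurable_Ibar (@subsetT _ _) Fhi).
  - have DI := integrableS measurableT measurable_Ibar (@subsetT _ _) Di.
    by have := integrableZl measurable_Ibar (f 0 c 0) DI; apply: eq_integrable.
  rewrite Dint; congr (_ + _).
  rewrite /Rintegral (integral_densityM dom measurable_Ibar mF' Fi) lebI_integral //.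
  rewrite (_ : Ibar `&` I = I); last by apply/setIidPr; exact: I_sub_Ibar.
  congr fine; apply: eq_integral => y Iy; congr EFin.
  rewrite /F' patchE mem_set; last by apply: I_sub_Ibar; exact: set_mem.
  by congr (f _ _ _); apply/matrixP => i j; rewrite !mxE /G patchE Iy.
transitivity (\int[lam]_(y in Ibar) f y (\matrix_(i, j) (G i j y * h y + c i j * D y)) (h y)).
  apply: ae_eq_Rintegral.
  - exact: measurable_Ibar.
  - apply: (Chom_measurable hf) => //; last exact: mRN.
    by move=> i j; under eq_fun do rewrite mxE; exact: mRN.
  - apply: (Chom_measurable hf) => //; last exact: measurable_funTS.
    move=> i j; under eq_fun do rewrite mxE.
    apply: measurable_funTS; apply: measurable_funD; first exact: measurable_funM.
    exact: measurable_funM.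
  - have : {ae lam, forall y i j, fine (Radon_Nikodym (q i j) lam y) = G i j y * h y + c i j * D y}.
      by apply: filter_forall => i; apply: filter_forall => j; exact: RNq.
    apply: filterS2 RN1 => y e1 eq _; rewrite e1; congr (f _ _ _).
    by apply/matrixP => i j; rewrite !mxE eq.
(* At each point at most one of the two parts is present: away from 0 the Dirac density vanishes; at
   0 either there is an atom and the Lebesgue density vanishes, or [c] is zero. Homogeneity then
   applies to the surviving part. *)
apply: eq_Rintegral => y Iy.
have h0 : 0 <= h y by exact: leb_density_ge0.
have Iy' : Ibar y by exact: set_mem.
rewrite /F' patchE Iy /F.
have base : f y (\matrix_(i, j) (G i j y * h y)) (h y) = f y (\matrix_(i, j) G i j y) 1 * h y.
  rewrite mulrC -(Chom_scale hf) // mulr1; congr (f _ _ _).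
  by apply/matrixP => i j; rewrite !mxE mulrC.
have [yz|y0] := eqVneq y 0; last first.
  have -> : D y = 0.
    by rewrite /D /dirac_density indicE memNset ?mul0r //= => e; rewrite e eqxx in y0.
  rewrite mulr0 addr0 -base; congr (f _ _ _).
  by apply/matrixP => i j; rewrite !mxE mulr0 addr0.
have [l0|l0] := eqVneq (lam [set 0]) 0%E.
  rewrite (c0 l0) (Chom00 hf I0) mul0r addr0 -base; congr (f _ _ _).
  by apply/matrixP => i j; rewrite !mxE mul0r addr0.
have hy : h y = 0 by rewrite yz; exact: leb_density_atom.
have Dy : 0 <= D y by rewrite /D /dirac_density divr_ge0 // fine_ge0.
rewrite hy mulr0 add0r mulrC -(Chom_scale hf) // mulr0 yz; congr (f _ _ _).
by apply/matrixP => i j; rewrite !mxE mulr0 add0r mulrC.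
Qed.

End DeltaPairing.

(** * Limit of the pairings at a single time *)

Section Estimates.
Context {R : realType}.
Notation mu := (@lebesgue_measure R).
Notation I := (@Defs.I R).
Notation RR := (measurableTypeR R).

Definition box (r y : R) : R := \1_(`]- r, r]%classic : set RR) y.

Lemma box_norm_le1 r y : `|box r y| <= 1.
Proof. by rewrite /box indicE; case: (_ \in _); rewrite ?normr1 ?normr0. Qed.

Lemma box_ge0 r y : 0 <= box r y.
Proof. by rewrite /box indicE; case: (_ \in _). Qed.

Lemma box1 r y : `|y| < r -> box r y = 1.
Proof.
rewrite ltr_norml => /andP[h1 h2].
by rewrite /box indicE mem_set //= in_itv /= h1 ltW.
Qed.

Lemma box_integrable r (c : R) : mu.-integrable I (EFin \o (fun y => c * box r y)).
Proof.
apply: (bounded_integrableM measurable_I (integrable_cst_I c)) => //.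
  by apply: measurable_indic; exact: measurable_itv.
by move=> y _; exact: box_norm_le1.
Qed.

Lemma Rintegral_box r (c : R) : 0 < r < 2^-1 ->
  \int[mu]_(y in I) (c * box r y) = c * (2 * r).
Proof.
move=> /andP[r0 r2].
have sub : `]- r, r]%classic `<=` I.
  by move=> y; rewrite in_I /= in_itv /= => /andP[? ?]; apply/andP; split; lra.
have mr : measurable (`]- r, r]%classic : set RR) by exact: measurable_itv.
rewrite (Rintegral_zero_off mu measurable_I mr sub); last first.
  by move=> y _ ry; rewrite /box indicE memNset // mulr0.
transitivity (\int[mu]_(y in `]- r, r]) c).
  by apply: eq_Rintegral => y yr; rewrite /box indicE yr mulr1.
by rewrite Rintegral_cst_itv; [congr (_ * _); ring|lra].
Qed.

Variable z0 : R -> R.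
Hypothesis z0c : {within Ibar, continuous z0}.
Hypothesis z0_01 : forall y, I y -> 0 <= z0 y <= 1.

Definition vec2 (a b : R) : 'M[R]_(1, 2) := \matrix_(i, j) (if j == 0 then a else b).

Definition excess (t : R) : R := Num.max (t - 1) 0.

Lemma excess_ge0 t : 0 <= excess t.
Proof. by rewrite le_max lexx orbT. Qed.

Lemma excess_min t : t - Num.min t 1 = excess t.
Proof. by rewrite /excess maxElt minElt; do 2 case: ifPn; rewrite -?leNgt => *; lra. Qed.

(** The pairing with the delta of ((t - 1)^+ delta_0, z0 + (t - 1)^+ delta_0), the mass of the atom
    being pulled out by homogeneity. *)
Definition limit_pairing (t : R) (f : @integrand R 1 2) : R :=
  \int[mu]_(y in I) f y (vec2 0 (z0 y)) 1 + excess t * f 0 (vec2 1 1) 0.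

Lemma z0_integrable : mu.-integrable I (EFin \o z0).
Proof.
apply: (@bounded_integrable_I _ _ 1); first exact: measurable_z0.
by move=> y Iy; have /andP[? ?] := z0_01 Iy; rewrite ger0_norm.
Qed.

Lemma vec2_integrable (f : @integrand R 1 2) (a b : R -> R) : Chom f ->
  mu.-integrable I (EFin \o a) -> mu.-integrable I (EFin \o b) ->
  mu.-integrable I (EFin \o (fun y => f y (vec2 (a y) (b y)) 1)).
Proof.
move=> hf ai bi.
have gi (i : 'I_1) (j : 'I_2) : mu.-integrable I (EFin \o (if j == 0 then a else b)).
  by case: ifPn.
apply: eq_integrable (Chom_integrable hf gi); first exact: measurable_I.
move=> y _; congr EFin; congr (f _ _ _).
by apply/matrixP => i j; rewrite !mxE; case: ifPn.
Qed.

(** Since t - min(t, 1) is (t - 1)^+, the two-sided bound on the stress is one on the plastic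
    mass. *)
Lemma mass_bounds r u e p z t : concentrated r z0 u e p z -> 0 <= t ->
  [/\ 0 <= \int[mu]_(y in I) p t y, \int[mu]_(y in I) p t y <= excess t &
      excess t - r <= \int[mu]_(y in I) p t y].
Proof.
move=> hc t0; have /andP[h1 h2] := concentrated_stress hc t0.
have em := excess_min t; split; [|lra..].
rewrite -(Rintegral_cst_I 0); apply: ae_le_Rintegral; first exact: measurable_I.
- exact: integrable_cst_I.
- exact: (concentrated_p_integrable hc).
- by apply: ae_imply (concentrated_p hc t0) => y h Iy; case: (h Iy).
Qed.

Let sum_bound (S a b e0 C2 k r : R) : 0 <= r -> 0 <= e0 -> S <= a + C2 * (2 * r) ->
  a <= e0 / 4 -> b <= r * k -> r * (4 * (C2 + 1) + 4 * (k + 1)) <= e0 ->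
  0 <= r * C2 -> 0 <= r * k -> S + b <= e0.
Proof. nra. Qed.

(* Where p is large, f y (p, z0 + p) 1 = p f y (1, z0 / p + 1) p^-1 is close to
   p f 0 (1, 1) 0; where p is bounded, the integrand is bounded, on a set of
   length at most 2 r. *)
Lemma pairing_estimate (f : @integrand R 1 2) t e0 : Chom f -> 0 <= t -> 0 < e0 ->
  exists2 r0, 0 < r0 & forall r u e p z, 0 < r <= r0 -> concentrated r z0 u e p z ->
    `| \int[mu]_(y in I) f y (vec2 (p t y) (z t y)) 1 - limit_pairing t f | <= e0.
Proof.
move=> hf t0 e00; have [C C0 hC] := Chom_bound hf.
have I0 : Ibar (0 : R) by rewrite in_Ibar; apply/andP; split; lra.
pose K := f 0 (vec2 1 1) 0; pose m := excess t; have m0 : 0 <= m := excess_ge0 t.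
(* The mass of [p] is at most [m], so an error of [eta] per unit of mass costs at most [e0 / 4]. *)
pose eta := e0 / (4 * (m + 1)); have eta0 : 0 < eta by rewrite divr_gt0 // mulr_gt0 //; lra.
have hm : m * eta <= e0 / 4.
  have -> : m * eta = (e0 / 4) * (m / (m + 1)) by rewrite /eta; field; rewrite gt_eqF //; lra.
  apply: ler_piMr; first by apply: divr_ge0 => //; exact: ltW.
  by rewrite ler_pdivrMr; lra.
have [d d0 hd] := Chom_eps_delta hf (vec2 1 1) 0 I0 eta0.
(* For p >= A both 1 / p and z0 / p, the latter being at most 1 / p, are smaller than [d]. *)
pose A := 2 / d; have A0 : 0 < A by rewrite divr_gt0.
(* The three summands bound the three terms of the error [D] below where p < A. *)
pose C2 := C * (A + 1) + A * `|K| + C.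
have C20 : 0 <= C2.
  by rewrite !addr_ge0 // mulr_ge0 // ?addr_ge0 // ltW.
have CC2 : C <= C2 by rewrite lerDr addr_ge0 // mulr_ge0 // ?addr_ge0 // ltW.
have den : 0 < 4 * (C2 + 1) + 4 * (`|K| + 1) by have := normr_ge0 K; lra.
exists (Num.min d (Num.min 4^-1 (e0 / (4 * (C2 + 1) + 4 * (`|K| + 1))))).
  by rewrite !lt_min d0 /= invr_gt0 ltr0n divr_gt0.
move=> r u e p z /andP[r0]; rewrite !le_min => /and3P[rd r4 re] hc.
have rh : 0 < r < 2^-1 by rewrite r0; lra.
have [P0 Pm mP] := mass_bounds hc t0.
have h0 : `|\int[mu]_(y in I) p t y - m| <= r.
  by rewrite ler_norml; apply/andP; split; rewrite /m; lra.
have pi_ := concentrated_p_integrable hc t0.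
have zi := concentrated_z_integrable hc t0.
have fi := vec2_integrable hf pi_ zi.
have f0i := vec2_integrable hf (integrable_cst_I 0) z0_integrable.
have pK : mu.-integrable I (EFin \o (fun y => p t y * K)).
  by have := integrableZr measurable_I K pi_; apply: eq_integrable.
have [D defD] : exists D, D = fun y =>
    f y (vec2 (p t y) (z t y)) 1 - f y (vec2 0 (z0 y)) 1 - p t y * K by eexists.
have d1i : mu.-integrable I (EFin \o (fun y => f y (vec2 (p t y) (z t y)) 1 - f y (vec2 0 (z0 y)) 1)).
  by have := integrableB measurable_I fi f0i; apply: eq_integrable.
have Di : mu.-integrable I (EFin \o D).
  by rewrite defD; have := integrableB measurable_I d1i pK; apply: eq_integrable.
have DE : \int[mu]_(y in I) D y = \int[mu]_(y in I) f y (vec2 (p t y) (z t y)) 1 -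
    \int[mu]_(y in I) f y (vec2 0 (z0 y)) 1 - (\int[mu]_(y in I) p t y) * K.
  by rewrite defD !RintegralB // RintegralZr.
have Dle : {ae mu, forall y : RR, I y -> `|D y| <= p t y * eta + C2 * box r y}.
  apply: ae_imply (concentrated_p hc t0) => y hy Iy; have [p0 pr zE] := hy Iy.
  have Iy' := I_sub_Ibar Iy; have /andP[z00 z01] := z0_01 Iy.
  have cb : 0 <= C2 * box r y by rewrite mulr_ge0 // box_ge0.
  rewrite defD zE.
  have [yr|yr] := leP r `|y|.
    rewrite pr // addr0 subrr mul0r subrr normr0 mul0r add0r.
    exact: cb.
  rewrite (box1 yr) mulr1.
  have b0 : `|f y (vec2 0 (z0 y)) 1| <= C.
    rewrite -[leRHS]mulr1; apply: hC => //; last by rewrite normr1.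
    by move=> i j; rewrite mxE; case: ifPn; rewrite ?normr0 // ger0_norm.
  have [pA|pA] := leP A (p t y).
    have pp : 0 < p t y by exact: lt_le_trans pA.
    have pd : (p t y)^-1 < d.
      apply: (@le_lt_trans _ _ A^-1); first by rewrite lef_pV2 // posrE.
      by rewrite /A invf_div ltr_pdivrMr // ltr_pMr // ltr1n.
    have -> : f y (vec2 (p t y) (z0 y + p t y)) 1 =
       p t y * f y (vec2 1 (z0 y / p t y + 1)) (p t y)^-1.
      rewrite -(Chom_scale hf) //; congr (f _ _ _); last by rewrite divff // gt_eqF.
      apply/matrixP => i j; rewrite !mxE; case: ifPn => _; first by rewrite mulr1.
      by field; rewrite gt_eqF.
    have near : `|f y (vec2 1 (z0 y / p t y + 1)) (p t y)^-1 - K| < eta.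
      apply: hd => //.
      - by rewrite subr0; exact: lt_le_trans rd.
      - move=> i j; rewrite !mxE; case: ifPn => _; first by rewrite subrr normr0.
        rewrite addrK ger0_norm ?divr_ge0 //; apply: le_lt_trans pd.
        by rewrite ler_piMl // invr_ge0.
      - by rewrite subr0 ger0_norm // invr_ge0.
    rewrite addrAC -mulrBr; apply: le_trans (ler_normB _ _) _.
    apply: lerD; last exact: le_trans b0 CC2.
    by rewrite normrM (ger0_norm p0) ler_wpM2l // ltW.
  have b1 : `|f y (vec2 (p t y) (z0 y + p t y)) 1| <= C * (A + 1).
    have A1 : 0 <= A + 1 by rewrite addr_ge0 // ltW.
    have A2 : `|1 : R| <= A + 1 by rewrite normr1 lerDr ltW.
    apply: (hC _ _ _ _ Iy' A1 _ A2) => i j.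
    rewrite mxE; case: ifPn => _; rewrite ger0_norm ?addr_ge0 //.
      by rewrite ler_wpDr // ltW.
    by rewrite addrC lerD // ltW.
  have b2 : `|p t y * K| <= A * `|K|.
    by rewrite normrM (ger0_norm p0) ler_wpM2r // ltW.
  apply: (@le_trans _ _ C2); last by rewrite lerDr mulr_ge0 // ltW.
  apply: le_trans (ler_normB _ _) _; apply: le_trans (lerD (ler_normB _ _) (lexx _)) _.
  by rewrite addrAC /C2 !lerD.
have bi : mu.-integrable I (EFin \o (fun y => p t y * eta + C2 * box r y)).
  have pe : mu.-integrable I (EFin \o (fun y => p t y * eta)).
    by have := integrableZr measurable_I eta pi_; apply: eq_integrable.
  by have := integrableD measurable_I pe (box_integrable r C2); apply: eq_integrable.
have Dint : `|\int[mu]_(y in I) D y| <= (\int[mu]_(y in I) p t y) * eta + C2 * (2 * r).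
  apply: le_trans (le_normr_Rintegral measurable_I Di) _.
  apply: le_trans (ae_le_Rintegral measurable_I _ bi Dle) _; first exact: integrable_norm.
  rewrite RintegralD //; last 2 first.
  - by have := integrableZr measurable_I eta pi_; apply: eq_integrable.
  - exact: box_integrable.
  by rewrite RintegralZr // Rintegral_box.
have -> : \int[mu]_(y in I) f y (vec2 (p t y) (z t y)) 1 - limit_pairing t f =
  \int[mu]_(y in I) D y + (\int[mu]_(y in I) p t y - m) * K.
  by rewrite DE /limit_pairing -/m -/K; ring.
apply: le_trans (ler_normD _ _) _.
have h1 : (\int[mu]_(y in I) p t y) * eta <= e0 / 4.
  apply: (@le_trans _ _ (m * eta)); first by rewrite ler_wpM2r // ltW.
  exact: hm.
have h2 : `|(\int[mu]_(y in I) p t y - m) * K| <= r * `|K|.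
  by rewrite normrM ler_wpM2r.
have h3 : r * (4 * (C2 + 1) + 4 * (`|K| + 1)) <= e0 by rewrite -ler_pdivlMr.
have h4 : 0 <= r * C2 by rewrite mulr_ge0 // ltW.
have h5 : 0 <= r * `|K| by rewrite mulr_ge0 // ltW.
exact: (sum_bound (ltW r0) (ltW e00) Dint h1 h2 h3 h4 h5).
Qed.

End Estimates.

(** * Convergence of the displacement in L1 *)

Section Displacement.
Context {R : realType}.
Notation mu := (@lebesgue_measure R).
Notation I := (@Defs.I R).
Notation RR := (measurableTypeR R).
Implicit Types (g : R -> R) (a b y t r : R).

Lemma primitive_I_ae_eq g1 g2 y : mu.-integrable I (EFin \o g1) ->
  mu.-integrable I (EFin \o g2) -> ae_eqI g1 g2 ->
  primitive_I g1 y = primitive_I g2 y.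
Proof.
move=> i1 i2 g12; apply: ae_eq_Rintegral => //.
- by apply: integrable_measurable_EFin; apply: integrable_restrict_I i1; exact: measurable_itv.
- by apply: integrable_measurable_EFin; apply: integrable_restrict_I i2; exact: measurable_itv.
- apply: ae_imply g12 => x h _; rewrite !patchE; case: ifPn => //.
  by rewrite inE; exact: h.
Qed.

Lemma primitive_I_cst (c : R) y : I y -> primitive_I (cst c) y = c * (y + 2^-1).
Proof.
rewrite in_I => /andP[y1 y2]; have := primitive_I_increment (integrable_cst_I c) (lexx (- 2^-1)) (ltW y1).
rewrite primitive_I_left subr0 => ->.
transitivity (\int[mu]_(x in `]- 2^-1, y]) c); last by rewrite Rintegral_cst_itv ?opprK // ltW.
apply: eq_Rintegral => x; rewrite inE /= in_itv /= => /andP[x1 x2].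
by rewrite patchE mem_set // in_I x1 (le_lt_trans x2).
Qed.

Lemma primitive_ID g1 g2 y : mu.-integrable I (EFin \o g1) ->
  mu.-integrable I (EFin \o g2) ->
  primitive_I (fun x => g1 x + g2 x) y = primitive_I g1 y + primitive_I g2 y.
Proof.
move=> i1 i2; rewrite /primitive_I -RintegralD //.
- by apply: eq_Rintegral => x _; rewrite !patchE; case: ifPn => // _; rewrite addr0.
- by apply: integrable_restrict_I i1; exact: measurable_itv.
- by apply: integrable_restrict_I i2; exact: measurable_itv.
Qed.

Definition limit_displacement t y : R :=
  if t <= 1 then t * y
  else if 0 < y then y + (t - 1) / 2 else y - (t - 1) / 2.

Lemma limit_displacement_integrable t : mu.-integrable I (EFin \o limit_displacement t).
Proof.
apply: (@bounded_integrable_I _ _ (2 * `|t| + 2)).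
  rewrite /limit_displacement; case: (leP t 1) => t1.
    by apply: measurable_funM => //; exact: measurable_id.
  apply: measurable_fun_if => //.
  - by apply: measurable_fun_ltr => //; exact: measurable_id.
  - by apply: measurable_funTS; apply: measurable_funD => //; exact: measurable_id.
  - by apply: measurable_funTS; apply: measurable_funB => //; exact: measurable_id.
move=> y; rewrite in_I => /andP[y1 y2]; rewrite /limit_displacement.
have tn := ler_norm t; have tn' : - t <= `|t| by rewrite -normrN ler_norm.
have yn : `|y| <= 1 by rewrite ler_norml; apply/andP; split; lra.
case: (leP t 1) => t1.
  rewrite normrM; have := normr_ge0 t; have := normr_ge0 y; nra.
by case: ifPn => _; rewrite ler_norml; apply/andP; split; lra.
Qed.

(* arithmetic of the displacement error near 0, to its right and to its left,
   P being the plastic mass and q its part to the left of y *)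
Let displacement_near t r P q y : 0 <= t -> - 2^-1 < y -> y < 2^-1 -> 0 < r -> r < 2^-1 ->
  0 <= P -> P <= excess t -> excess t - r <= P ->
  Num.min t 1 <= t - P <= Num.min t 1 + r -> t - Num.min t 1 = excess t ->
  0 <= q -> q <= P -> `|y| < r ->
  `|- t / 2 + (t - P) * (y + 2^-1) + q - limit_displacement t y| <= r + (4 * t + 4).
Proof.
move=> t0 y1 y2 r0 r2 P0 Pm mP /andP[s1 s2] em q0 qP _.
have mt : Num.min t 1 <= t by rewrite ge_min lexx.
have m1 : Num.min t 1 <= 1 by rewrite ge_min lexx orbT.
have m0 : 0 <= Num.min t 1 by rewrite le_min t0 ler01.
have b1 : 0 <= (t - P) * (y + 2^-1) by apply: mulr_ge0; lra.
have b2 : (t - P) * (y + 2^-1) <= 2 by nra.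
have lb : - (t + 1) <= limit_displacement t y <= t + 1.
  rewrite /limit_displacement; case: (leP t 1) => t1; first by apply/andP; split; nra.
  by case: ifPn => _; apply/andP; split; lra.
case/andP: lb => lb1 lb2.
by rewrite ler_norml; apply/andP; split; lra.
Qed.

Let displacement_right t r P y : 0 <= t -> - 2^-1 < y -> y < 2^-1 -> 0 < r -> r <= y ->
  0 <= P -> P <= excess t -> excess t - r <= P ->
  Num.min t 1 <= t - P <= Num.min t 1 + r -> t - Num.min t 1 = excess t ->
  `|- t / 2 + (t - P) * (y + 2^-1) + P - limit_displacement t y| <= r.
Proof.
move=> t0 y1 y2 r0 ry P0 Pm mP /andP[s1 s2] em.
rewrite /limit_displacement; case: (leP t 1) => t1.
  have e0 : P = 0 by move: em; rewrite min_l //; lra.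
  rewrite e0 (_ : - t / 2 + (t - 0) * (y + 2^-1) + 0 - t * y = 0); last by field.
  by rewrite normr0 ltW.
have -> : 0 < y by exact: lt_le_trans ry.
have e1 : excess t = t - 1 by move: em; rewrite (min_r (ltW t1)); lra.
by rewrite ler_norml; apply/andP; split; nra.
Qed.

Let displacement_left t r P y : 0 <= t -> - 2^-1 < y -> y < 2^-1 -> 0 < r -> r <= - y ->
  0 <= P -> P <= excess t -> excess t - r <= P ->
  Num.min t 1 <= t - P <= Num.min t 1 + r -> t - Num.min t 1 = excess t ->
  `|- t / 2 + (t - P) * (y + 2^-1) + 0 - limit_displacement t y| <= r.
Proof.
move=> t0 y1 y2 r0 ry P0 Pm mP /andP[s1 s2] em.
rewrite /limit_displacement; case: (leP t 1) => t1.
  have e0 : P = 0 by move: em; rewrite min_l //; lra.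
  rewrite e0 (_ : - t / 2 + (t - 0) * (y + 2^-1) + 0 - t * y = 0); last by field.
  by rewrite normr0 ltW.
have -> : (0 < y) = false by apply/negbTE; rewrite -leNgt; lra.
have e1 : excess t = t - 1 by move: em; rewrite (min_r (ltW t1)); lra.
by rewrite ler_norml; apply/andP; split; nra.
Qed.

Section Concentrated.
Variables (r : R) (z0 : R -> R) (u e p z : R -> R -> R) (t : R).
Hypothesis hc : concentrated r z0 u e p z.
Hypothesis t0 : 0 <= t.

Let Q y := primitive_I (p t) y.

Lemma primitive_p_le a b : - 2^-1 <= a -> a <= b -> Q a <= Q b.
Proof.
move=> a1 ab; rewrite -subr_ge0 primitive_I_increment //; last first.
  exact: (concentrated_p_integrable hc).
rewrite -(mul0r (b - a)) -Rintegral_cst_itv //; apply: ae_le_Rintegral => //.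
- exact: integrable_cst_itv.
- by apply: integrable_restrict_I (concentrated_p_integrable hc t0); exact: measurable_itv.
- apply: ae_imply (concentrated_p hc t0) => x h _; rewrite patchE; case: ifPn => //.
  by rewrite inE => Ix; case: (h Ix).
Qed.

Lemma primitive_p_eq a b : - 2^-1 <= a -> a <= b ->
  (forall x, a < x <= b -> r <= `|x|) -> Q b = Q a.
Proof.
move=> a1 ab far; apply/eqP; rewrite -subr_eq0; apply/eqP.
rewrite primitive_I_increment //; last exact: (concentrated_p_integrable hc).
rewrite -(mul0r (b - a)) -Rintegral_cst_itv //; apply: ae_eq_Rintegral => //.
- apply: integrable_measurable_EFin.
  by apply: integrable_restrict_I (concentrated_p_integrable hc t0); exact: measurable_itv.
- apply: ae_imply (concentrated_p hc t0) => x h; rewrite /= in_itv /= => xab.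
  rewrite patchE; case: ifPn => //; rewrite inE => Ix.
  by have [_ /(_ (far _ xab))] := h Ix.
Qed.

(** Almost everywhere the displacement is - t / 2 + s (y + 1/2) plus the primitive of [p], which is
    constant outside |y| < r. There the error comes only from the stress and the mass and is at most
    [r]; in the remaining zone, of length 2 r, it is bounded. *)
Lemma displacement_estimate : 0 < r < 2^-1 ->
  \int[mu]_(y in I) `|u t y - limit_displacement t y| <= r + (4 * t + 4) * (2 * r).
Proof.
move=> rh; case/andP: (rh) => r0 r2.
have pi_ := concentrated_p_integrable hc t0.
have ui := concentrated_u_integrable hc t0.
have [P0 Pm mP] := mass_bounds hc t0.
have hs := concentrated_stress hc t0.
have em := excess_min t.
pose s := t - \int[mu]_(y in I) p t y.
have uE : {ae mu, forall y : RR, I y -> u t y = - t / 2 + s * (y + 2^-1) + Q y}.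
  apply: ae_imply (concentrated_u hc t0) => y h Iy; rewrite h // -addrA; congr (_ + _).
  rewrite -(primitive_I_cst s Iy) /Q -primitive_ID //; last exact: integrable_cst_I.
  have ei := concentrated_e_integrable hc t0.
  symmetry; apply: primitive_I_ae_eq.
  - by have := integrableD measurable_I (integrable_cst_I s) pi_; apply: eq_integrable.
  - by have := integrableD measurable_I ei pi_; apply: eq_integrable.
  - by apply: ae_imply (concentrated_e hc t0) => x hx Ix; rewrite hx.
have Q0 : Q (- 2^-1) = 0 by exact: primitive_I_left.
have Q1 : Q 2^-1 = \int[mu]_(y in I) p t y by exact: primitive_I_right.
have bound : {ae mu, forall y : RR, I y ->
    `|u t y - limit_displacement t y| <= r + (4 * t + 4) * box r y}.
  apply: ae_imply uE => y h Iy; rewrite h // {h}.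
  move: (Iy); rewrite in_I => /andP[y1 y2].
  have Qge : 0 <= Q y by rewrite -Q0 primitive_p_le // ltW.
  have Qle : Q y <= \int[mu]_(y in I) p t y by rewrite -Q1 primitive_p_le // ltW.
  have [yr|yr] := ltP `|y| r.
    have b1 := box1 yr; rewrite b1 mulr1 {b1}.
    exact: displacement_near t0 y1 y2 r0 r2 P0 Pm mP hs em Qge Qle yr.
  have b0 := box_ge0 r y.
  apply: (@le_trans _ _ r); last by rewrite lerDl mulr_ge0 //; move: t0; lra.
  move: yr; rewrite ler_normr => /orP[yr|yr].
    have QE : Q y = \int[mu]_(y in I) p t y.
      rewrite -Q1; symmetry; apply: primitive_p_eq; [exact: ltW|exact: ltW|].
      by move=> x /andP[x1 _]; rewrite ler_normr; rewrite (le_trans yr (ltW x1)).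
    by rewrite QE; exact: displacement_right t0 y1 y2 r0 yr P0 Pm mP hs em.
  have QE : Q y = 0.
    rewrite -Q0; apply: primitive_p_eq; [exact: lexx|exact: ltW|].
    by move=> x /andP[_ x1]; rewrite ler_normr; apply/orP; right; apply: le_trans yr _; rewrite lerN2.
  by rewrite QE; exact: displacement_left t0 y1 y2 r0 yr P0 Pm mP hs em.
have li : mu.-integrable I (EFin \o limit_displacement t).
  exact: limit_displacement_integrable.
have di : mu.-integrable I (EFin \o (fun y => `|u t y - limit_displacement t y|)).
  apply: integrable_norm.
  by have := integrableB measurable_I ui li; apply: eq_integrable.
have bi : mu.-integrable I (EFin \o (fun y => r + (4 * t + 4) * box r y)).
  by have := integrableD measurable_I (integrable_cst_I r) (box_integrable r (4 * t + 4)); apply: eq_integrable.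
apply: le_trans (ae_le_Rintegral measurable_I di bi bound) _.
rewrite RintegralD //; [|exact: integrable_cst_I|exact: box_integrable].
by rewrite Rintegral_cst_I Rintegral_box.
Qed.

End Concentrated.
End Displacement.

(** * The integrands of the dissipation and of the energy *)

Section HomogeneousIntegrands.
Context {R : realType}.
Notation point3 m d := (R * 'M[R]_(m, d) * R)%type.

Lemma entry_continuous m d (i : 'I_m) (j : 'I_d) :
  continuous (fun x : point3 m d => x.1.2 i j).
Proof.
move=> x; apply: (@continuous_comp _ _ _ (fun x : point3 m d => x.1.2) (fun A => A i j)).
  by apply: continuous_comp; [exact: cvg_fst|exact: cvg_snd].
exact: coord_continuous.
Qed.

Lemma HRZ (s a b : R) : 0 <= s -> HR (s * a) (s * b) = s * HR a b.
Proof.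
by move=> s0; rewrite !HR_max !normrM (ger0_norm s0) -maxr_pMr // mulrCA.
Qed.

Lemma Chom_HR_increment m (i j : 'I_m) :
  Chom (fun _ (x : 'M[R]_(m, 2)) _ => HR (x i 0 - x j 0) (x i 1 - x j 1)).
Proof.
split=> [|y xi eta s _ s0]; last by rewrite !mxE -!mulrBr HRZ.
apply: continuous_subspaceT => x.
rewrite (_ : (fun _ => _) = fun x : point3 m 2 =>
  2 * Num.max `|x.1.2 i 0 - x.1.2 j 0| `|x.1.2 i 1 - x.1.2 j 1|); last first.
  by apply/funext => w; rewrite HR_max.
apply: cvgMr; apply: (@continuous_max _ _ (fun x : point3 m 2 => `|x.1.2 i 0 - x.1.2 j 0|)
  (fun x : point3 m 2 => `|x.1.2 i 1 - x.1.2 j 1|));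
  by apply: cvg_norm; apply: cvgB; exact: entry_continuous.
Qed.

Variables (V : R -> R) (M : R).
Hypothesis hV1 : forall x, derivable V x 1.
Hypothesis hVeven : forall x, V x = V (- x).
Hypothesis hV'1 : forall x, derive1 V x = -1 <-> 1 <= x.

(** For |x| >= 1 the sum is the constant V 1 + 1, and on [-1, 1] continuity bounds it. *)
Lemma V_plus_norm_bounded : exists2 B, 0 <= B & forall x, `|V x + `|x| | <= B.
Proof.
have cV : {within `[-1, 1], continuous (fun x => `|V x|)}.
  apply: continuous_subspaceT => x; apply: cvg_norm; exact: derivable_continuous.
have [c _ hmax] := @EVT_max R (fun x => `|V x|) (-1) 1 ltac:(lra) cV.
exists (`|V 1 + 1| + (`|V c| + 1)); first by rewrite !addr_ge0.
move=> x; have [x1|x1] := leP 1 `|x|.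
  rewrite (V_far hV1 hVeven hV'1 x1) (_ : _ + _ = V 1 + 1); last by ring.
  by rewrite lerDl addr_ge0.
apply: (@le_trans _ _ (`|V c| + 1)); last by rewrite lerDr.
apply: le_trans (ler_normD _ _) _; rewrite normr_id lerD //; last exact: ltW.
by apply: hmax; rewrite in_itv /=; move: x1; rewrite ltr_norml => /andP[? ?]; apply/andP; split; lra.
Qed.

(** [V] differs from -|x| by a bounded function, which disappears after division by t. *)
Lemma VinfE theta : Vinf V theta = - `|theta|.
Proof.
have [B B0 hB] := V_plus_norm_bounded.
apply: cvg_lim => //; apply/cvgrPdist_le => e e0.
near=> t.
have t0 : 0 < t by near: t; apply: nbhs_pinfty_gt; exact: num_real.
have tB : B / e <= t by near: t; apply: nbhs_pinfty_ge; exact: num_real.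
rewrite (_ : _ - _ = - ((V (t * theta) + `|t * theta|) / t)); last first.
  by rewrite normrM (gtr0_norm t0); field; rewrite gt_eqF.
rewrite normrN normrM normfV (gtr0_norm t0) ler_pdivrMr //.
by apply: le_trans (hB _) _; rewrite mulrC -ler_pdivrMr.
Unshelve. all: by end_near. Qed.

Lemma perspZ theta eta s : 0 <= s ->
  persp V (s * theta) (s * eta) = s * persp V theta eta.
Proof.
rewrite le_eqVlt => /orP[/eqP <-|s0].
  by rewrite !mul0r /persp ltxx VinfE normr0 oppr0.
rewrite /persp pmulr_rgt0 //; case: ifPn => e0.
  rewrite -mulrA; congr (_ * (_ * V _)); field.
  by rewrite !gt_eqF.
by rewrite !VinfE normrM (gtr0_norm s0) mulrN.
Qed.

(** Splitting off -|theta| leaves eta U(theta / eta) with U = V + |x| bounded; this tends to 0 with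
    eta, however theta / eta behaves, and so matches the value prescribed for eta <= 0. *)
Lemma persp_continuous (T : topologicalType) (th et : T -> R) :
  continuous th -> continuous et -> continuous (fun x => persp V (th x) (et x)).
Proof.
move=> cth cet x0; have [B B0 hB] := V_plus_norm_bounded.
have cV : continuous V by exact: derivable_continuous.
pose U x := V x + `|x|.
have cU : continuous U by move=> x; apply: cvgD; [exact: cV|exact: norm_continuous].
pose W x := if 0 < et x then et x * U (th x / et x) else 0.
have -> : (fun x => persp V (th x) (et x)) = (fun x => - `|th x| + W x).
  apply/funext => x; rewrite /persp /W; case: ifPn => e0; last by rewrite VinfE addr0.
  rewrite /U normrM normfV (gtr0_norm e0); field.
  by rewrite gt_eqF.
apply: cvgD; first by apply: cvgN; apply: cvg_norm; exact: cth.
have [e0|e0|e0] := ltgtP (et x0) 0.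
- have W0 : W x0 = 0 by rewrite /W ltNge ltW.
  rewrite W0; apply: cvg_near_cst.
  have : \forall x \near x0, et x < 0 by exact: (cet x0 [set w | w < 0] (lt_nbhsl e0)).
  by apply: filterS => x ex; rewrite /W ltNge ltW.
- have -> : W x0 = et x0 * U (th x0 / et x0) by rewrite /W e0.
  have : (fun x => et x * U (th x / et x)) x @[x --> x0] --> et x0 * U (th x0 / et x0).
    apply: cvgM; first exact: cet.
    apply: (@continuous_comp _ _ _ (fun x => th x / et x) U); last exact: cU.
    by apply: cvgM; [exact: cth|apply: cvgV; [rewrite gt_eqF|exact: cet]].
  apply: cvg_trans; apply: near_eq_cvg.
  have : \forall x \near x0, 0 < et x by exact: (cet x0 [set w | 0 < w] (lt_nbhsr e0)).
  by apply: filterS => x ex; rewrite /W ex.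
- have W0 : W x0 = 0 by rewrite /W e0 ltxx.
  rewrite W0; apply/cvgrPdist_le => e ep.
  have : et x @[x --> x0] --> (0 : R) by rewrite -e0; exact: cet.
  have d0 : 0 < e / (B + 1) by rewrite divr_gt0 //; lra.
  move/cvgrPdist_le => /(_ _ d0); apply: filterS => x.
  rewrite !sub0r !normrN => ex; rewrite /W; case: ifPn => px; last by rewrite normr0 ltW.
  rewrite normrM; apply: (@le_trans _ _ (e / (B + 1) * B)).
    by apply: ler_pM => //; exact: hB.
  rewrite -mulrA ler_piMr ?(ltW ep) //.
  by rewrite mulrC ler_pdivrMr; lra.
Qed.

Lemma Chom_persp : Chom (fun _ (x : 'M[R]_(1, 2)) eta => persp V (x 0 1) eta).
Proof.
split=> [|y xi eta s _ s0]; last by rewrite mxE perspZ.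
apply: continuous_subspaceT; apply: persp_continuous.
  exact: entry_continuous.
by move=> x; exact: cvg_snd.
Qed.

End HomogeneousIntegrands.

(** * Identification of limits *)

Section LimitTools.
Context {R : realType}.
Notation mu := (@lebesgue_measure R).
Notation I := (@Defs.I R).
Notation RR := (measurableTypeR R).
Implicit Types (f g h : R -> R) (c t s : R).

Lemma L2_intro f : measurable_fun (I : set RR) f ->
  mu.-integrable I (EFin \o (fun y => f y ^+ 2)) -> L2 f.
Proof.
move=> mf /integrableP[_ fi].
have mfI : measurable_fun setT (f \_ I) by apply/(measurable_restrictT _ measurable_I).
rewrite /L2 /Lfun; apply/andP; split; rewrite inE //=.
rewrite /finite_norm ltey; apply/eqP => N2.
have := normL2_sqr f; rewrite /normL2 N2 expe2 mulyy.
have -> : (\int[mu]_(y in I) (f y ^+ 2)%:E =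
    \int[mu]_(y in I) `|(EFin \o (fun y => f y ^+ 2)%R) y|)%E.
  by apply: eq_integral => y _; rewrite /= ger0_norm // sqr_ge0.
by move=> e; move: fi; rewrite -e.
Qed.

Lemma L2_cst c : L2 (cst c).
Proof.
apply: L2_intro; first exact: measurable_cst.
exact: (integrable_cst_I (c ^+ 2)).
Qed.

Lemma L2B f g : L2 f -> L2 g -> L2 (fun y => f y - g y).
Proof.
move=> hf hg; have mf := L2_measurable hf; have mg := L2_measurable hg.
apply: L2_intro; first exact: measurable_funB.
have i1 : mu.-integrable I (EFin \o (fun y => f y ^+ 2 + g y ^+ 2)).
  by have := integrableD measurable_I (L2_sqr_integrable hf) (L2_sqr_integrable hg); apply: eq_integrable.
have i2 : mu.-integrable I (EFin \o (fun y => 2 * (f y ^+ 2 + g y ^+ 2))).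
  by have := integrableZl measurable_I 2 i1; apply: eq_integrable.
apply: le_integrableR i2 => //.
  by apply: measurable_funX; exact: measurable_funB.
move=> y _; rewrite ger0_norm ?sqr_ge0 //.
have := sqr_ge0 (f y + g y); nra.
Qed.

Lemma Rintegral_norm_eq0 f g : mu.-integrable I (EFin \o f) ->
  mu.-integrable I (EFin \o g) -> \int[mu]_(y in I) `|f y - g y| <= 0 -> ae_eqI f g.
Proof.
move=> fi gi le0.
have di : mu.-integrable I (EFin \o (fun y => f y - g y)).
  by have := integrableB measurable_I fi gi; apply: eq_integrable.
have eq0 : (\int[mu]_(y in I) `|(EFin \o (fun y => f y - g y)%R) y| = 0)%E.
  rewrite [LHS](integrable_EFin_Rintegral measurable_I (integrable_norm di)).
  congr EFin; apply/eqP; rewrite eq_le le0 /=.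
  by apply: Rintegral_ge0.
case/integrableP: di => md _.
have := ae_eq_integral_abs mu measurable_I md.
move=> -[/(_ eq0) + _]; apply: ae_imply => y h Iy.
by have [/eqP] := h Iy; rewrite subr_eq0 => /eqP.
Qed.

(** Testing with [f - c] itself shows that its L2 norm vanishes. *)
Lemma L2_ip_eq_cst f c : L2 f -> (forall g, L2 g -> ip f g = c * \int[mu]_(y in I) g y) ->
  ae_eqI f (cst c).
Proof.
move=> hf hg; have hd := L2B hf (L2_cst c).
have di := L2_sqr_integrable hd.
have /= fgi := L2_mul_integrable hf hd.
have := hg _ hd; rewrite /ip => e.
have i0 : \int[mu]_(y in I) `|(f y - c) ^+ 2 - 0| = 0.
  transitivity (\int[mu]_(y in I) (f y * (f y - c) - c * (f y - c))).
    by apply: eq_Rintegral => y _; rewrite subr0 ger0_norm ?sqr_ge0 // -mulrBl expr2.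
  have ci : mu.-integrable I (EFin \o (fun y => c * (f y - c))).
    by have := integrableZl measurable_I c (L2_integrable hd); apply: eq_integrable.
  by rewrite RintegralB // e RintegralZl ?subrr //; exact: L2_integrable hd.
have := @Rintegral_norm_eq0 (fun y => (f y - c) ^+ 2) (cst 0) di (integrable_cst_I 0).
rewrite i0 => /(_ (lexx 0)); apply: ae_imply => y h Iy.
by have /eqP := h Iy; rewrite sqrf_eq0 subr_eq0 => /eqP.
Qed.

Lemma Rintegral_norm_triangle f g h : mu.-integrable I (EFin \o f) ->
  mu.-integrable I (EFin \o g) -> mu.-integrable I (EFin \o h) ->
  \int[mu]_(y in I) `|f y - h y| <=
  \int[mu]_(y in I) `|f y - g y| + \int[mu]_(y in I) `|g y - h y|.
Proof.
move=> fi gi hi.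
have B (a b : R -> R) : mu.-integrable I (EFin \o a) -> mu.-integrable I (EFin \o b) ->
    mu.-integrable I (EFin \o (fun y => `|a y - b y|)).
  move=> ai bi; apply: integrable_norm.
  by have := integrableB measurable_I ai bi; apply: eq_integrable.
rewrite -RintegralD //; [|exact: B..].
apply: le_Rintegral; [exact: measurable_I|exact: B| |].
  by have := integrableD measurable_I (B _ _ fi gi) (B _ _ gi hi); apply: eq_integrable.
by move=> y _; exact: ler_distD.
Qed.

(** Uniformity in [y] lets the limit at times of [Theta] be carried over to all times by left
    continuity. *)
Lemma limit_displacement_lipschitz s t y : I y ->
  `|limit_displacement s y - limit_displacement t y| <= `|s - t|.
Proof.
wlog st : s t / s <= t => [hw|].
  by have [/hw//|/ltW/hw] := leP s t; rewrite distrC (distrC s).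
rewrite in_I => /andP[y1 y2]; rewrite (ler0_norm (x := s - t)) ?subr_le0 //.
rewrite /limit_displacement.
case: (leP s 1) => s1; case: (leP t 1) => t1; last 3 first.
- by case: ifPn => y0; rewrite ler_norml; apply/andP; split; nra.
- lra.
- by case: ifPn => y0; rewrite ler_norml; apply/andP; split; lra.
by rewrite ler_norml; apply/andP; split; nra.
Qed.

Lemma Rintegral_min T : 0 < T ->
  (\int[mu]_(t in `[0%R, T]) (Num.min t 1)%:E = (Num.min T 1 ^+ 2 / 2 + excess T)%:E)%E.
Proof.
(* A C^1 primitive of min(t, 1): it is t + (1 - t)^2 / 2 before 1 and t afterwards, [signed_sqr]
   cancelling the quadratic term there. *)
move=> T0; pose F t : R := t + ((1 - t) ^+ 2 + signed_sqr (1 - t)) / 4.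
have D t : is_derive t 1 F (Num.min t 1).
  have D1 : is_derive t 1 (fun t => signed_sqr (1 - t)) (2 * `|1 - t| * -1).
    apply: (@is_derive1_comp _ (@signed_sqr R) (fun t => 1 - t)).
      exact: is_derive_signed_sqr.
    by apply: is_derive_eq; rewrite /GRing.scale /=; ring.
  apply: is_derive_eq; rewrite /GRing.scale /= minElt; case: ltP => t1.
    by rewrite ger0_norm ?subr_ge0 ?ltW //; field.
  by rewrite ler0_norm ?subr_le0 //; field.
have cF : continuous F by move=> t; apply/differentiable_continuous/derivable1_diffP; case: (D t).
rewrite (@continuous_FTC2 _ _ F) //.
- rewrite -EFinD; congr EFin; rewrite /F /signed_sqr /excess minElt maxElt.
  rewrite subr0 normr1; case: (ltP T 1) => T1.
    by rewrite ger0_norm; [case: ifPn; rewrite -?leNgt => ?; [field|lra]|lra].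
  by rewrite ler0_norm; [case: ifPn; rewrite -?leNgt => ?; [lra|field]|lra].
- apply: continuous_subspaceT => t.
  by apply: (@continuous_min _ _ id (cst 1)); [exact: cvg_id|exact: cvg_cst].
- split; first by move=> t _; case: (D t).
    by apply: cvg_at_right_filter; exact: cF.
  by apply: cvg_at_left_filter; exact: cF.
- by move=> t _; rewrite derive1E; case: (D t).
Qed.

(** The density vanishes outside [I], so only the part of a set inside [I] is charged; the default
    zero charge is trivially dominated. Hence [lebI] is admissible in every pairing with regularized
    solutions. *)
Lemma L1_charge_dominated f : L1_charge f `<< (@lebI R).
Proof.
apply/null_content_dominatesP => A mA A0.
rewrite /L1_charge; case: pselect => // h; rewrite /induced_charge.
have Gi := integrable_lebI (integrable_measurable_EFin h)
  (integrableS measurableT measurable_I (@subsetT _ _) h).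
have := lebI_integral mA Gi.
have -> : (\int[mu]_(x in A `&` I) ((f \_ I) x)%:E = \int[mu]_(x in A) ((f \_ I) x)%:E)%E.
  by rewrite integral_mkcondr; apply: eq_integral => y _; rewrite !patchE; case: ifPn => yI; rewrite ?(negbTE yI) ?yI.
move=> e; transitivity (\int[mu]_(x in A) ((f \_ I) x)%:E)%E; first by [].
rewrite -e; apply: null_set_integral => //.
by case/integrableP: (integrableS measurableT mA (@subsetT _ _) Gi).
Qed.

Lemma lebI_dominating m d (g : 'I_m -> 'I_d -> R -> R) :
  dominating (fun i j => L1_charge (g i j)) (@lebI R).
Proof. by split => [i j|]; exact: L1_charge_dominated. Qed.

Lemma delta_pairing_L1 m d (g : 'I_m -> 'I_d -> R -> R) (f : @integrand R m d) :
  Chom f -> (forall i j, mu.-integrable I (EFin \o g i j)) ->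
  delta_pairing (@lebI R) (fun i j => L1_charge (g i j)) f =
  \int[mu]_(y in I) f y (\matrix_(i, j) g i j y) 1.
Proof.
move=> hf gi; rewrite (delta_pairing_density (c := 0) hf (lebI_dominating g) gi).
  by rewrite Chom00 ?addr0 // in_Ibar; apply/andP; split; lra.
by move=> i j A mA; rewrite mxE mul0e adde0.
Qed.

End LimitTools.

(** * Passage to the limit in the regularized solutions *)

Section Evolution.
Context {R : realType}.
Notation mu := (@lebesgue_measure R).
Notation I := (@Defs.I R).
Notation RR := (measurableTypeR R).
Variables (V : R -> R) (M : R) (z0 : R -> R) (u e : R -> R -> R) (nu : @time_family R 2).
Hypothesis hV1 : forall x, derivable V x 1.
Hypothesis hV2 : forall x, derivable (derive1 V) x 1.
Hypothesis hV2b : forall x, - M <= derive1n 2 V x <= 0.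
Hypothesis hVeven : forall x, V x = V (- x).
Hypothesis hV'1 : forall x, derive1 V x = -1 <-> 1 <= x.
Hypothesis z0c : {within Ibar, continuous z0}.
Hypothesis z01 : z0 0 = 1.
Hypothesis z0b : forall y, Ibar y -> y != 0 -> 0 <= z0 y < 1.
Hypothesis hu : Linfloc_BV u.
Hypothesis he : Linfloc_L2 e.
Hypothesis left_u : forall t, 0 <= t -> BV_wstar_cvg (from_left t) u (u t).
Hypothesis left_e : forall t, 0 <= t -> L2_weak_cvg (from_left t) e (e t).
Hypothesis left_nu : SGY_left_continuous nu.
Variables (eps_ : nat -> R) (Theta : set R) (u_ e_ p_ z_ : nat -> R -> R -> R).
Hypothesis eps_gt0 : forall k, 0 < eps_ k.
Hypothesis eps_cvg : eps_ @ \oo --> 0.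
Hypothesis Theta_ge0 : Theta `<=` half_line.
Hypothesis Theta0 : Theta 0.
Hypothesis Theta_full : mu.-negligible (half_line `\` Theta).
Hypothesis sol : forall k, eps_solution (eps_ k) V wR (cst 0) (cst 0) (cst 0) z0
  (u_ k) (e_ k) (p_ k) (z_ k).
Hypothesis cvg_u : forall t, Theta t -> BV_wstar_cvg \oo (fun k => u_ k t) (u t).
Hypothesis cvg_e : forall t, Theta t -> L2_weak_cvg \oo (fun k => e_ k t) (e t).
Hypothesis cvg_nu : forall m (t : 'rV[R]_m), times t -> (forall i, Theta (t 0 i)) ->
  delta_wstar_cvg (fun k i =>
      pair_charge (L1_charge (p_ k (t 0 i))) (L1_charge (z_ k (t 0 i)))) (nu t).

Let z0_01 y : I y -> 0 <= z0 y <= 1.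
Proof.
move=> /I_sub_Ibar Iy; have [->|y0] := eqVneq y 0; first by rewrite z01 lexx ler01.
by case/andP: (z0b Iy y0) => -> /ltW.
Qed.

Let min1_lipschitz (s t : R) : `|Num.min s 1 - Num.min t 1| <= `|s - t|.
Proof.
have n1 := ler_norm (s - t); have n2 : t - s <= `|s - t| by rewrite distrC ler_norm.
move: (`|s - t|) n1 n2 => N n1 n2; rewrite ler_norml !minElt.
by do 2 case: ifPn; rewrite -?leNgt => *; apply/andP; split; lra.
Qed.

Let excess_lipschitz (s t : R) : `|excess s - excess t| <= `|s - t|.
Proof.
have n1 := ler_norm (s - t); have n2 : t - s <= `|s - t| by rewrite distrC ler_norm.
move: (`|s - t|) n1 n2 => N n1 n2; rewrite ler_norml /excess !maxElt.
by do 2 case: ifPn; rewrite -?leNgt => *; apply/andP; split; lra.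
Qed.

Lemma Theta_ge t : Theta t -> 0 <= t.
Proof. by move=> /Theta_ge0; rewrite /half_line /= in_itv /= andbT. Qed.

Lemma near_concentrated r : 0 < r ->
  \forall k \near \oo, concentrated r z0 (u_ k) (e_ k) (p_ k) (z_ k).
Proof.
move=> r0; have [eps0 [eps00 hc]] :=
  eps_solution_concentrated hV1 hV2 hV2b hVeven hV'1 z0c z01 z0b r0.
move/cvgrPdist_le : eps_cvg => /(_ _ eps00); apply: filterS => k.
rewrite sub0r normrN ger0_norm; last exact: ltW.
by move=> ke; apply: hc (sol k); rewrite eps_gt0.
Qed.

(** The common form of the limits of real sequences below: a sufficiently concentrated solution is
    already within [a] of the limit, whatever its index. *)
Lemma concentrated_cvg (X : nat -> R) l :
  (forall a, 0 < a -> exists2 r, 0 < r & forall k,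
    concentrated r z0 (u_ k) (e_ k) (p_ k) (z_ k) -> `|X k - l| <= a) ->
  X @ \oo --> l.
Proof.
move=> hX; apply/cvgrPdist_le => a a0; have [r r0 hr] := hX _ a0.
by apply: filterS (near_concentrated r0) => k /hr; rewrite distrC.
Qed.

(** [Theta] has full measure and so meets every interval of positive times; at [t = 0], where no
    earlier time exists, 0 itself is taken. *)
Lemma Theta_left t l : 0 <= t -> l < t -> exists s, [/\ Theta s, l < s & s <= t].
Proof.
rewrite le_eqVlt => /orP[/eqP <- l0|t0 lt]; first by exists 0.
have aeT : {ae mu, forall y : RR, half_line y -> Theta y}.
  apply: negligibleS Theta_full => y /= /not_implyP[hy Ty]; split => //.
have [||s [/andP[]]] := @ae_exists_itv _ (fun y => half_line y -> Theta y) (Num.max l 0) t.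
- exact: aeT.
- by rewrite gt_max lt t0.
rewrite gt_max => /andP[ls s0] st hs; exists s; split => //; last exact: ltW.
by apply: hs; rewrite /half_line /= in_itv /= ltW.
Qed.

Lemma from_left_pick t (P : set R) d : 0 <= t -> from_left t P -> 0 < d ->
  exists s, [/\ Theta s, `|s - t| < d, s <= t & P s].
Proof.
move=> t0 /nbhs_ballP[q /= q0 hq] d0.
have [|s [Ts ls st]] := @Theta_left t (t - Num.min q d) t0.
  by rewrite ltrBlDr ltrDl lt_min q0.
have sd : `|s - t| < Num.min q d.
  by rewrite ler0_norm ?subr_le0 // opprB ltrBlDl -ltrBlDr.
exists s; split=> //; first by apply: lt_le_trans sd _; rewrite ge_min lexx orbT.
apply: hq; last by rewrite (Theta_ge Ts).
by rewrite /ball /= distrC; apply: lt_le_trans sd _; rewrite ge_min lexx.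
Qed.

(** At times of [Theta] the weak limit is computed on concentrated solutions, whose stress is a
    constant close to min(t, 1). Left continuity and the Lipschitz dependence of min(t, 1) on t
    reach the other times. *)
Lemma e_limit t : 0 <= t -> ae_eqI (e t) (cst (Num.min t 1)).
Proof.
move=> t0; have [L2e _ _] := he.
apply: L2_ip_eq_cst; first exact: L2e.
have onTheta s g : Theta s -> L2 g -> ip (e s) g = Num.min s 1 * \int[mu]_(y in I) g y.
  move=> Ts hg; have s0 := Theta_ge Ts.
  have c1 := cvg_e Ts hg.
  rewrite -(cvg_lim _ c1) //; apply: cvg_lim => //; apply: concentrated_cvg => a a0.
  pose G := \int[mu]_(y in I) g y.
  have gi := L2_integrable hg.
  exists (a / (`|G| + 1)); first by rewrite divr_gt0 // ltr_wpDl.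
  move=> k hc; have /andP[s1 s2] := concentrated_stress hc s0.
  have -> : ip (e_ k s) g = (s - \int[mu]_(y in I) p_ k s y) * G.
    rewrite /ip /G -RintegralZl //; apply: ae_eq_Rintegral.
    - exact: measurable_I.
    - apply: measurable_funM; last exact: L2_measurable.
      exact: integrable_measurable_EFin (concentrated_e_integrable hc s0).
    - by apply: measurable_funM => //; exact: L2_measurable.
    - by apply: ae_imply (concentrated_e hc s0) => y h Iy; rewrite h.
  rewrite -mulrBl normrM.
  apply: (@le_trans _ _ (a / (`|G| + 1) * `|G|)).
    by rewrite ler_wpM2r // ler_norml; apply/andP; split; lra.
  rewrite -mulrA ler_piMr ?(ltW a0) // mulrC ler_pdivrMr ?ltr_wpDl //.
  by rewrite mul1r lerDl.
move=> g hg; have c1 := left_e t0 hg.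
apply/eqP; rewrite -subr_eq0 -normr_le0; apply/ler_addgt0Pr => a a0; rewrite add0r.
pose G := \int[mu]_(y in I) g y.
have a20 : 0 < a / 2 by rewrite divr_gt0.
move/cvgrPdist_le : c1 => /(_ _ a20) c1.
have d0 : 0 < a / 2 / (`|G| + 1) by rewrite divr_gt0 // ltr_wpDl.
have [s [Ts sd st hs]] := from_left_pick t0 c1 d0.
have {}hs : `|ip (e t) g - ip (e s) g| <= a / 2 := hs.
rewrite -/G; move: hs; rewrite (onTheta s g Ts hg) -/G => hs.
have h2 : `|Num.min s 1 * G - Num.min t 1 * G| <= a / 2.
  rewrite -mulrBl normrM; apply: (@le_trans _ _ (`|s - t| * `|G|)).
    by rewrite ler_wpM2r // min1_lipschitz.
  apply: (@le_trans _ _ (a / 2 / (`|G| + 1) * `|G|)).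
    by rewrite ler_wpM2r // ltW.
  rewrite -mulrA ler_piMr ?(ltW a20) // mulrC ler_pdivrMr ?ltr_wpDl //.
  by rewrite mul1r lerDl.
have -> : ip (e t) g - Num.min t 1 * G =
  (ip (e t) g - Num.min s 1 * G) + (Num.min s 1 * G - Num.min t 1 * G) by ring.
apply: le_trans (ler_normD _ _) _; lra.
Qed.

Lemma u_integrable t : 0 <= t -> mu.-integrable I (EFin \o u t).
Proof. by move=> t0; have [nu_ [h _ _]] := hu; case: (h t t0). Qed.

Let dist_u (f g : R -> R) : R := \int[mu]_(y in I) `|f y - g y|.

Let small_dist (S : Type) (F : set_system S) {FF : Filter F} (f_ : S -> R -> R) (f : R -> R) (a : R) :
  BV_wstar_cvg F f_ f -> (\forall s \near F, mu.-integrable I (EFin \o f_ s)) ->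
  mu.-integrable I (EFin \o f) -> 0 < a ->
  \forall s \near F, dist_u (f_ s) f <= a.
Proof.
move=> [c1 _] fi_ fi a0.
move/fine_cvgP : c1 => [_ /cvgrPdist_le/(_ _ a0)]; apply: filter_app.
apply: filterS fi_ => s fs.
rewrite sub0r normrN /= => h; apply: le_trans h; apply: ler_norm.
Qed.

(** The L1 convergence contained in weak* convergence in BV identifies the limit by the triangle
    inequality, through a concentrated solution at times of [Theta] and through a nearby earlier
    time otherwise. *)
Lemma u_limit t : 0 <= t -> ae_eqI (u t) (limit_displacement t).
Proof.
move=> t0; have li s := @limit_displacement_integrable R s.
have onTheta s : Theta s -> dist_u (u s) (limit_displacement s) <= 0.
  move=> Ts; have s0 := Theta_ge Ts; have [cs _] := cvg_u Ts.
  apply/ler_addgt0Pr => a a0; rewrite add0r.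
  have a20 : 0 < a / 2 by rewrite divr_gt0.
  pose r := Num.min 4^-1 (a / 2 / (1 + (4 * s + 4) * 2)).
  have den : 0 < 1 + (4 * s + 4) * 2 by lra.
  have r0 : 0 < r by rewrite lt_min invr_gt0 ltr0n divr_gt0.
  have rh : 0 < r < 2^-1 by rewrite r0 gt_min; apply/orP; left; lra.
  have ra : r + (4 * s + 4) * (2 * r) <= a / 2.
    have : r <= a / 2 / (1 + (4 * s + 4) * 2) by rewrite ge_min lexx orbT.
    by rewrite ler_pdivlMr //; lra.
  have nc := near_concentrated r0.
  have ni : \forall k \near \oo, mu.-integrable I (EFin \o u_ k s).
    by apply: filterS nc => k hc; exact: concentrated_u_integrable hc _ s0.
  have nd : \forall k \near \oo, dist_u (u_ k s) (u s) <= a / 2.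
    by apply: (small_dist (cvg_u Ts) ni (u_integrable s0) a20).
  have [k [hc [hi hd]]] := filter_ex (filterI nc (filterI ni nd)).
  have := displacement_estimate hc s0 rh => hl.
  apply: le_trans (Rintegral_norm_triangle (u_integrable s0) hi (li s)) _.
  have : \int[mu]_(y in I) `|u s y - u_ k s y| <= a / 2.
    apply: le_trans hd; rewrite le_eqVlt; apply/orP; left; apply/eqP.
    by apply: eq_Rintegral => y _; rewrite distrC.
  lra.
apply: (Rintegral_norm_eq0 (u_integrable t0) (li t)).
apply/ler_addgt0Pr => a a0; rewrite add0r.
have a20 : 0 < a / 2 by rewrite divr_gt0.
have ni : \forall s \near from_left t, mu.-integrable I (EFin \o u s).
  by apply: (@filterE _ (nbhs t)) => s /andP[s0 _]; exact: u_integrable.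
have nd : \forall s \near from_left t, dist_u (u s) (u t) <= a / 2.
  by apply: (small_dist (left_u t0) ni (u_integrable t0) a20).
have [s [Ts sd st hs]] := from_left_pick t0 nd a20.
have s0 := Theta_ge Ts.
apply: le_trans (Rintegral_norm_triangle (u_integrable t0) (u_integrable s0) (li t)) _.
have h1 : \int[mu]_(y in I) `|u t y - u s y| <= a / 2.
  apply: le_trans hs; rewrite le_eqVlt; apply/orP; left; apply/eqP.
  by apply: eq_Rintegral => y _; rewrite distrC.
have h2 := Rintegral_norm_triangle (u_integrable s0) (li s) (li t).
have h3 := onTheta _ Ts; rewrite /dist_u in h3.
have h4 : \int[mu]_(y in I) `|limit_displacement s y - limit_displacement t y| <= a / 2.
  apply: (@le_trans _ _ (\int[mu]_(y in I) `|s - t|)); last by rewrite Rintegral_cst_I ltW.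
  apply: le_Rintegral; [exact: measurable_I| |exact: integrable_cst_I|].
    apply: integrable_norm.
    by have := integrableB measurable_I (li s) (li t); apply: eq_integrable.
  by move=> y Iy; exact: limit_displacement_lipschitz.
lra.
Qed.

(* weak* left continuity determines nu from its values on Theta: choose the
   times s_j in Theta just below t_j but above t_i for i < j *)
Lemma nu_extend m (f : integrand m 2) (L : 'rV[R]_m -> R) : Chom f ->
  (forall t : 'rV[R]_m, times t -> (forall i, Theta (t 0 i)) -> nu t f = L t) ->
  (forall (t : 'rV[R]_m) (a : R), 0 < a -> exists2 d, 0 < d &
     forall s : 'rV[R]_m, (forall i, `|s 0 i - t 0 i| < d) -> `|L s - L t| <= a) ->
  forall t : 'rV[R]_m, times t -> nu t f = L t.
Proof.
move=> hf hL cL t tt; have [tge tlt] := tt.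
apply/eqP; rewrite -subr_eq0 -normr_le0; apply/ler_addgt0Pr => a a0; rewrite add0r.
have a20 : 0 < a / 2 by rewrite divr_gt0.
have [d d0 hd] := cL t _ a20.
have /cvgrPdist_le/(_ _ a20) := left_nu tt hf.
rewrite /within /= => /nbhs_ballP[q /= q0 hq].
pose dd := Num.min d q; have dd0 : 0 < dd by rewrite lt_min d0.
have /choice[s hs] : forall j : 'I_m, exists s, [/\ Theta s, `|s - t 0 j| < dd, s <= t 0 j &
    forall i : 'I_m, (i < j)%N -> t 0 i < s].
  move=> j; pose l := \big[Num.max/t 0 j - dd]_(i < m | (i < j)%N) t 0 i.
  have lt : l < t 0 j.
    apply: bigmax_lt => [|i ij]; first by rewrite ltrBlDr ltrDl.
    exact: tlt.
  have [s [Ts ls st]] := Theta_left (tge j) lt.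
  exists s; split => //.
    have : t 0 j - dd < s by apply: le_lt_trans ls; exact: bigmax_ge_id.
    by rewrite ler0_norm ?subr_le0 // opprB; lra.
  by move=> i ij; apply: le_lt_trans ls; exact: le_bigmax_cond.
pose sv : 'rV[R]_m := \row_j s j.
have svE j : sv 0 j = s j by rewrite mxE.
have st : times sv.
  split=> [i|i j ij]; rewrite !svE; first by case: (hs i) => /Theta_ge.
  have [_ _ si _] := hs i; have [_ _ _ sj] := hs j.
  by apply: le_lt_trans si _; exact: sj.
have sT i : Theta (sv 0 i) by rewrite svE; case: (hs i).
have h1 : `|nu t f - nu sv f| <= a / 2.
  apply: hq.
    split=> // i j; rewrite ord1 svE /ball /= distrC; have [_ h _ _] := hs j.
    by apply: lt_le_trans h _; rewrite ge_min lexx orbT.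
  by split => // i; rewrite svE; case: (hs i).
have h2 : `|L sv - L t| <= a / 2.
  apply: hd => i; rewrite svE; have [_ h _ _] := hs i.
  by apply: lt_le_trans h _; rewrite ge_min lexx.
have -> : nu t f - L t = (nu t f - nu sv f) + (L sv - L t) by rewrite (hL _ st sT); ring.
apply: le_trans (ler_normD _ _) _; lra.
Qed.

Let data m (t : 'rV[R]_m) k (i : 'I_m) (j : 'I_2) : R -> R :=
  if j == 0 then p_ k (t 0 i) else z_ k (t 0 i).

(** Since [lebI] dominates all the charges involved, the assumed convergence can be read with it,
    and the pairings become ordinary integrals over [I]. *)
Lemma nu_cvg m (t : 'rV[R]_m) (f : integrand m 2) : Chom f -> times t ->
  (forall i, Theta (t 0 i)) ->
  \int[mu]_(y in I) f y (\matrix_(i, j) data t k i j y) 1 @[k --> \oo] --> nu t f.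
Proof.
move=> hf tt tT.
have dE k : (fun i => pair_charge (L1_charge (p_ k (t 0 i))) (L1_charge (z_ k (t 0 i))))
   = (fun i j => L1_charge (data t k i j)).
  by apply/funext => i; apply/funext => j; rewrite /pair_charge /data; case: ifPn.
have H k : dominating (fun i => pair_charge (L1_charge (p_ k (t 0 i)))
    (L1_charge (z_ k (t 0 i)))) (@lebI R).
  by rewrite dE; exact: lebI_dominating.
apply: cvg_trans (cvg_nu tt tT H hf).
apply: near_eq_cvg; apply: filterS (near_concentrated ltr01) => k hc.
rewrite /= dE delta_pairing_L1 // => i j.
rewrite /data; have t0 := Theta_ge (tT i); case: ifPn => _.
  exact: concentrated_p_integrable hc _ t0.
exact: concentrated_z_integrable hc _ t0.
Qed.

Lemma nu_limit t (f : integrand 1 2) : Chom f -> 0 <= t ->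
  nu (const_mx t : 'rV[R]_1) f = limit_pairing z0 t f.
Proof.
move=> hf t0.
have tt s : 0 <= s -> times (const_mx s : 'rV[R]_1).
  by move=> s0; split=> [i|i j]; rewrite ?mxE // !ord1.
have := @nu_extend 1 f (fun s => limit_pairing z0 (s 0 0) f) hf _ _ _ (tt t t0).
rewrite mxE; apply=> [s _ sT|s a a0].
  have s0 := Theta_ge (sT 0); have sE : s = const_mx (s 0 0).
    by apply/matrixP => i j; rewrite mxE !ord1.
  have c1 := nu_cvg hf (tt _ s0) (fun i => ltac:(rewrite mxE; exact: sT)).
  rewrite {1}sE -(cvg_lim _ c1) //; apply: cvg_lim => //; apply: concentrated_cvg => a a0.
  have [r r0 hr] := pairing_estimate z0c z0_01 hf s0 a0.
  exists r => // k hc.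
  have := hr _ _ _ _ _ (_ : 0 < r <= r) hc; rewrite r0 lexx => /(_ isT).
  congr (`|_ - _| <= _); apply: eq_Rintegral => y _; congr (f _ _ _).
  by apply/matrixP => i j; rewrite !mxE /data !mxE; case: ifPn.
pose K := f 0 (vec2 1 1) 0.
exists (a / (`|K| + 1)); first by rewrite divr_gt0 // ltr_wpDl.
move=> w /(_ 0) hw; rewrite /limit_pairing -/K.
rewrite (_ : _ - _ = (excess (w 0 0) - excess (s 0 0)) * K); last by ring.
rewrite normrM; apply: (@le_trans _ _ (a / (`|K| + 1) * `|K|)).
  by rewrite ler_wpM2r // (le_trans (excess_lipschitz _ _)) // ltW.
rewrite -mulrA ler_piMr ?(ltW a0) // mulrC ler_pdivrMr ?ltr_wpDl //.
by rewrite mul1r lerDl.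
Qed.

(** For concentrated solutions z - z0 = p and p increases in time, so the increments of (p, z) lie
    on the diagonal with nonnegative entries. There [HR] is linear and the pairing is twice the
    increment of the plastic mass. *)
Lemma nu_increment m (t : 'rV[R]_m) (i j : 'I_m) : times t -> (j < i)%N ->
  nu t (fun _ x _ => HR (x i 0 - x j 0) (x i 1 - x j 1)) =
  2 * (excess (t 0 i) - excess (t 0 j)).
Proof.
move=> tt ji; have hf := @Chom_HR_increment R m i j.
apply: (nu_extend (L := fun t => 2 * (excess (t 0 i) - excess (t 0 j))) hf _ _ tt).
  move=> s ts sT; have [_ /(_ _ _ ji) sji] := ts.
  have si := Theta_ge (sT i); have sj := Theta_ge (sT j).
  have c1 := nu_cvg hf ts sT.
  rewrite -(cvg_lim _ c1) //; apply: cvg_lim => //; apply: concentrated_cvg => a a0.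
  (* Both masses lie between their limit minus [r] and their limit, so their difference is off by at
     most [r], and twice it by at most [a]. *)
  exists (a / 2); first by rewrite divr_gt0.
  move=> k hc.
  have pi_ := concentrated_p_integrable hc si; have pj := concentrated_p_integrable hc sj.
  have zi := concentrated_z_integrable hc si; have zj := concentrated_z_integrable hc sj.
  have di : mu.-integrable I (EFin \o (fun y => p_ k (s 0 i) y - p_ k (s 0 j) y)).
    by have := integrableB measurable_I pi_ pj; apply: eq_integrable.
  have E : \int[mu]_(y in I) HR ((\matrix_(i0, j0) data s k i0 j0 y) i 0 - (\matrix_(i0, j0) data s k i0 j0 y) j 0)
      ((\matrix_(i0, j0) data s k i0 j0 y) i 1 - (\matrix_(i0, j0) data s k i0 j0 y) j 1) =
      2 * (\int[mu]_(y in I) p_ k (s 0 i) y - \int[mu]_(y in I) p_ k (s 0 j) y).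
    rewrite -RintegralB // -RintegralZl //; apply: ae_eq_Rintegral.
    - exact: measurable_I.
    - apply: (@Chom_measurable _ _ _ _ hf I
        (fun y => \matrix_(i0, j0) data s k i0 j0 y) (cst 1)) => //.
      + exact: I_sub_Ibar.
      + move=> i0 j0; under eq_fun do rewrite mxE; rewrite /data.
        have s0 := Theta_ge (sT i0); case: ifPn => _.
          exact: integrable_measurable_EFin (concentrated_p_integrable hc s0).
        exact: integrable_measurable_EFin (concentrated_z_integrable hc s0).
    - by apply: measurable_funM => //; exact: integrable_measurable_EFin di.
    - have sij : 0 <= s 0 j <= s 0 i by rewrite sj ltW.
      have := ae_and (concentrated_mono hc sij) (ae_and (concentrated_p hc si) (concentrated_p hc sj)).
      apply: ae_imply => y [hm [hpi hpj]] Iy.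
      have [_ _ zyi] := hpi Iy; have [_ _ zyj] := hpj Iy.
      rewrite !mxE /data /= zyi zyj.
      rewrite (_ : z0 y + _ - _ = p_ k (s 0 i) y - p_ k (s 0 j) y); last by ring.
      by rewrite HR_diag // subr_ge0; exact: hm.
  rewrite E; have [_ h1 h2] := mass_bounds hc si; have [_ h3 h4] := mass_bounds hc sj.
  by rewrite ler_norml; apply/andP; split; lra.
move=> s a a0; exists (a / 4); first by rewrite divr_gt0.
move=> w hw; have h1 := le_trans (excess_lipschitz (w 0 i) (s 0 i)) (ltW (hw i)).
have h2 := le_trans (excess_lipschitz (w 0 j) (s 0 j)) (ltW (hw j)).
move: h1 h2; rewrite !ler_norml => /andP[? ?] /andP[? ?]; apply/andP; split; lra.
Qed.

(** For every dominating measure the pairing splits into the density (0, z0) and the atom (t - 1)^+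
    (1, 1), which is the value found for [nu]. *)
Lemma nu_is_delta t : 0 <= t ->
  is_delta (fun _ : 'I_1 => pair_charge
      (cscale (Num.max (t - 1) 0) (dirac_charge 0))
      (cadd (L1_charge z0) (cscale (Num.max (t - 1) 0) (dirac_charge 0))))
    (nu (const_mx t : 'rV[R]_1)).
Proof.
move=> t0 lam dom f hf; rewrite nu_limit //.
have I0 : Ibar (0 : R) by rewrite in_Ibar; apply/andP; split; lra.
pose g (i : 'I_1) (j : 'I_2) : R -> R := if j == 0 then cst 0 else z0.
have gi i j : mu.-integrable I (EFin \o g i j).
  by rewrite /g; case: ifPn => _; [exact: integrable_cst_I|exact: z0_integrable].
rewrite (delta_pairing_density (g := g) (c := excess t *: vec2 1 1) hf dom gi).
  rewrite /limit_pairing; congr (_ + _).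
    apply: eq_Rintegral => y _; congr (f _ _ _).
    by apply/matrixP => i j; rewrite !mxE /g; case: ifPn.
  by rewrite -(Chom_scale hf) ?excess_ge0 // mulr0.
move=> i j A mA; rewrite !mxE /pair_charge /g; case: ifPn => _; rewrite mulr1 //.
rewrite L1_chargeE; last exact: integrable_cst_I.
rewrite integral0_eq ?add0e // => y _; rewrite patchE.
by case: ifPn.
Qed.

(** The sum telescopes to the same value for every partition, so the supremum is over a singleton; 0
    < T makes the two-point partition admissible, which shows that it is not empty. *)
Lemma dissipation_excess T : 0 < T -> dissipation nu 0 T = (2 * excess T)%:E.
Proof.
move=> T0; have sumE k (t : 'rV[R]_k.+1) : times t -> t 0 ord0 = 0 -> t 0 ord_max = T ->
    \sum_(i < k) nu t (fun _ x _ =>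
               HR (x (lift ord0 i) 0 - x (widen_ord (leqnSn k) i) 0)
                  (x (lift ord0 i) 1 - x (widen_ord (leqnSn k) i) 1)) = 2 * excess T.
  move=> tt t00 tT; pose F n := 2 * excess (t 0 (inord n)).
  transitivity (\sum_(0 <= n < k) (F n.+1 - F n)).
    rewrite big_mkord; apply: eq_bigr => i _; rewrite nu_increment //.
    rewrite mulrBr /F; congr (2 * excess (t 0 _) - 2 * excess (t 0 _)); apply: val_inj => /=.
      by rewrite inordK // ltnS.
    by rewrite inordK // ltnS ltnW.
  rewrite telescope_sumr // /F.
  have -> : inord k = ord_max :> 'I_k.+1 by apply: val_inj; rewrite /= inordK.
  have -> : inord 0 = ord0 :> 'I_k.+1 by apply: val_inj; rewrite /= inordK.
  by rewrite tT t00 {2}/excess max_r ?mulr0 ?subr0 //; lra.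
rewrite /dissipation (_ : [set r | _] = [set (2 * excess T)%:E]) ?ereal_sup1 //.
apply/seteqP; split => [_ [k [t [tt t00 tT ->]]]|_ ->]; first by rewrite /= sumE.
pose t : 'rV[R]_2 := \row_j (if j == ord0 then 0 else T).
have tt : times t.
  split=> [i|i j ij]; rewrite !mxE; first by case: ifPn => _ //; exact: ltW.
  have -> : i = ord0 by apply: val_inj; case: i j ij => [[|[|?]] ?] [[|[|?]] ?].
  by rewrite eqxx; case: ifPn => // /eqP j0; rewrite j0 in ij.
exists 1%N, t; split => //; rewrite ?mxE //.
by rewrite sumE // mxE.
Qed.

Lemma ip_e_const t (c : R) : 0 <= t -> ip (e t) (cst c) = Num.min t 1 * c.
Proof.
move=> t0; have [L2e _ _] := he; rewrite /ip -(Rintegral_cst_I (Num.min t 1 * c)).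
apply: ae_eq_Rintegral.
- exact: measurable_I.
- by apply: measurable_funM => //; exact: L2_measurable (L2e _ t0).
- exact: measurable_cst.
- by apply: ae_imply (e_limit t0) => y h Iy; rewrite h.
Qed.

(** The recession function is -1 at 1, so the atom lowers the internal energy by (T - 1)^+. This
    pays for half of the dissipation 2 (T - 1)^+, and the other half is the work of the unit stress
    after time 1. *)
Lemma energy_balance T : 0 < T ->
  ((2^-1)%:E * normL2 (e T) ^+ 2 + dissipation nu 0 T
       + (nu (const_mx T : 'rV[R]_1) (fun _ x eta => persp V (x 0 1) eta))%:E
     = \int[mu]_(y in I) (V (z0 y))%:E
       + \int[mu]_(t in `[0%R, T])
           (ip (e t) (derive1 (fun y => derive1 (wR ^~ y) t)))%:E)%E.
Proof.
move=> T0; have [L2e _ _] := he; have T0' := ltW T0.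
have hp := Chom_persp hV1 hVeven hV'1.
have -> : (\int[mu]_(t in `[0%R, T]) (ip (e t) (derive1 (fun y => derive1 (wR ^~ y) t)))%:E =
    (Num.min T 1 ^+ 2 / 2 + excess T)%:E)%E.
  rewrite -Rintegral_min //; apply: eq_integral => t; rewrite inE /= in_itv /= => /andP[t0 _].
  have -> : (fun y : R => derive1 (wR ^~ y) t) = id.
    apply/funext => y; rewrite /wR.
    have D : is_derive t 1 (fun s : R => s * y) y.
      by apply: is_derive_eq; rewrite /GRing.scale /=; ring.
    by rewrite derive1E; case: D.
  have -> : derive1 (id : R -> R) = cst 1 by apply/funext => y; rewrite derive1_id.
  by rewrite ip_e_const // mulr1.
have -> : (normL2 (e T) ^+ 2 = (Num.min T 1 ^+ 2)%:E)%E.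
  rewrite normL2_sqr (integrable_EFin_Rintegral measurable_I (L2_sqr_integrable (L2e _ T0'))).
  congr EFin; rewrite -[RHS]Rintegral_cst_I; apply: ae_eq_Rintegral.
  - exact: measurable_I.
  - by apply: measurable_funX; exact: L2_measurable (L2e _ T0').
  - exact: measurable_cst.
  - by apply: ae_imply (e_limit T0') => y h Iy; rewrite h.
have Vi : mu.-integrable I (EFin \o (fun y => V (z0 y))).
  apply: eq_integrable (vec2_integrable hp (integrable_cst_I 0) (z0_integrable z0c z0_01)).
    exact: measurable_I.
  by move=> y _; rewrite /= mxE /= /persp ltr01 mul1r divr1.
rewrite dissipation_excess // nu_limit //.
have -> : (\int[mu]_(y in I) (V (z0 y))%:E = (\int[mu]_(y in I) V (z0 y))%:E)%E.
  exact: integrable_EFin_Rintegral.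
have -> : limit_pairing z0 T (fun _ x eta => persp V (x 0 1) eta) =
    \int[mu]_(y in I) V (z0 y) - excess T.
  rewrite /limit_pairing; congr (_ + _).
    by apply: eq_Rintegral => y _; rewrite mxE /= /persp ltr01 mul1r divr1.
  by rewrite mxE /= /persp ltxx (VinfE hV1 hVeven hV'1) normr1 mulrN1.
by rewrite -!EFinM -!EFinD; congr EFin; ring.
Qed.

End Evolution.

(** * The limit evolution with its dissipation and energy balance *)

Theorem theorem8p1 (R : realType) (V : R -> R) (M : R) (z0 : R -> R)
    (u e : R -> R -> R) (nu : time_family 2)
    (hM : 0 <= M)
    (hV1 : forall x, derivable V x 1)
    (hV2 : forall x, derivable V^`() x 1)
    (hV2c : continuous V^`(2))
    (hV2b : forall x, - M <= V^`(2) x <= 0)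
    (hVeven : forall x, V x = V (- x))
    (hV'1 : forall x, V^`() x = -1 <-> 1 <= x)
    (hz0c : {within Ibar, continuous z0})
    (hz00 : z0 0 = 1)
    (hz0b : forall y, Ibar y -> y != 0 -> 0 <= z0 y < 1)
    (hev : approximable_evolution V wR (cst 0) (cst 0) (cst 0) z0 u e nu) :
  (forall t, 0 <= t ->
    [/\ ae_eqI (u t) (fun y =>
          if t <= 1 then t * y
          else if 0 < y then y + (t - 1) / 2 else y - (t - 1) / 2),
        ae_eqI (e t) (fun=> Num.min t 1) &
        is_delta (fun _ : 'I_1 => pair_charge
            (cscale (Num.max (t - 1) 0) (dirac_charge 0))
            (cadd (L1_charge z0)
                  (cscale (Num.max (t - 1) 0) (dirac_charge 0))))
          (nu 1%N (const_mx t))]) /\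
  (forall T, 0 < T ->
    dissipation nu 0 T = (2 * Num.max (T - 1) 0)%:E /\
    ((2^-1)%:E * normL2 (e T) ^+ 2 + dissipation nu 0 T
       + (nu 1%N (const_mx T) (fun _ x eta => persp V (x 0 1) eta))%:E
     = \int[lebesgue_measure]_(y in I) (V (z0 y))%:E
       + \int[lebesgue_measure]_(t in `[0%R, T])
           (ip (e t) (derive1 (fun y => derive1 (wR ^~ y) t)))%:E)%E).
Proof.
have [[hu he hnu] [lu le_ lnu] [eps_]] := hev.
case=> Theta [u_ [e_ [p_ [z_ [[eps0 epsc] [Ts T0 Tf] sol cue cnu]]]]].
have cu t (Tt : Theta t) := (cue t Tt).1; have ce t (Tt : Theta t) := (cue t Tt).2.
split=> [t t0|T T0'].
  split.
  - exact: (u_limit hV1 hV2 hV2b hVeven hV'1 hz0c hz00 hz0b hu lu eps0 epsc Ts T0 Tf sol cu).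
  - exact: (e_limit hV1 hV2 hV2b hVeven hV'1 hz0c hz00 hz0b he le_ eps0 epsc Ts T0 Tf sol ce).
  - exact: (nu_is_delta hV1 hV2 hV2b hVeven hV'1 hz0c hz00 hz0b lnu eps0 epsc Ts T0 Tf sol cnu).
split.
  exact: (dissipation_excess hV1 hV2 hV2b hVeven hV'1 hz0c hz00 hz0b lnu eps0 epsc Ts T0 Tf sol cnu).
exact: (energy_balance hV1 hV2 hV2b hVeven hV'1 hz0c hz00 hz0b he le_ lnu eps0 epsc Ts T0 Tf sol ce cnu).
Qed.
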